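(* Let $\mathbf{c}=(c_1,\dots,c_n)$ and $\bar{\mathbf{c}}=(\bar c_1,\dots,\bar c_n)$ be (nonnegative) renormalized solutions of the Maxwell--Stefan system on $\mathbb{T}^3\times(0,\infty)$ (with velocities $u_i$ and $\bar u_i$, respectively) emanating from the same initial data, and suppose that $c_iu_i$ and $\bar c_i\bar u_i$ belong to $L^\infty(\mathbb{T}^3\times(0,\infty))$ for all $i=1,\dots,n$. Then $\mathbf{c}=\bar{\mathbf{c}}$; that is, for given initial data there is at most one nonnegative renormalized solution of the Maxwell--Stefan system with bounded fluxes.
   Context: $\mathbb{T}^3$ is the 3-dimensional torus, $n\ge 2$, and $D_{ij}=D_{ji}>0$ ($i\neq j$) are given constants. The Maxwell--Stefan system for concentrations $\mathbf{c}=(c_1,\dots,c_n)$ and velocities $u_i(x,t)\in\mathbb{R}^3$, with fluxes $J_i=c_iu_i$, is $$\partial_t c_i+\nabla\cdot(c_iu_i)=0,\qquad i=1,\dots,n,$$ together with the constrained linear system $$-\sum_{j\neq i}\frac{c_jJ_i-c_iJ_j}{D_{ij}}=\nabla c_i\quad (i=1,\dots,n),\qquad \sum_{i=1}^nJ_i=0, \qquad (\ast)$$ and initial conditions $c_i(x,0)=c_i^0(x)$. The initial data always satisfy $0\le c_i^0\in L^\infty(\mathbb{T}^3)$, $\sum_{i=1}^nc_i^0=1$, and $H(\mathbf{c}^0)=\int_{\mathbb{T}^3}\sum_ic_i^0(\ln c_i^0-1)\,dx<+\infty$. Renormalized solution: $\mathbf{c}$ (with velocities $u_i$) is a renormalized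 solution with initial data $\mathbf{c}^0$ if for all $i$: (i) $0\le c_i\le1$ and $\sum_ic_i=1$; (ii) $\nabla\sqrt{c_i}\in L^2(\mathbb{T}^3\times(0,T))$ and $\sqrt{c_i}\,u_i\in L^2(\mathbb{T}^3\times(0,T))$ for every $T>0$; (iii) for every $\phi_i\in C_c^\infty(\mathbb{T}^3\times[0,\infty))$ and every $\beta\in C^2([0,\infty))$, $$\int_{\mathbb{T}^3}\beta(c_i^0)\phi_i(x,0)\,dx+\int_0^\infty\!\!\int_{\mathbb{T}^3}\beta(c_i)\partial_t\phi_i\,dx\,dt+\int_0^\infty\!\!\int_{\mathbb{T}^3}\sqrt{c_i}\,\beta'(c_i)\sqrt{c_i}\,u_i\cdot\nabla\phi_i\,dx\,dt+2\int_0^\infty\!\!\int_{\mathbb{T}^3}c_i\beta''(c_i)\nabla\sqrt{c_i}\cdot\sqrt{c_i}\,u_i\,\phi_i\,dx\,dt=0,$$ and $J_i=c_iu_i$ satisfies $(\ast)$; (iv) $\lim_{t\to0}\int_{\mathbb{T}^3}|\beta(c_i(x,t))-\beta(c_i^0(x))|\,dx=0$ for every $\beta\in C^2([0,\infty))$. Equality of solutions is understood almost everywhere on $\mathbb{T}^3\times(0,\infty)$. *)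

(* Defs.v *)
From HB Require Import structures.
From mathcomp Require Import all_boot all_order all_algebra.
From mathcomp Require Import all_classical all_reals all_analysis.

Set Implicit Arguments.
Unset Strict Implicit.
Unset Printing Implicit Defensive.

Import Order.TTheory GRing.Theory Num.Theory.
Import numFieldNormedType.Exports.

Local Open Scope classical_set_scope.
Local Open Scope ring_scope.

(* [m1 \x m2] under a name that carries the sigma-finite structure, so that it
   can be the left factor of another product in Fubini's theorem. *)
Section ProductMeasure.
Context {d1 d2 : measure_display} {T1 : measurableType d1}
  {T2 : measurableType d2} {R : realType}.
Variables (m1 : {sigma_finite_measure set T1 -> \bar R})
  (m2 : {sigma_finite_measure set T2 -> \bar R}).

Definition prod_measure := (m1 \x m2)%E.

HB.instance Definition _ := Measure.on prod_measure.

Let prod_measure_sigma_finite : sigma_finite setT prod_measure.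
Proof.
have /sigma_finiteP[F [TF ndF Foo]] := sigma_finiteT m1.
have /sigma_finiteP[G [TG ndG Goo]] := sigma_finiteT m2.
exists (fun n => F n `*` G n).
  rewrite -setXTT TF TG predeqE => -[x y]; split.
    move=> [/= [n _ Fnx] [k _ Gky]]; exists (maxn n k) => //; split.
    - by move: x Fnx; exact/subsetPset/ndF/leq_maxl.
    - by move: y Gky; exact/subsetPset/ndG/leq_maxr.
  by move=> [n _ []/= ? ?]; split; exists n.
move=> k; have [? ?] := Foo k; have [? ?] := Goo k.
split; first exact: measurableX.
by rewrite /prod_measure product_measure1E// lte_mul_pinfty// ge0_fin_numE.
Qed.

HB.instance Definition _ :=
  Measure_isSigmaFinite.Build _ _ _ prod_measure prod_measure_sigma_finite.

End ProductMeasure.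

Notation space3 R := (R * R * R)%type.
Notation spacetime R := (R * R * R * R)%type.

(* Functions on the torus T^3 = R^3/Z^3 are encoded as functions on R^3 that
   are 1-periodic in each variable; an integral over T^3 is an integral over
   the cell [0,1)^3. A point of T^3 x R is a pair (x, t). Functions on
   T^3 x (0,oo) are total; apart from periodicity in x, nothing is required of
   their values at times t <= 0, which can be taken to be 0. *)
Section TorusCylinder.
Context {R : realType}.

Definition leb1 : {sigma_finite_measure set _ -> \bar R} := @lebesgue_measure R.
Definition leb3 : {sigma_finite_measure set _ -> \bar R} :=
  prod_measure (prod_measure leb1 leb1) leb1.
Definition leb4 : {sigma_finite_measure set _ -> \bar R} :=
  prod_measure leb3 leb1.

Definition cell : set (space3 R) :=
  `[0, 1[%classic `*` `[0, 1[%classic `*` `[0, 1[%classic.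

Definition cylinder (I : set R) : set (spacetime R) := cell `*` I.

Definition basis (k : 'I_3) : space3 R :=
  ((k == 0%N :> nat)%:R, (k == 1%N :> nat)%:R, (k == 2%N :> nat)%:R).

Definition dx (k : 'I_3) (f : spacetime R -> R)
  : spacetime R -> R := 'D_((basis k, 0)) f.

Definition dt (f : spacetime R -> R)
  : spacetime R -> R := 'D_((0, 1)) f.

Definition torus_periodic (f : space3 R -> R) : Prop :=
  forall k x, f (x + basis k) = f x.

Definition torus_periodic_in_space (f : spacetime R -> R) : Prop :=
  forall t, torus_periodic (fun x => f (x, t)).

(* C^oo: every iterated directional derivative is differentiable everywhere. *)
Definition smooth (f : spacetime R -> R) : Prop :=
  forall (vs : seq (spacetime R)) z,
    differentiable (foldr (fun v g => 'D_v g) f vs) z.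

(* C_c^oo(T^3 x [0,oo)): restrictions to t >= 0 of smooth functions on T^3 x R,
   with bounded support in t; they need not vanish at t = 0. *)
Record test_function (phi : spacetime R -> R) : Prop := TestFunction {
  test_smooth : smooth phi;
  test_periodic : torus_periodic_in_space phi;
  test_support : exists T, forall x t, T <= t -> phi (x, t) = 0
}.

(* C_c^oo(T^3 x (0,oo)) *)
Definition interior_test_function (phi : spacetime R -> R) : Prop :=
  test_function phi /\
  exists2 a, 0 < a & forall x t, t <= a -> phi (x, t) = 0.

(* L^1_loc(T^3 x (0,oo)) *)
Definition L1loc (f : spacetime R -> R) : Prop :=
  forall a b, 0 < a -> a < b ->
    leb4.-integrable (cylinder `[a, b]%classic) (EFin \o f).

(* g is the k-th spatial derivative of f in the sense of distributions on
   T^3 x (0,oo). *)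
Definition weak_dx (k : 'I_3) (f g : spacetime R -> R) : Prop :=
  [/\ L1loc f, L1loc g &
    forall phi, interior_test_function phi ->
      \int[leb4]_(z in cylinder `]0, +oo[%classic) (f z * dx k phi z) =
      - \int[leb4]_(z in cylinder `]0, +oo[%classic) (g z * phi z)].

(* b belongs to C^2([0,oo)), with first and second derivatives b1 and b2; the
   values of the three functions at negative arguments are irrelevant, and the
   one-sided derivatives at 0 are the continuous extensions. *)
Record C2_halfline (b b1 b2 : R -> R) : Prop := C2Halfline {
  C2_cont0 : {within `[0, +oo[%classic, continuous b};
  C2_cont1 : {within `[0, +oo[%classic, continuous b1};
  C2_cont2 : {within `[0, +oo[%classic, continuous b2};
  C2_derive1 : forall s : R, 0 < s -> is_derive s 1 b (b1 s);
  C2_derive2 : forall s : R, 0 < s -> is_derive s 1 b1 (b2 s)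
}.

End TorusCylinder.

Section MaxwellStefan.
Context {R : realType} {n : nat}.
Implicit Types (D : 'I_n -> 'I_n -> R) (init : 'I_n -> space3 R -> R)
  (c : 'I_n -> spacetime R -> R)
  (u : 'I_n -> 'I_3 -> spacetime R -> R)
  (g : 'I_n -> 'I_3 -> spacetime R -> R).

(* The entropy integrand uses [ln 0 = 0], so that 0 * (ln 0 - 1) = 0. *)
Record initial_data init : Prop := InitialData {
  init_periodic : forall i, torus_periodic (init i);
  init_bounded : forall i, (init i \_ cell) \in Lfun leb3 +oo%E;
  init_ge0 : forall i, \forall x \ae leb3, cell x -> 0 <= init i x;
  init_sum : \forall x \ae leb3, cell x -> \sum_i init i x = 1;
  init_entropy :
    (\int[leb3]_(x in cell) (\sum_i init i x * (ln (init i x) - 1))%:E < +oo)%E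
}.

(* u i k is the k-th component of the velocity of the i-th species. *)
Definition flux c u i k z : R := c i z * u i k z.

Definition wvel c u i k z : R := Num.sqrt (c i z) * u i k z.

(* The first clause says that the left-hand side of the linear system is the
   distributional gradient of c_i. *)
Definition flux_gradient_system D c u : Prop :=
  (forall i k, weak_dx k (c i) (fun z =>
     - \sum_(j | j != i)
         (c j z * flux c u i k z - c i z * flux c u j k z) / D i j)) /\
  (forall k, \forall z \ae leb4, cylinder `]0, +oo[%classic z ->
     \sum_i flux c u i k z = 0).

(* g i stands for the weak spatial gradient of sqrt(c_i), whose existence is
   part of the definition of a solution. *)
Definition renormalized_equation init c u g i : Prop :=
  forall (phi : spacetime R -> R) (b b1 b2 : R -> R),
    test_function phi -> C2_halfline b b1 b2 ->
    let Q := cylinder `]0, +oo[%classic in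
    \int[leb3]_(x in cell) (b (init i x) * phi (x, 0))
    + \int[leb4]_(z in Q) (b (c i z) * dt phi z)
    + \int[leb4]_(z in Q) (\sum_(k < 3)
        Num.sqrt (c i z) * b1 (c i z) * wvel c u i k z * dx k phi z)
    + 2 * \int[leb4]_(z in Q) (\sum_(k < 3)
        c i z * b2 (c i z) * g i k z * wvel c u i k z * phi z) = 0.

(* The limit t -> 0+ runs over almost every t, so that it depends only on the
   a.e. class of c. *)
Definition attains_initial_data init c i : Prop :=
  forall (b b1 b2 : R -> R), C2_halfline b b1 b2 ->
    forall eps : R, 0 < eps -> exists2 delta : R, 0 < delta &
      \forall t \ae leb1, 0 < t < delta ->
        (\int[leb3]_(x in cell) `|b (c i (x, t)) - b (init i x)|%:E < eps%:E)%E.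

Record renormalized_with_gradient D init c u g : Prop := RenormalizedWith {
  renorm_c_periodic : forall i, torus_periodic_in_space (c i);
  renorm_u_periodic : forall i k, torus_periodic_in_space (u i k);
  renorm_measurable : forall i,
    measurable_fun (cylinder `]0, +oo[%classic) (c i);
  renorm_bounds : forall i, \forall z \ae leb4,
    cylinder `]0, +oo[%classic z -> 0 <= c i z <= 1;
  renorm_sum : \forall z \ae leb4,
    cylinder `]0, +oo[%classic z -> \sum_i c i z = 1;
  renorm_gradient : forall i k,
    weak_dx k (fun z => Num.sqrt (c i z)) (g i k);
  renorm_gradient_L2 : forall i k (T : R), 0 < T ->
    (g i k \_ (cylinder `]0, T[%classic)) \in Lfun leb4 2%:E;
  renorm_velocity_L2 : forall i k (T : R), 0 < T ->
    (wvel c u i k \_ (cylinder `]0, T[%classic)) \in Lfun leb4 2%:E;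
  renorm_equation : forall i, renormalized_equation init c u g i;
  renorm_system : flux_gradient_system D c u;
  renorm_initial : forall i, attains_initial_data init c i
}.

Definition renormalized_solution D init c u : Prop :=
  exists g, renormalized_with_gradient D init c u g.

Definition bounded_fluxes c u : Prop := forall i k,
  (flux c u i k \_ (cylinder `]0, +oo[%classic)) \in Lfun leb4 +oo%E.

End MaxwellStefan.

(* Main.v *)
Require Import Defs.
From HB Require Import structures.
From mathcomp Require Import all_boot all_order all_algebra.
From mathcomp Require Import all_classical all_reals all_analysis.
From mathcomp Require Import measurable_realfun ess_sup_inf ring lra.

Set Implicit Arguments.
Unset Strict Implicit.
Unset Printing Implicit Defensive.

Import Order.TTheory GRing.Theory Num.Theory.
Import numFieldNormedType.Exports.

Local Open Scope classical_set_scope.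
Local Open Scope ring_scope.

(** Uniqueness is an energy estimate for the difference of two solutions after
mollification. Write [w = c - cb] for the difference of the concentrations and
[f = J - Jb] for that of the fluxes, and let [C], [W], [F] be the mollified
[c], [w], [f]. The energy is

  [\sum_i \int W_i ^+ 2 / (C_i + kappa)],

the quadratic part of the relative entropy, shifted by a small constant [kappa]
so that it stays smooth where a concentration vanishes. Set
[Y_i = W_i / (C_i + kappa)].

- The renormalized equation with [beta = id] and a mollification kernel as test
  function is the mass balance of the mollified fields, and the linear system
  tested against the same kernel expresses the gradient of [C_i] as a mollified
  product of concentrations and fluxes ([clean_solution]). The gradient of [W_i]
  is thereby an algebraic expression in [C], [W], [F] and bounded fluxes, up to
  a commutator [E_i]; no derivative has to be estimated.

- By the mass balances, the time derivative of the energy is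
  [2 * \sum_i \int (F_i - Y_i J_i) . grad Y_i] ([energy_identity]). The
  terms that are quadratic in [F] are a dissipation of at least
  [delta / 2 * \sum_i F_i ^+ 2 / (C_i + kappa)]: without the shift it is half
  the sum of [a_ij C_i C_j (v_i - v_j) ^+ 2] with [F_i = C_i v_i], which
  controls [\sum_i C_i v_i ^+ 2] because the [F_i] sum to zero, and the error
  made by the shift is absorbed when [kappa] is small ([friction_coercive]).
  Every other term contains a factor [W_i] or [E_i], and the fluxes are
  bounded, so that Young's inequality bounds the whole by
  [K * (\sum_i W_i ^+ 2 + \sum_i |E_i|)] ([energy_density_bound]). An
  exponential weight in time then plays the role of Gronwall's lemma
  ([energy_estimate]).

- A commutator is bounded by the average of [|c z - c z'|] against the kernel,
  the oscillation of [c] at the scale of the kernel. The integral of the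
  oscillation tends to 0 for every bounded measurable function: the sets whose
  indicator has this property form a sigma-algebra that contains the coordinate
  half-spaces ([oscillation_vanishes]).

- The kernels average over strictly later times. Hence the mollified fields
  make sense and solve the equations down to time 0 without an extension to
  negative times, and the energy at time 0 tends to 0 because both solutions
  attain the same initial data ([mollified_trace_vanishes]).

Letting the scale of the kernel tend to 0 gives [w = 0] on every bounded time
interval ([bounded_flux_uniqueness]).

In space the kernel is a product of normalised powers of [cos (pi * s)]: these
are periodic, and concentrate at the integers as the exponent grows, so that the
convolution on the torus is an integral over one cell and no cut-off is needed.
*)

(** * Integrals of bounded functions over sets of finite measure *)

Section BoundedMeasurable.
Context {R : realType}.

(** Bounded at every point and measurable on the whole space. This class is stable
under products, sections and partial integrals, and its members are integrable
on every set of finite measure, so that linearity, Fubini's theorem and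
dominated convergence apply to them without further conditions. *)
Definition bmeas d (T : measurableType d) (f : T -> R) : Prop :=
  measurable_fun setT f /\ exists M : R, forall x, `|f x| <= M.

Context d (T : measurableType d).
Implicit Types (f g : T -> R).

Lemma bmeas_cst (r : R) : bmeas (fun _ : T => r).
Proof. by split; [exact: measurable_cst|exists `|r|]. Qed.

Lemma bmeasD f g : bmeas f -> bmeas g -> bmeas (fun x => f x + g x).
Proof.
move=> [mf [M fM]] [mg [N gN]]; split; first exact: measurable_funD.
by exists (M + N) => x; rewrite (le_trans (ler_normD _ _))// lerD.
Qed.

Lemma bmeasN f : bmeas f -> bmeas (fun x => - f x).
Proof.
move=> [mf [M fM]]; split; first exact: measurableT_comp.
by exists M => x; rewrite normrN.
Qed.

Lemma bmeasB f g : bmeas f -> bmeas g -> bmeas (fun x => f x - g x).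
Proof. by move=> bf bg; apply: bmeasD => //; exact: bmeasN. Qed.

Lemma bmeasM f g : bmeas f -> bmeas g -> bmeas (fun x => f x * g x).
Proof.
move=> [mf [M fM]] [mg [N gN]]; split; first exact: measurable_funM.
by exists (M * N) => x; rewrite normrM ler_pM.
Qed.

Lemma bmeasZ r f : bmeas f -> bmeas (fun x => r * f x).
Proof. by move=> bf; apply: bmeasM => //; exact: bmeas_cst. Qed.

Lemma bmeas_norm f : bmeas f -> bmeas (fun x => `|f x|).
Proof.
move=> [mf [M fM]]; split; first exact: measurableT_comp.
by exists M => x; rewrite normr_id.
Qed.

Lemma bmeasX f n : bmeas f -> bmeas (fun x => f x ^+ n).
Proof.
move=> bf; elim: n => [|n IHn]; first exact: bmeas_cst.
by under eq_fun do rewrite exprS; exact: bmeasM.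
Qed.

Lemma bmeas_sum (I : Type) (s : seq I) (P : pred I) (F : I -> T -> R) :
  (forall i, bmeas (F i)) -> bmeas (fun x => \sum_(i <- s | P i) F i x).
Proof.
move=> bF; elim: s => [|i s IHs].
  by under eq_fun do rewrite big_nil; exact: bmeas_cst.
under eq_fun do rewrite big_cons; case: (P i) => //; exact: bmeasD.
Qed.

Lemma bmeas_comp d' (T' : measurableType d') (h : T' -> T) f :
  measurable_fun setT h -> bmeas f -> bmeas (fun x => f (h x)).
Proof.
move=> mh [mf [M fM]]; split; first exact: measurableT_comp mf mh.
by exists M.
Qed.

Lemma bmeas_indic (A : set T) : measurable A -> bmeas (\1_A : T -> R).
Proof.
move=> mA; split; first exact: measurable_indic.
by exists 1 => x; rewrite indicE; case: (x \in A); rewrite ?normr1 ?normr0.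
Qed.

Context (mu : {measure set T -> \bar R}) (D : set T)
  (mD : measurable D) (finD : (mu D < +oo)%E).

Lemma bmeas_integrable f : bmeas f -> mu.-integrable D (EFin \o f).
Proof.
move=> [mf [M fM]]; apply: measurable_bounded_integrable => //.
  exact: measurable_funTS.
exists M; split; first exact: num_real.
by move=> x Mx y _ /=; rewrite (le_trans (fM y))// ltW.
Qed.

Lemma bint_EFin f : bmeas f ->
  (\int[mu]_(x in D) f x)%:E = (\int[mu]_(x in D) (f x)%:E)%E.
Proof.
by move=> bf; rewrite /Rintegral fineK//; exact/integrable_fin_num/bmeas_integrable.
Qed.

Lemma bintD f g : bmeas f -> bmeas g ->
  \int[mu]_(x in D) (f x + g x) = \int[mu]_(x in D) f x + \int[mu]_(x in D) g x.
Proof. by move=> bf bg; apply: RintegralD => //; exact: bmeas_integrable. Qed.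

Lemma bintB f g : bmeas f -> bmeas g ->
  \int[mu]_(x in D) (f x - g x) = \int[mu]_(x in D) f x - \int[mu]_(x in D) g x.
Proof. by move=> bf bg; apply: RintegralB => //; exact: bmeas_integrable. Qed.

Lemma bintZ r f : bmeas f ->
  \int[mu]_(x in D) (r * f x) = r * \int[mu]_(x in D) f x.
Proof. by move=> bf; apply: RintegralZl => //; exact: bmeas_integrable. Qed.

Lemma bintN f : bmeas f ->
  \int[mu]_(x in D) (- f x) = - \int[mu]_(x in D) f x.
Proof.
move=> bf; rewrite -mulN1r -bintZ//.
by apply: eq_Rintegral => x _; rewrite mulN1r.
Qed.

Lemma bint_sum (I : Type) (s : seq I) (P : pred I) (F : I -> T -> R) :
  (forall i, bmeas (F i)) ->
  \int[mu]_(x in D) (\sum_(i <- s | P i) F i x) =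
  \sum_(i <- s | P i) \int[mu]_(x in D) F i x.
Proof.
move=> bF; elim: s => [|i s IHs].
  under eq_Rintegral do rewrite big_nil.
  by rewrite big_nil Rintegral_cst// mul0r.
under eq_Rintegral do rewrite big_cons.
rewrite big_cons; case: (P i) => //.
by rewrite bintD// ?IHs//; exact: bmeas_sum.
Qed.

Lemma le_bint f g : bmeas f -> bmeas g -> (forall x, D x -> f x <= g x) ->
  \int[mu]_(x in D) f x <= \int[mu]_(x in D) g x.
Proof. by move=> bf bg; apply: le_Rintegral => //; exact: bmeas_integrable. Qed.

Lemma le_norm_bint f g : bmeas f -> bmeas g -> (forall x, D x -> `|f x| <= g x) ->
  `|\int[mu]_(x in D) f x| <= \int[mu]_(x in D) g x.
Proof.
move=> bf bg fg; apply: (le_trans (le_normr_Rintegral _ _)) => //.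
  exact: bmeas_integrable.
by apply: le_bint => //; exact: bmeas_norm.
Qed.

Lemma le_bint_cst f M : bmeas f -> (forall x, D x -> f x <= M) ->
  \int[mu]_(x in D) f x <= M * fine (mu D).
Proof.
by move=> bf fM; rewrite -Rintegral_cst//; apply: le_bint => //; exact: bmeas_cst.
Qed.

Lemma le_norm_bint_cst f M : bmeas f -> (forall x, D x -> `|f x| <= M) ->
  `|\int[mu]_(x in D) f x| <= M * fine (mu D).
Proof.
move=> bf fM; rewrite -Rintegral_cst//.
by apply: le_norm_bint => //; exact: bmeas_cst.
Qed.

Lemma bint_ae_eq f g : bmeas f -> bmeas g ->
  (\forall x \ae mu, D x -> f x = g x) ->
  \int[mu]_(x in D) f x = \int[mu]_(x in D) g x.
Proof.
move=> [mf _] [mg _] fg; congr fine; apply: ae_eq_integral => //.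
- by apply/measurable_EFinP; exact: measurable_funTS.
- by apply/measurable_EFinP; exact: measurable_funTS.
- by apply: filterS fg => x fgx Dx /=; rewrite fgx.
Qed.

Lemma bint_eq0_ae f : bmeas f -> (forall x, 0 <= f x) ->
  \int[mu]_(x in D) f x = 0 -> \forall x \ae mu, D x -> f x = 0.
Proof.
move=> bf f0 If0.
have : (\int[mu]_(x in D) `|(f x)%:E| = 0)%E.
  under eq_integral do rewrite gee0_abs ?lee_fin//.
  by rewrite -bint_EFin// If0.
move=> /(ae_eq_integral_abs mu mD).
have mf : measurable_fun D (EFin \o f).
  by apply/measurable_EFinP/measurable_funTS; case: bf.
move=> /(_ mf); apply: filterS => x /= h Dx.
by have := h Dx => -[].
Qed.

Lemma cvg_bint (f_ : nat -> T -> R) f M :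
  (forall n, measurable_fun setT (f_ n)) -> (forall n x, `|f_ n x| <= M) ->
  bmeas f -> (forall x, D x -> f_ n x @[n --> \oo] --> f x) ->
  \int[mu]_(x in D) f_ n x @[n --> \oo] --> \int[mu]_(x in D) f x.
Proof.
move=> mf_ f_M bf cf.
have bf_ n : bmeas (f_ n) by split => //; exists M.
apply: fine_cvg; rewrite fineK; last exact/integrable_fin_num/bmeas_integrable.
apply: (@dominated_cvg _ _ _ mu D mD _ _ (cst M%:E)) => //.
- by move=> n; apply/measurable_EFinP/measurable_funTS.
- by move=> x Dx; apply: cvg_EFin; [exact: nearW|exact: cf].
- by apply: bmeas_integrable; exact: bmeas_cst.
- by move=> n x _; rewrite lee_fin.
Qed.

End BoundedMeasurable.

Section AlmostEverywhere.
Context {R : realType} d (T : measurableType d) (mu : {measure set T -> \bar R}).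

Lemma aeS (P Q : T -> Prop) : (forall x, P x -> Q x) ->
  (\forall x \ae mu, P x) -> \forall x \ae mu, Q x.
Proof. by move=> PQ; apply: filterS. Qed.

Lemma aeS2 (P Q S : T -> Prop) : (forall x, P x -> Q x -> S x) ->
  (\forall x \ae mu, P x) -> (\forall x \ae mu, Q x) -> \forall x \ae mu, S x.
Proof. by move=> PQ; apply: filterS2. Qed.

Lemma ae_all_ord n (P : 'I_n -> T -> Prop) : (forall i, \forall x \ae mu, P i x) ->
  \forall x \ae mu, forall i, P i x.
Proof. by move=> h; apply: filter_forall. Qed.

End AlmostEverywhere.

Section IntegralSupport.
Context {R : realType} d (T : measurableType d) (mu : {measure set T -> \bar R}).
Implicit Types (f : T -> R).

Lemma Rint_support (A B : set T) f :
  (forall x, A x -> ~ B x -> f x = 0) -> (forall x, B x -> ~ A x -> f x = 0) ->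
  \int[mu]_(x in A) f x = \int[mu]_(x in B) f x.
Proof.
move=> AB BA; rewrite Rintegral_mkcond [RHS]Rintegral_mkcond; congr Rintegral.
apply/funext => x; rewrite !patchE; case: ifPn => [|/negP]; rewrite inE => Ax;
  case: ifPn => [|/negP]; rewrite inE => Bx //.
- exact: AB.
- by rewrite BA.
Qed.

(** Only the larger side has to be integrable, so that [A] may have infinite
measure. *)
Lemma bint_le_support (A B : set T) f : measurable A -> measurable B ->
  (mu B < +oo)%E -> bmeas f -> (forall x, 0 <= f x) ->
  (forall x, A x -> ~ B x -> f x = 0) ->
  \int[mu]_(x in A) f x <= \int[mu]_(x in B) f x.
Proof.
move=> mA mB Boo bf f0 AB; rewrite /Rintegral; apply: fine_le.
- rewrite (_ : \int[mu]_(x in A) _ = \int[mu]_(x in A `&` B) (f x)%:E)%E.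
    apply: integrable_fin_num; first exact: measurableI.
    apply: (integrableS mB) => //; first exact: measurableI.
    by apply: bmeas_integrable.
  rewrite integral_mkcond [RHS]integral_mkcond; apply: eq_integral => x _.
  rewrite !patchE; case: ifPn => [|/negP]; rewrite inE => Ax;
    case: ifPn => [|/negP]; rewrite inE => Bx //.
  + by rewrite AB// => Bx'; apply: Bx.
  + by case: Bx.
- by apply: integrable_fin_num => //; exact: bmeas_integrable.
- rewrite integral_mkcond [leRHS]integral_mkcond; apply: ge0_le_integral => //.
  + by move=> x _; rewrite patchE; case: ifP; rewrite // lee_fin.
  + apply/(measurable_restrictT _ mA)/measurable_EFinP/measurable_funTS.
    by case: bf.
  + apply/(measurable_restrictT _ mB)/measurable_EFinP/measurable_funTS.
    by case: bf.
  + move=> x _; rewrite !patchE; case: ifPn => [|/negP]; rewrite inE => Ax;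
      case: ifPn => [|/negP]; rewrite inE => Bx //; last by rewrite lee_fin.
    by rewrite AB.
Qed.

End IntegralSupport.

Section BoundedFubini.
Context {R : realType} d1 d2 (T1 : measurableType d1) (T2 : measurableType d2).
Context (m1 : {sigma_finite_measure set T1 -> \bar R})
  (m2 : {sigma_finite_measure set T2 -> \bar R}) (A : set T1) (B : set T2)
  (mA : measurable A) (finA : (m1 A < +oo)%E)
  (mB : measurable B) (finB : (m2 B < +oo)%E).
Implicit Types f : T1 * T2 -> R.

Lemma prod_measureXE : prod_measure m1 m2 (A `*` B) = (m1 A * m2 B)%E.
Proof. by rewrite /prod_measure product_measure1E. Qed.

Lemma prod_measureX_fin : (prod_measure m1 m2 (A `*` B) < +oo)%E.
Proof. by rewrite prod_measureXE lte_mul_pinfty// ge0_fin_numE. Qed.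

Let integrable_AB f : bmeas f ->
  (m1 \x m2)%E.-integrable setT (EFin \o (f \_ (A `*` B))).
Proof.
move=> bf; rewrite -restrict_EFin.
apply/integrable_restrict => //; first exact: measurableX.
rewrite setTI; apply: bmeas_integrable => //; first exact: measurableX.
exact: prod_measureX_fin.
Qed.

Let sectionE f x : A x ->
  fubini_F m2 (EFin \o (f \_ (A `*` B))) x = (\int[m2]_(y in B) (f (x, y))%:E)%E.
Proof.
move=> Ax; rewrite /fubini_F [RHS]integral_mkcond; apply: eq_integral => y _ /=.
rewrite !patchE; case: ifPn => [|]; case: ifPn => //.
  by move=> /negP nBy; rewrite inE => -[/= _ By]; exfalso; apply: nBy; rewrite inE.
by rewrite inE => By /negP nABy; exfalso; apply: nABy; rewrite inE.
Qed.

Let sectionE0 f x : ~ A x ->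
  fubini_F m2 (EFin \o (f \_ (A `*` B))) x = 0%E.
Proof.
move=> nAx; rewrite /fubini_F integral0_eq// => y _ /=.
by rewrite patchE; case: ifPn => //; rewrite inE => -[].
Qed.

Lemma bmeas_pair2 f x : bmeas f -> bmeas (fun y => f (x, y)).
Proof.
by move=> bf; apply: (@bmeas_comp _ _ _ _ _ (fun y => (x, y))) bf; exact: pair1_measurable.
Qed.

Lemma bmeas_pair1 f y : bmeas f -> bmeas (fun x => f (x, y)).
Proof.
by move=> bf; apply: (@bmeas_comp _ _ _ _ _ (fun x => (x, y))) bf; exact: pair2_measurable.
Qed.

Lemma bmeas_bint2 f : bmeas f ->
  bmeas (fun x => \int[m2]_(y in B) f (x, y)).
Proof.
move=> bf; have [mf [M fM]] := bf; split; last first.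
  exists (M * fine (m2 B)) => x.
  by apply: le_norm_bint_cst => //; exact: bmeas_pair2.
(* measurability of partial integrals comes from Tonelli's theorem, which asks
   for a nonnegative integrand: hence the shift by the bound [M] *)
pose g z := ((f z + M)%:E * (\1_(setT `*` B) z)%:E)%E.
have mB' : measurable ([set: T1] `*` B) by exact: measurableX.
have mg : measurable_fun setT g.
  apply: emeasurable_funM; apply/measurable_EFinP; last exact: measurable_indic.
  exact: measurable_funD.
have g0 z : (0 <= g z)%E.
  by rewrite mule_ge0// lee_fin -lerBlDr sub0r; have := fM z; rewrite ler_norml => /andP[].
have := measurable_fun_fubini_tonelli_F (m2 := m2) g mg g0.
move=> mG.
rewrite (_ : (fun x => _) = fun x => fine (fubini_F m2 g x) - M * fine (m2 B)).
  apply: measurable_funB => //; exact: measurableT_comp.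
apply/funext => x; rewrite /fubini_F.
have -> : (\int[m2]_y g (x, y) = \int[m2]_(y in B) (f (x, y) + M)%:E)%E.
  rewrite [RHS]integral_mkcond; apply: eq_integral => y _.
  rewrite /g patchE indicE; case: ifPn => [|/negP]; rewrite inE => By.
    by rewrite mem_set// mule1.
  by rewrite memNset ?mule0//= => -[].
rewrite -[X in _ = X - _]/(\int[m2]_(y in B) (f (x, y) + M)) bintD//.
- by rewrite Rintegral_cst// addrK.
- exact: bmeas_pair2.
- exact: bmeas_cst.
Qed.

Lemma bint_fubini1 f : bmeas f ->
  \int[prod_measure m1 m2]_(z in A `*` B) f z =
  \int[m1]_(x in A) \int[m2]_(y in B) f (x, y).
Proof.
move=> bf; rewrite Rintegral_mkcond /Rintegral.
congr fine.
rewrite /prod_measure /= -integral12_prod_meas1; last exact: integrable_AB.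
rewrite [RHS]integral_mkcond; apply: eq_integral => x _.
rewrite patchE; case: ifPn => [|/negP]; rewrite inE => Ax.
  by rewrite sectionE// -bint_EFin//; exact: bmeas_pair2.
by rewrite sectionE0.
Qed.

End BoundedFubini.

Section BoundedFubiniSwap.
Context {R : realType} d1 d2 (T1 : measurableType d1) (T2 : measurableType d2).
Context (m1 : {sigma_finite_measure set T1 -> \bar R})
  (m2 : {sigma_finite_measure set T2 -> \bar R}) (A : set T1) (B : set T2)
  (mA : measurable A) (finA : (m1 A < +oo)%E)
  (mB : measurable B) (finB : (m2 B < +oo)%E).
Implicit Types f : T1 * T2 -> R.

Lemma bmeas_swap f : bmeas f -> bmeas (fun z => f (z.2, z.1)).
Proof. by move=> bf; apply: (bmeas_comp _ bf); exact: measurable_swap. Qed.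

Lemma bmeas_bint1 f : bmeas f ->
  bmeas (fun y => \int[m1]_(x in A) f (x, y)).
Proof. by move=> /bmeas_swap/(bmeas_bint2 mA finA). Qed.

Lemma bint_swap f : bmeas f ->
  \int[m1]_(x in A) \int[m2]_(y in B) f (x, y) =
  \int[m2]_(y in B) \int[m1]_(x in A) f (x, y).
Proof.
move=> bf; pose g z := (f z * \1_(A `*` B) z).
have mAB : measurable (A `*` B) by exact: measurableX.
have bg : bmeas g by apply: bmeasM => //; exact: bmeas_indic.
have ig : (m1 \x m2)%E.-integrable setT (EFin \o g).
  rewrite (_ : EFin \o g = (EFin \o f) \_ (A `*` B)).
    apply/integrable_restrict => //.
    rewrite setTI; apply: bmeas_integrable => //.
    exact: prod_measureX_fin.
  apply/funext => z; rewrite /g /= patchE indicE; case: ifPn => /= _.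
    by rewrite mulr1.
  by rewrite mulr0.
have := Fubini ig; rewrite /Rintegral.
have H1 x : A x -> (\int[m2]_y (EFin \o g) (x, y) = (\int[m2]_(y in B) f (x, y))%:E)%E.
  move=> Ax; rewrite bint_EFin//; last exact: bmeas_pair2.
  rewrite [RHS]integral_mkcond; apply: eq_integral => y _.
  rewrite /g/= patchE indicE; case: ifPn => [|/negP]; rewrite inE => By.
    by rewrite mem_set// mulr1.
  by rewrite memNset ?mulr0//= => -[].
have H2 y : B y -> (\int[m1]_x (EFin \o g) (x, y) = (\int[m1]_(x in A) f (x, y))%:E)%E.
  move=> By; rewrite bint_EFin//; last exact: bmeas_pair1.
  rewrite [RHS]integral_mkcond; apply: eq_integral => x _.
  rewrite /g/= patchE indicE; case: ifPn => [|/negP]; rewrite inE => Ax.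
    by rewrite mem_set// mulr1.
  by rewrite memNset ?mulr0//= => -[].
move=> E; congr fine; rewrite [LHS]integral_mkcond [RHS]integral_mkcond.
rewrite (eq_integral (fun x => \int[m2]_y (EFin \o g) (x, y)))%E; last first.
  move=> x _; rewrite patchE; case: ifPn => [|/negP]; rewrite inE => Ax.
    by rewrite H1.
  rewrite integral0_eq// => y _; rewrite /g/= indicE memNset ?mulr0//.
  by move=> [].
rewrite E; apply: eq_integral => y _.
rewrite patchE; case: ifPn => [|/negP]; rewrite inE => By.
  by rewrite H2.
rewrite integral0_eq// => x _; rewrite /g/= indicE memNset ?mulr0//.
by move=> [].
Qed.

Lemma bint_fubini2 f : bmeas f ->
  \int[prod_measure m1 m2]_(z in A `*` B) f z =
  \int[m2]_(y in B) \int[m1]_(x in A) f (x, y).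
Proof. by move=> bf; rewrite bint_fubini1// bint_swap. Qed.

End BoundedFubiniSwap.

(** * The period cell *)

Section TorusCell.
Context {R : realType}.
Lemma measurable_cell : measurable (cell : set (space3 R)).
Proof. by apply: measurableX => //; apply: measurableX. Qed.

Lemma leb1E (I : set R) : leb1 I = lebesgue_measure I.
Proof. by []. Qed.

Lemma leb1_itv01 : leb1 (`[0%R, 1%R[%classic : set R) = 1%E.
Proof. by rewrite leb1E lebesgue_measure_itv/= lte01 oppr0 adde0. Qed.

Lemma leb3_cell : leb3 (cell : set (space3 R)) = 1%E.
Proof.
have E : prod_measure leb1 leb1 (`[0%R, 1%R[%classic `*` `[0%R, 1%R[%classic : set (R * R)) = 1%E.
  by rewrite prod_measureXE// leb1_itv01 mul1e.
rewrite -[LHS]/(prod_measure (prod_measure leb1 leb1) leb1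
  (`[0%R, 1%R[%classic `*` `[0%R, 1%R[%classic `*` `[0%R, 1%R[%classic)).
rewrite prod_measureXE//; last exact: measurableX.
rewrite [X in (X * _)%E]E mul1e.
exact: leb1_itv01.
Qed.

Lemma measurable_cylinder (I : set R) : measurable I ->
  measurable (cylinder I : set (spacetime R)).
Proof. by move=> mI; apply: measurableX => //; exact: measurable_cell. Qed.

Lemma leb4_cylinder (I : set R) : measurable I ->
  leb4 (cylinder I : set (spacetime R)) = lebesgue_measure I.
Proof.
move=> mI; rewrite -[LHS]/(prod_measure leb3 leb1 (cell `*` I)) prod_measureXE//;
  last exact: measurable_cell.
by rewrite leb3_cell mul1e.
Qed.

Lemma leb4_cylinder_fin (I : set R) : measurable I ->
  (lebesgue_measure I < +oo)%E -> (leb4 (cylinder I : set (spacetime R)) < +oo)%E.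
Proof. by move=> mI; rewrite leb4_cylinder. Qed.
Lemma leb3_cell_fin : (leb3 (cell : set (space3 R)) < +oo)%E.
Proof. by rewrite leb3_cell ltry. Qed.

End TorusCell.

(** * Profiles and differentiation under the integral sign *)

Section Profile.
Context {R : realType}.
Implicit Types (p q : R -> R).

(** Bounded derivatives of all orders, rather than compact support: the kernels in
space are periodic, and boundedness of every derivative is what differentiation
under the integral sign over a set of finite measure uses. *)
Definition profile p : Prop := forall n,
  (forall x, derivable p^`(n)%classic x 1) /\ exists M : R, forall x, `|p^`(n)%classic x| <= M.

Lemma profile_derive p : profile p -> profile p^`()%classic.
Proof. by move=> hp n; rewrite -derive1Sn; exact: hp. Qed.

Lemma profile_is_derive p (x : R) : profile p -> is_derive x 1 p (p^`()%classic x).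
Proof.
by move=> /(_ 0%N)[+ _]; rewrite derive1n0 derive1E => dp; exact: derivableP.
Qed.

Lemma derivable_continuousT p : (forall x : R, derivable p x 1) -> continuous p.
Proof.
move=> dp x; apply: differentiable_continuous.
by apply/derivable1_diffP; exact: dp.
Qed.

Lemma profile_continuous p : profile p -> continuous p.
Proof.
move=> /(_ 0%N)[+ _]; rewrite derive1n0 => dp x.
exact: derivable_continuousT.
Qed.

Lemma profile_bmeas p : profile p -> bmeas p.
Proof.
move=> hp; split; first by apply: continuous_measurable_fun; exact: profile_continuous.
by have [_] := hp 0%N; rewrite derive1n0.
Qed.

(** Every mollified field has this form along every coordinate line: only the
profile [p] depends on the parameter. The derivative of the integrand is bounded
by a constant, which is integrable since [mu D] is finite. *)
Lemma is_derive_bint d (T : measurableType d) (mu : {measure set T -> \bar R})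
    (D : set T) p (l h : T -> R) (a : R) :
  measurable D -> (mu D < +oo)%E -> profile p -> measurable_fun setT l ->
  bmeas h ->
  is_derive a 1 (fun a => \int[mu]_(y in D) (p (a - l y) * h y))
    (\int[mu]_(y in D) (p^`()%classic (a - l y) * h y)).
Proof.
move=> mD finD hp ml bh.
have bph q x : profile q -> bmeas (fun y => q (x - l y) * h y).
  move=> hq; apply: bmeasM => //; apply: (bmeas_comp _ (profile_bmeas hq)).
  by apply: measurable_funB => //; exact: measurable_cst.
have dF x y : is_derive x (1 : R) (fun x => p (x - l y) * h y) (p^`()%classic (x - l y) * h y).
  have dp := profile_is_derive (x - l y) hp.
  have dq : is_derive x (1 : R) (fun x => x - l y) (1 - 0) by exact: is_deriveB.
  have dc : is_derive x 1 (p \o (fun x => x - l y)) (p^`()%classic (x - l y) * (1 - 0)).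
    exact: (@is_derive1_comp _ p _ x).
  have := is_deriveM dc (is_derive_cst (h y) x 1).
  by move/is_derive_eq; apply; rewrite subr0 scaler0 add0r mulr1 /GRing.scale/= mulrC.
have [M pM] : exists M, forall x, `|p^`()%classic x| <= M.
  by have [_] := hp 1%N; rewrite derive1n1.
have [mh [H hH]] := bh.
have aI : `]a - 1, a + 1[%classic a by rewrite /= in_itv/=; lra.
have cv := @cvg_differentiation_under_integral R _ T mu (fun x y => p (x - l y) * h y)
  D mD a (a - 1) (a + 1) aI _ _ (fun=> M * H) _ _ _.
have E y : partial1of2 (fun x y => p (x - l y) * h y) a y = p^`()%classic (a - l y) * h y.
  by rewrite partial1of2E; apply: (@derive_val _ _ _ _ _ _ _ (dF a y)).
have {}cv : h0^-1 *: (\int[mu]_(y in D) (p (h0 + a - l y) * h y) -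
      \int[mu]_(y in D) (p (a - l y) * h y)) @[h0 --> 0^'] -->
    \int[mu]_(y in D) (p^`()%classic (a - l y) * h y).
  under [X in _ --> X]eq_Rintegral do rewrite -E.
  apply: cv.
  - by move=> x _; apply: bmeas_integrable => //; exact: bph.
  - by move=> x y _ _; case: (dF x y).
  - by move=> y; apply: mulr_ge0;
      [exact: le_trans (pM 0)|exact: le_trans (hH y)].
  - by apply: bmeas_integrable => //; exact: bmeas_cst.
  - move=> x y _ _; rewrite partial1of2E (@derive_val _ _ _ _ _ _ _ (dF x y)).
    by rewrite normrM ler_pM.
apply: DeriveDef.
  by apply/cvg_ex; exists (\int[mu]_(y in D) (p^`()%classic (a - l y) * h y)); under eq_fun do rewrite [_ *: 1]mulr1.
by apply/cvg_lim => //; under eq_fun do rewrite [_ *: 1]mulr1.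
Qed.

(** Reduces directional derivatives to derivatives of functions of one real
variable, to which the fundamental theorem of calculus applies. *)
Lemma is_derive_lineP (V : normedModType R) (F : V -> R) (z v : V) (s d : R) :
  is_derive (s *: v + z) v F d <-> is_derive s (1 : R) (fun s => F (s *: v + z)) d.
Proof.
have E : (fun h : R => h^-1 *: (F (h *: v + (s *: v + z)) - F (s *: v + z))) =
  (fun h : R => h^-1 *: (F ((h *: 1 + s) *: v + z) - F (s *: v + z))).
  by apply/funext => h; rewrite addrA -scalerDl [h *: 1]mulr1.
split=> -[d1 d2]; apply: DeriveDef.
- by rewrite /derivable -[X in cvg (X @ _)]E.
- by rewrite -d2 /derive -[X in lim (X @ _) = _]E.
- by rewrite /derivable [X in cvg (X @ _)]E.
- by rewrite -d2 /derive [X in lim (X @ _) = _]E.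
Qed.

Lemma is_derive_line0 (V : normedModType R) (F : V -> R) (z v : V) (d : R) :
  is_derive z v F d <-> is_derive (0 : R) (1 : R) (fun s : R => F (s *: v + z)) d.
Proof. by rewrite -is_derive_lineP scale0r add0r. Qed.

End Profile.

(** * Coercivity of the friction and the energy density *)

Section Coercivity.
Context {R : realFieldType} {n : nat}.
Implicit Types (a : 'I_n -> 'I_n -> R) (C F W J v h : 'I_n -> R).

(** A weighted form of Lagrange's identity. When [\sum_i h i * v i = 0] it shows
that the relative velocities control the velocities themselves. *)
Lemma sum_sqr_difference h v :
  \sum_i \sum_j h i * h j * (v i - v j) ^+ 2 =
  2 * ((\sum_i h i) * (\sum_i h i * v i ^+ 2) - (\sum_i h i * v i) ^+ 2).
Proof.
have E1 : (\sum_i h i) * (\sum_i h i * v i ^+ 2) =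
    \sum_i \sum_j h i * (h j * v j ^+ 2).
  by rewrite mulr_suml; apply: eq_bigr => i _; rewrite mulr_sumr.
have E2 : (\sum_i h i * v i) ^+ 2 = \sum_i \sum_j (h i * v i) * (h j * v j).
  by rewrite expr2 mulr_suml; apply: eq_bigr => i _; rewrite mulr_sumr.
have E3 : \sum_i \sum_j h i * (h j * v j ^+ 2) =
    \sum_i \sum_j h j * (h i * v i ^+ 2) by rewrite exchange_big.
rewrite mulrBr mulr2n mulrDl mul1r {1}E1 E3 E1 E2 mulr_sumr.
rewrite -big_split -sumrB; apply: eq_bigr => i _ /=.
rewrite mulr_sumr -big_split -sumrB; apply: eq_bigr => j _ /=; ring.
Qed.

Lemma sqr_sum_le (x : 'I_n -> R) : (\sum_i x i) ^+ 2 <= n%:R * \sum_i x i ^+ 2.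
Proof.
have := sum_sqr_difference (fun=> 1) x.
under [\sum_i 1 * x i]eq_bigr do rewrite mul1r.
under [\sum_i 1 * x i ^+ 2]eq_bigr do rewrite mul1r.
rewrite sumr_const card_ord => E.
have : 0 <= \sum_i \sum_j 1 * 1 * (x i - x j) ^+ 2.
  by apply: sumr_ge0 => i _; apply: sumr_ge0 => j _; rewrite !mul1r sqr_ge0.
by rewrite E pmulr_rge0// subr_ge0.
Qed.

(** Put [h i = C i + mu ^+ 2] and [v i = F i / h i]. If [C] were equal to [h], the
right-hand side would be half the sum of [a i j * h i * h j * (v i - v j) ^+ 2]
by symmetry of [a], and Lagrange's identity together with [\sum_i F i = 0] would
bound it below by [delta * \sum_i h i * v i ^+ 2]. Replacing [C] by [h] makes an
error of size [mu ^+ 2 * a i j * v i * (F i - F j)]. As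
[mu ^+ 2 * v i ^+ 2 <= h i * v i ^+ 2], this error is at most of relative size
[mu], and the smallness of [mu] absorbs it into half of the lower bound. *)
Lemma friction_coercive a (delta Lam mu : R) C F :
  (forall i j, a i j = a j i) -> (forall i j, delta <= a i j <= Lam) ->
  0 <= delta -> 0 < mu <= 1 -> 5 * Lam * n%:R * mu <= delta ->
  (forall i, 0 <= C i) -> \sum_i C i = 1 -> \sum_i F i = 0 ->
  delta / 2 * \sum_i F i ^+ 2 / (C i + mu ^+ 2) <=
  \sum_i F i / (C i + mu ^+ 2) * \sum_j (C j * F i - C i * F j) * a i j.
Proof.
move=> a_sym aB d0 /andP[mu0 mu1] small C0 C1 F0.
pose h i := C i + mu ^+ 2; pose v i := F i / h i; pose p i := h i * v i ^+ 2.
have mu2 : 0 < mu ^+ 2 by rewrite exprn_gt0.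
have mu21 : mu ^+ 2 <= 1 by rewrite exprn_ile1// ltW.
have h_gt0 i : 0 < h i by rewrite /h ltr_wpDl.
have C_le1 i : C i <= 1.
  by rewrite -C1 (bigD1 i)//= lerDl; apply: sumr_ge0.
have h_le2 i : h i <= 2 by rewrite /h; have := C_le1 i; lra.
have Fv i : F i = h i * v i by rewrite /v mulrC divfK// gt_eqF.
have pE i : F i ^+ 2 / (C i + mu ^+ 2) = p i.
  rewrite -/(h i) /p /v; field; exact: lt0r_neq0.
have p0 i : 0 <= p i by rewrite /p mulr_ge0// ?sqr_ge0// ltW.
under eq_bigr do rewrite pE.
set S := \sum_i p i.
have S0 : 0 <= S by exact: sumr_ge0.
pose X i j := a i j * (h i * h j) * (v i - v j) ^+ 2.
pose Z i j := mu ^+ 2 * (a i j * (v i * F i - v i * F j)).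
have -> : \sum_i F i / (C i + mu ^+ 2) * (\sum_j (C j * F i - C i * F j) * a i j)
    = (\sum_i \sum_j X i j) / 2 - \sum_i \sum_j Z i j.
  pose Y i j := a i j * (h i * h j) * (v i ^+ 2 - v i * v j).
  have XY : \sum_i \sum_j X i j = 2 * \sum_i \sum_j Y i j.
    rewrite mulr2n mulrDl mul1r [X in _ = _ + X]exchange_big -big_split.
    apply: eq_bigr => i _ /=; rewrite -big_split; apply: eq_bigr => j _ /=.
    rewrite /X /Y (a_sym j i); ring.
  rewrite XY mulrAC divff ?pnatr_eq0// mul1r -sumrB; apply: eq_bigr => i _.
  rewrite -sumrB mulr_sumr; apply: eq_bigr => j _.
  rewrite -[F i / (C i + mu ^+ 2)]/(v i) /Y /Z.
  have -> : C j = h j - mu ^+ 2 by rewrite /h addrK.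
  have -> : C i = h i - mu ^+ 2 by rewrite /h addrK.
  rewrite !Fv; ring.
have X_ge : delta * S <= (\sum_i \sum_j X i j) / 2.
  have h1 : 1 <= \sum_i h i.
    rewrite /h big_split/= C1 lerDl; apply: sumr_ge0 => i _; exact: ltW.
  have -> : delta * S = delta * S * 2 / 2 by rewrite mulfK// pnatr_eq0.
  rewrite ler_pM2r ?invr_gt0//.
  apply: (@le_trans _ _ (delta * \sum_i \sum_j h i * h j * (v i - v j) ^+ 2)).
    rewrite sum_sqr_difference.
    under [\sum_i h i * v i]eq_bigr do rewrite -Fv.
    rewrite F0 expr0n subr0 -/S -mulrA ler_wpM2l// mulrC ler_pM2l//.
    by rewrite ler_peMl.
  rewrite mulr_sumr; apply: ler_sum => i _; rewrite mulr_sumr; apply: ler_sum => j _.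
  rewrite /X mulrA; apply: ler_wpM2r; first exact: sqr_ge0.
  apply: ler_wpM2r; first by rewrite mulr_ge0// ltW.
  by have /andP[] := aB i j.
have Z_le : \sum_i \sum_j Z i j <= delta / 2 * S.
  have Zij i j : Z i j <= Lam * mu * (3 / 2 * p i + p j).
    have ineq : mu ^+ 2 * (v i * F i - v i * F j) <= mu * (3 / 2 * p i + p j).
      have t1 : mu ^+ 2 * (v i * F i) <= mu * p i.
        have -> : v i * F i = p i by rewrite {1}Fv /p; ring.
        by apply: ler_wpM2r => //; rewrite expr2 ler_piMl// ltW.
      have t2 : mu ^+ 2 * (- (v i * F j)) <= mu * (p i / 2 + p j).
        rewrite expr2 -mulrA ler_pM2l//.
        have q1 : mu ^+ 2 * v i ^+ 2 <= p i.
          by rewrite /p; apply: ler_wpM2r; rewrite ?sqr_ge0// /h lerDr.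
        have q2 : F j ^+ 2 <= 2 * p j.
          rewrite Fv /p exprMn expr2 -mulrA ler_wpM2r//.
          by rewrite mulr_ge0// ?sqr_ge0// ltW.
        have q3 : 0 <= (mu * v i + F j) ^+ 2 by exact: sqr_ge0.
        have q4 : (mu * v i + F j) ^+ 2 =
          mu ^+ 2 * v i ^+ 2 + 2 * (mu * (v i * F j)) + F j ^+ 2 by ring.
        by rewrite mulrN; lra.
      have -> : mu ^+ 2 * (v i * F i - v i * F j) =
        mu ^+ 2 * (v i * F i) + mu ^+ 2 * (- (v i * F j)) by ring.
      apply: le_trans (lerD t1 t2) _.
      by rewrite le_eqVlt; apply/orP; left; apply/eqP; field.
    have B0 : 0 <= mu * (3 / 2 * p i + p j).
      by apply: mulr_ge0; [exact: ltW|rewrite addr_ge0// mulr_ge0].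
    rewrite /Z mulrCA -mulrA; have /andP[da aL] := aB i j.
    apply: (@le_trans _ _ (a i j * (mu * (3 / 2 * p i + p j)))).
      by apply: ler_wpM2l => //; exact: le_trans da.
    exact: ler_wpM2r.
  apply: (@le_trans _ _ (\sum_i \sum_j Lam * mu * (3 / 2 * p i + p j))).
    by apply: ler_sum => i _; apply: ler_sum => j _.
  have -> : \sum_i \sum_j Lam * mu * (3 / 2 * p i + p j) =
      5 * Lam * n%:R * mu / 2 * S.
    have E1 i : \sum_j Lam * mu * (3 / 2 * p i + p j) =
        Lam * mu * (3 / 2 * n%:R) * p i + Lam * mu * S.
      rewrite -mulr_sumr big_split/= sumr_const card_ord -/S -mulr_natr; ring.
    under eq_bigr do rewrite E1.
    by rewrite big_split/= sumr_const card_ord -mulr_sumr -/S -mulr_natr; field.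
  by rewrite ler_wpM2r// ler_pM2r ?invr_gt0.
lra.
Qed.

(** The left-hand side is the integrand of the energy balance in one space
direction: [J] and [Jb] stand for the fluxes of the two solutions, [dC] for the
derivative of [C], and the friction law with defect [E] has been substituted for
the derivative of [W]. The part that is quadratic in [F] is coercive. Any other
term has a factor [W i] or [E i], the remaining factors being bounded, so that
Young's inequality moves its factor [F i], if there is one, into the coercive
part. The constant degenerates as [mu] tends to 0, which is harmless since [mu]
stays fixed. *)
Lemma energy_density_bound a (delta Lam mu B B1 : R) :
  (forall i j, a i j = a j i) -> (forall i j, delta <= a i j <= Lam) ->
  0 < delta -> 0 <= Lam -> 0 < mu <= 1 -> 5 * Lam * n%:R * mu <= delta ->
  0 <= B -> 0 <= B1 ->
  exists2 K, 0 <= K & forall C F W J Jb dC (E : 'I_n -> R),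
    (forall i, 0 <= C i) -> \sum_i C i = 1 -> \sum_i F i = 0 ->
    (forall i, `|W i| <= 1) -> (forall i, `|J i| <= B) ->
    (forall i, `|Jb i| <= B) -> (forall i, `|F i| <= 2 * B) ->
    (forall i, `|dC i| <= B1) ->
    \sum_i (F i - W i / (C i + mu ^+ 2) * J i) *
      ((- (\sum_j (C j * F i - C i * F j + (W j * Jb i - W i * Jb j)) * a i j)
        + E i - W i / (C i + mu ^+ 2) * dC i) / (C i + mu ^+ 2)) <=
    K * (\sum_i W i ^+ 2 + \sum_i `|E i|).
Proof.
move=> a_sym aB d0 Lam0 muB small B0 B10; have /andP[mu0 mu1] := muB.
have mu2 : 0 < mu ^+ 2 by rewrite exprn_gt0.
have mu21 : mu ^+ 2 <= 1 by rewrite exprn_ile1// ltW.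
pose q := (mu ^+ 2)^-1; have q0 : 0 < q by rewrite invr_gt0.
pose k := Lam * B * (1 + n%:R) + q * B1.
have k0 : 0 <= k by rewrite addr_ge0// !mulr_ge0// ltW.
(* with [w], [f], [r] the sums of the [`|W i|], [`|F i|], [`|E i|], the terms to
   be absorbed are at most [K1 * w * f + K2 * w ^+ 2 + K3 * r] *)
pose K1 := q * k + n%:R * (q ^+ 2 * B * (2 * Lam)).
pose K2 := n%:R * (q ^+ 2 * B * k).
pose K3 := 2 * q * B + q ^+ 2 * B.
have K10 : 0 <= K1 by rewrite addr_ge0 ?mulr_ge0 ?exprn_ge0// ltW.
have K20 : 0 <= K2 by rewrite !mulr_ge0 ?exprn_ge0// ltW.
have K30 : 0 <= K3 by rewrite addr_ge0 ?mulr_ge0 ?exprn_ge0// ltW.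
have Kw0 : 0 <= n%:R * (K1 ^+ 2 / delta) + K2.
  by rewrite addr_ge0// mulr_ge0// divr_ge0 ?sqr_ge0// ltW.
exists ((n%:R * (K1 ^+ 2 / delta) + K2) * n%:R + K3).
  by rewrite addr_ge0// mulr_ge0.
move=> C F W J Jb dC E C0 C1 F0 W1 JB JbB FB dCB.
pose h i := C i + mu ^+ 2; pose Y i := W i / h i.
have h_gt0 i : 0 < h i by rewrite /h ltr_wpDl.
have C_le1 i : C i <= 1.
  by rewrite -C1 (bigD1 i)//= lerDl; apply: sumr_ge0.
have h_le2 i : h i <= 2 by rewrite /h; have := C_le1 i; lra.
have hV i : 0 <= (h i)^-1 <= q.
  by rewrite invr_ge0 ltW//= lef_pV2 ?posrE// /h lerDr.
pose w := \sum_i `|W i|; pose f := \sum_i `|F i|; pose r := \sum_i `|E i|.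
have Ww i : `|W i| <= w by rewrite /w (bigD1 i)//= lerDl sumr_ge0.
have Ff i : `|F i| <= f by rewrite /f (bigD1 i)//= lerDl sumr_ge0.
have w0 : 0 <= w by rewrite sumr_ge0.
have f0 : 0 <= f by rewrite sumr_ge0.
pose M i := \sum_j (C j * F i - C i * F j) * a i j.
pose L i := \sum_j (W j * Jb i - W i * Jb j) * a i j.
have a0L i j : 0 <= a i j <= Lam.
  by have /andP[da ->] := aB i j; rewrite (le_trans _ da)// ltW.
have M_le i : `|M i| <= 2 * Lam * f.
  apply: (le_trans (ler_norm_sum _ _ _)).
  apply: (@le_trans _ _ (\sum_j (C j * `|F i| + `|F j|) * Lam)).
    apply: ler_sum => j _; rewrite normrM; have /andP[a0 aL] := a0L i j.
    rewrite (ger0_norm a0); apply: ler_pM => //.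
    apply: (le_trans (ler_normB _ _)); rewrite !normrM !(ger0_norm (C0 _)) lerD2l.
    by rewrite ler_piMl.
  rewrite -mulr_suml big_split/= -mulr_suml C1 mul1r -/f.
  rewrite [leRHS](_ : _ = (f + f) * Lam); last by ring.
  by apply: ler_wpM2r => //; rewrite lerD2r.
have L_le i : `|L i| <= Lam * B * (1 + n%:R) * w.
  apply: (le_trans (ler_norm_sum _ _ _)).
  apply: (@le_trans _ _ (\sum_j (`|W j| * B + w * B) * Lam)).
    apply: ler_sum => j _; rewrite normrM; have /andP[a0 aL] := a0L i j.
    rewrite (ger0_norm a0); apply: ler_pM => //.
    apply: (le_trans (ler_normB _ _)); rewrite !normrM.
    by apply: lerD; apply: ler_pM.
  rewrite -mulr_suml big_split/= -mulr_suml sumr_const card_ord -/w -mulr_natr.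
  by rewrite le_eqVlt; apply/orP; left; apply/eqP; ring.
have Y_le i : `|Y i| <= q * w.
  rewrite /Y normrM (ger0_norm (_ : 0 <= (h i)^-1)); last by have /andP[] := hV i.
  by rewrite mulrC; have /andP[? ?] := hV i; apply: ler_pM.
have Y_leq i : `|Y i| <= q.
  rewrite /Y normrM (ger0_norm (_ : 0 <= (h i)^-1)); last by have /andP[] := hV i.
  by rewrite -[leRHS]mul1r; have /andP[? ?] := hV i; apply: ler_pM.
pose G i := - L i - Y i * dC i.
have G_le i : `|G i| <= k * w.
  rewrite /G /k mulrDl; apply: (le_trans (ler_normB _ _)); rewrite normrN.
  by apply: lerD => //; rewrite normrM mulrAC; apply: ler_pM.
have term_le i : (F i - W i / (C i + mu ^+ 2) * J i) *
      ((- (\sum_j (C j * F i - C i * F j + (W j * Jb i - W i * Jb j)) * a i j)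
        + E i - W i / (C i + mu ^+ 2) * dC i) / (C i + mu ^+ 2)) <=
    - (F i / h i * M i) + q * k * w * `|F i|
    + q ^+ 2 * B * (2 * Lam * f * w + k * w ^+ 2) + K3 * `|E i|.
  rewrite -/(h i) -/(Y i).
  have -> : \sum_j (C j * F i - C i * F j + (W j * Jb i - W i * Jb j)) * a i j =
      M i + L i.
    by rewrite /M /L -big_split; apply: eq_bigr => j _; rewrite mulrDl.
  have -> : (F i - Y i * J i) * ((- (M i + L i) + E i - Y i * dC i) / h i) =
      - (F i / h i * M i) + F i * G i / h i + F i * E i / h i
      + Y i * J i * M i / h i - Y i * J i * G i / h i - Y i * J i * E i / h i.
    by rewrite /G; field; exact: lt0r_neq0.
  have /andP[hV0 hVq] := hV i.
  have bnd x y : `|x| <= y -> `|x / h i| <= y * q.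
    by move=> xy; rewrite normrM (ger0_norm hV0); apply: ler_pM.
  have b1 : `|F i * G i / h i| <= `|F i| * (k * w) * q.
    by apply: bnd; rewrite normrM; apply: ler_pM.
  have b2 : `|F i * E i / h i| <= (2 * B) * `|E i| * q.
    by apply: bnd; rewrite normrM; apply: ler_pM.
  have YJ : `|Y i * J i| <= q * w * B by rewrite normrM; apply: ler_pM.
  have YJq : `|Y i * J i| <= q * B by rewrite normrM; apply: ler_pM.
  have b3 : `|Y i * J i * M i / h i| <= (q * w) * B * (2 * Lam * f) * q.
    by apply: bnd; rewrite normrM; apply: ler_pM.
  have b4 : `|Y i * J i * G i / h i| <= (q * w) * B * (k * w) * q.
    by apply: bnd; rewrite normrM; apply: ler_pM.
  have b5 : `|Y i * J i * E i / h i| <= q * B * `|E i| * q.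
    by apply: bnd; rewrite normrM; apply: ler_pM.
  move: b1 b2 b3 b4 b5; rewrite !ler_norml => /andP[_ b1] /andP[_ b2] /andP[_ b3].
  move=> /andP[b4 _] /andP[b5 _].
  rewrite [leRHS](_ : _ = - (F i / h i * M i) + `|F i| * (k * w) * q
    + (2 * B) * `|E i| * q + (q * w) * B * (2 * Lam * f) * q
    + (q * w) * B * (k * w) * q + q * B * `|E i| * q); last by rewrite /K3; ring.
  move: (F i / h i * M i) (F i * G i / h i) (F i * E i / h i)
    (Y i * J i * M i / h i) (Y i * J i * G i / h i) (Y i * J i * E i / h i) b1 b2 b3 b4 b5.
  move=> x0 x1 x2 x3 x4 x5; lra.
apply: (le_trans (ler_sum _ (fun i _ => term_le i))).
rewrite !big_split/= -!mulr_sumr sumr_const card_ord -/f -/r sumrN.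
have := friction_coercive a_sym aB (ltW d0) muB small C0 C1 F0.
rewrite -/h; set Q := (X in _ <= X) => QF.
have QF4 : delta / 4 * \sum_i F i ^+ 2 <= Q.
  apply: le_trans QF; rewrite (_ : delta / 4 = delta / 2 * 2^-1); last by field.
  rewrite -mulrA; apply: ler_wpM2l; first by rewrite divr_ge0// ltW.
  rewrite mulr_sumr; apply: ler_sum => i _; rewrite mulrC; apply: ler_wpM2l.
    exact: sqr_ge0.
  by rewrite -/(h i) lef_pV2 ?posrE.
have Young : K1 * w * f - delta / 4 * \sum_i F i ^+ 2 <=
    n%:R * (K1 ^+ 2 / delta) * w ^+ 2.
  rewrite /f (mulr_sumr _ _ _ (K1 * w)) (mulr_sumr _ _ _ (delta / 4)) -sumrB.
  apply: (@le_trans _ _ (\sum_(i < n) K1 ^+ 2 / delta * w ^+ 2)); last first.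
    by rewrite sumr_const card_ord -[leLHS]mulr_natl mulrA.
  apply: ler_sum => i _; rewrite -(normr_idP (sqr_ge0 _)) normrX.
  set y := `|F i|; rewrite -subr_ge0.
  have -> : K1 ^+ 2 / delta * w ^+ 2 - (K1 * w * y - delta / 4 * y ^+ 2) =
    delta * (K1 * w / delta - y / 2) ^+ 2.
    by field; exact: lt0r_neq0.
  by rewrite mulr_ge0 ?sqr_ge0// ltW.
have w2 : w ^+ 2 <= n%:R * \sum_i W i ^+ 2.
  apply: (le_trans (sqr_sum_le _)).
  by under eq_bigr do rewrite -normrX (ger0_norm (sqr_ge0 _)).
have W20 : 0 <= \sum_i W i ^+ 2 by apply: sumr_ge0 => i _; exact: sqr_ge0.
have r0 : 0 <= r by rewrite sumr_ge0.
apply: (@le_trans _ _ ((n%:R * (K1 ^+ 2 / delta) + K2) * w ^+ 2 + K3 * r)).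
  have -> : - Q + q * k * w * f + q ^+ 2 * B * ((2 * Lam * f * w + k * w ^+ 2) *+ n)
      + K3 * r = (K1 * w * f - Q) + K2 * w ^+ 2 + K3 * r.
    by rewrite /K1 /K2 -mulr_natr; ring.
  rewrite lerD2r [leRHS]mulrDl lerD2r; apply: le_trans Young.
  by rewrite lerD2l lerN2.
rewrite mulrDr; apply: lerD.
  rewrite [leRHS]mulrDl -[X in _ <= X + _]mulrA; apply: (@le_trans _ _
    ((n%:R * (K1 ^+ 2 / delta) + K2) * (n%:R * \sum_i W i ^+ 2))).
    exact: ler_wpM2l.
  by rewrite lerDl mulr_ge0.
by apply: ler_wpM2r => //; rewrite lerDr mulr_ge0.
Qed.

End Coercivity.

(** * Kernels on the line *)

Section FundamentalTheorem.
Context {R : realType}.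
Implicit Types (F f : R -> R) (a b : R).

Lemma leb1_itv_fin (a b : bool) (x y : R) :
  (leb1 ([set` Interval (BSide a x) (BSide b y)] : set R) < +oo)%E.
Proof. by rewrite leb1E lebesgue_measure_itv/=; case: ifP => _; rewrite ltry. Qed.

Lemma Rint_derive F f a b : a <= b -> (forall x : R, is_derive x (1 : R) F (f x)) ->
  continuous f -> \int[leb1]_(y in `[a, b]%classic) f y = F b - F a.
Proof.
move=> ab dF cf; rewrite -[LHS]/(\int[lebesgue_measure]_(y in `[a, b]%classic) f y).
move: ab; rewrite le_eqVlt => /orP[/eqP <-|ab].
  by rewrite set_itv1 Rintegral_set1 subrr.
have cF x : {for x, continuous F}.
  by apply: derivable_continuousT => {}x; case: (dF x).
rewrite /Rintegral (@continuous_FTC2 R f F a b)//.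
- by apply: continuous_subspaceT => x; exact: cf.
- split.
  + by move=> x _; case: (dF x).
  + by apply: cvg_at_right_filter; exact: cF.
  + by apply: cvg_at_left_filter; exact: cF.
- by move=> x _; rewrite derive1E; exact: (@derive_val _ _ _ _ _ _ _ (dF x)).
Qed.

Lemma Rint_derive_co F f a b : a <= b ->
  (forall x : R, is_derive x (1 : R) F (f x)) -> continuous f ->
  \int[leb1]_(y in `[a, b[%classic) f y = F b - F a.
Proof.
move=> ab dF cf; rewrite -(Rint_derive ab dF cf).
rewrite -[LHS]/(\int[lebesgue_measure]_(y in `[a, b[%classic) f y).
rewrite -[RHS]/(\int[lebesgue_measure]_(y in `[a, b]%classic) f y).
rewrite /Rintegral integral_itv_bndo_bndc//; apply/measurable_EFinP/measurable_funTS.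
exact: continuous_measurable_fun.
Qed.

Lemma Rint_derive_oo F f a b : a < b ->
  (forall x : R, is_derive x (1 : R) F (f x)) -> continuous f ->
  \int[leb1]_(y in `]a, b[%classic) f y = F b - F a.
Proof.
move=> ab dF cf; rewrite -(Rint_derive_co (ltW ab) dF cf).
rewrite -[LHS]/(\int[lebesgue_measure]_(y in `]a, b[%classic) f y).
rewrite -[RHS]/(\int[lebesgue_measure]_(y in `[a, b[%classic) f y).
rewrite /Rintegral integral_itv_obnd_cbnd//; apply/measurable_EFinP/measurable_funTS.
exact: continuous_measurable_fun.
Qed.

End FundamentalTheorem.

Section SmoothProfiles.
Context {R : realType}.
Implicit Types (p q : R -> R).

Definition bounded_derivable p : Prop :=
  (forall x : R, derivable p x 1) /\ exists M : R, forall x, `|p x| <= M.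

(** The recursion goes through the first derivative, so that the Leibniz rule
reduces order [n] to order [n.-1] for both factors of a product. *)
Fixpoint bounded_derivs n p : Prop :=
  bounded_derivable p /\ (if n is n'.+1 then bounded_derivs n' p^`()%classic else True).

Lemma bounded_derivs_le n p : bounded_derivs n.+1 p -> bounded_derivs n p.
Proof. by elim: n p => [|n IHn] p [] // bp hp; split => //; exact: IHn. Qed.

Lemma profileP p : profile p <-> forall n, bounded_derivs n p.
Proof.
split=> [hp n|hp n].
  elim: n p hp => [|n IHn] p hp /=; split => //; try exact: (hp 0%N).
  by apply: IHn; exact: profile_derive.
elim: n p hp => [|n IHn] p hp; first by have [] := hp 0%N; rewrite derive1n0.
by rewrite derive1Sn; apply: IHn => m; have [] := hp m.+1.
Qed.

Lemma bounded_derivs_ext n p q : p =1 q -> bounded_derivs n p -> bounded_derivs n q.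
Proof. by move=> /funext ->. Qed.

Lemma bounded_derivsD n p q : bounded_derivs n p -> bounded_derivs n q ->
  bounded_derivs n (p + q).
Proof.
elim: n p q => [|n IHn] p q [[dp [M pM]] hp] [[dq [N qN]] hq] /=.
  split=> //; split=> [x|]; first exact: derivableD.
  by exists (M + N) => x; rewrite (le_trans (ler_normD _ _))// lerD.
split; [split=> [x|]|].
- exact: derivableD.
- by exists (M + N) => x; rewrite (le_trans (ler_normD _ _))// lerD.
- apply: (@bounded_derivs_ext _ (p^`()%classic + q^`()%classic)); last exact: IHn.
  by move=> x; rewrite fctE !derive1E deriveD.
Qed.

Lemma bounded_derivsM n p q : bounded_derivs n p -> bounded_derivs n q ->
  bounded_derivs n (p * q).
Proof.
elim: n p q => [|n IHn] p q [[dp [M pM]] hp] [[dq [N qN]] hq] /=.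
  split=> //; split=> [x|]; first exact: derivableM.
  by exists (M * N) => x; rewrite fctE normrM ler_pM.
split; [split=> [x|]|].
- exact: derivableM.
- by exists (M * N) => x; rewrite fctE normrM ler_pM.
- apply: (@bounded_derivs_ext _ (p * q^`()%classic + q * p^`()%classic)).
    by move=> x; rewrite [RHS]derive1E deriveM// -!derive1E.
  apply: bounded_derivsD; apply: IHn => //; apply: bounded_derivs_le.
    by split => //; split => //; exists M.
  by split => //; split => //; exists N.
Qed.

Lemma bounded_derivs_cst n (r : R) : bounded_derivs n (cst r).
Proof.
elim: n r => [|n IHn] r /=; (split; [split=> [x|]|]) => //.
- by exists `|r|.
- by exists `|r|.
- apply: (@bounded_derivs_ext _ (cst 0)); last exact: IHn.
  by move=> x; rewrite derive1E derive_cst.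
Qed.

Lemma is_derive_affine p (s c x d : R) : is_derive (s * x + c) (1 : R) p d ->
  is_derive x (1 : R) (fun x => p (s * x + c)) (d * s).
Proof.
move=> dp; have da : is_derive x (1 : R) (fun x => s * x + c) s.
  have := is_deriveD (is_deriveZ s (is_derive_id x (1:R))) (is_derive_cst c x (1:R)).
  by move/is_derive_eq; apply; rewrite addr0 [_ *: 1]mulr1.
exact: (@is_derive1_comp _ p (fun x => s * x + c) x).
Qed.

Lemma bounded_derivs_affine n p (s c : R) : bounded_derivs n p ->
  bounded_derivs n (fun x => p (s * x + c)).
Proof.
elim: n p => [|n IHn] p [[dp [M pM]] hp] /=.
  split => //; split=> [x|]; last by exists M.
  by have := is_derive_affine (derivableP (dp (s * x + c))); case.
split; [split=> [x|]|].
- by have := is_derive_affine (derivableP (dp (s * x + c))); case.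
- by exists M.
- apply: (@bounded_derivs_ext _ ((fun x => p^`()%classic (s * x + c)) * cst s)).
    move=> x; rewrite fctE !derive1E.
    by rewrite (@derive_val _ _ _ _ _ _ _ (is_derive_affine (derivableP (dp (s * x + c))))).
  by apply: bounded_derivsM; [exact: IHn|exact: bounded_derivs_cst].
Qed.

Lemma profileM p q : profile p -> profile q -> profile (p * q).
Proof. by move=> /profileP hp /profileP hq; apply/profileP => n; exact: bounded_derivsM. Qed.

Lemma profile_cst (r : R) : profile (cst r).
Proof. by apply/profileP => n; exact: bounded_derivs_cst. Qed.

Lemma profileX p m : profile p -> profile (p ^+ m).
Proof.
move=> hp; elim: m => [|m IHm]; first by rewrite expr0; exact: profile_cst.
by rewrite exprS; exact: profileM.
Qed.

Lemma profile_affine p (s c : R) : profile p -> profile (fun x => p (s * x + c)).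
Proof. by move=> /profileP hp; apply/profileP => n; exact: bounded_derivs_affine. Qed.

Lemma profile_cos : profile (@cos R).
Proof.
(* the combinations of cos and sin are closed under differentiation *)
suff H n (a b : R) : bounded_derivs n (fun x => a * cos x + b * sin x).
  apply/profileP => n; apply: bounded_derivs_ext (H n 1 0) => x.
  by rewrite mul1r mul0r addr0.
move: n a b.
have d a b x : is_derive x (1 : R) (fun x => a * cos x + b * sin x)
    (b * cos x + - a * sin x).
  have := is_deriveD (is_deriveZ a (is_derive_cos x)) (is_deriveZ b (is_derive_sin x)).
  by move/is_derive_eq; apply; rewrite /GRing.scale/= mulrN mulNr addrC.
have bd a b : bounded_derivable (fun x => a * cos x + b * sin x).
  split=> [x|]; first by case: (d a b x).
  exists (`|a| + `|b|) => x; rewrite (le_trans (ler_normD _ _))// !normrM.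
  by rewrite lerD// ler_piMr// ler_norml ?cos_geN1 ?cos_le1 ?sin_geN1 ?sin_le1.
elim=> [|n IHn] a b; split => //.
apply: bounded_derivs_ext (IHn b (- a)) => x; rewrite derive1E.
by rewrite (@derive_val _ _ _ _ _ _ _ (d a b x)).
Qed.

End SmoothProfiles.

Section ExponentialTail.
Context {R : realType}.
Implicit Types (p : {poly R}).

(** The functions that are flat at 0, from which a smooth bump is built; with a
polynomial factor they are closed under differentiation. *)
Definition exp_tail p (x : R) : R :=
  if 0 < x then p.[x^-1] * expR (- x^-1) else 0.

Lemma expn_expRN_le (m : nat) (y : R) : 0 <= y -> y ^+ m * expR (- y) <= m`!%:R.
Proof.
move=> y0; rewrite expRN ler_pdivrMr ?expR_gt0//.
have f0 : 0 < m`!%:R :> R by rewrite ltr0n fact_gt0.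
rewrite mulrC -ler_pdivrMr//; case: m f0 => [|m] f0.
  by rewrite expr0 fact0 divr1; apply: le_trans (expR_ge1Dx y); rewrite lerDl.
by apply: le_trans (expR_ge1Dxn m y0); rewrite lerDr.
Qed.

Lemma exp_tail_bounded p : exists M : R, forall x, `|exp_tail p x| <= M.
Proof.
exists (\sum_(i < size p) `|p`_i| * i`!%:R) => x; rewrite /exp_tail.
case: ifPn => [x0|_]; last by rewrite normr0 sumr_ge0// => i _; rewrite mulr_ge0.
rewrite horner_coef mulr_suml (le_trans (ler_norm_sum _ _ _))//.
apply: ler_sum => i _; rewrite -mulrA normrM ler_wpM2l//.
have y0 : 0 <= x^-1 by rewrite invr_ge0 ltW.
by rewrite ger0_norm ?expn_expRN_le// mulr_ge0// ?exprn_ge0// expR_ge0.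
Qed.

Lemma is_derive_exp_tail p (x : R) :
  is_derive x (1 : R) (exp_tail p) (exp_tail ('X^2 * (p - p^`())) x).
Proof.
have [x0|x0|->] := ltgtP x 0.
- have -> : exp_tail ('X^2 * (p - p^`())) x = 0 by rewrite /exp_tail ltNge ltW.
  apply: (@near_eq_is_derive _ _ _ (cst (0 : R)) _ x (1 : R)).
  near=> y; rewrite /exp_tail ltNge ltW//.
  by near: y; exact: lt_nbhsl.
- have xn0 : x != 0 by rewrite gt_eqF.
  have dE : is_derive x (1 : R) (fun x => p.[x^-1] * expR (- x^-1))
      (exp_tail ('X^2 * (p - p^`())) x); last first.
    apply: (near_eq_is_derive _ dE).
    by near=> y; rewrite /exp_tail ifT//; near: y; exact: lt_nbhsr.
  rewrite /exp_tail x0.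
  have dV : is_derive x (1 : R) (fun x : R => x^-1) (- x ^- 2).
    have := is_deriveV xn0 (is_derive_id x (1 : R)).
    by move/is_derive_eq; apply; rewrite [_ *: 1]mulr1.
  have d1 : is_derive x (1 : R) (horner p \o (fun x : R => x^-1)) (p^`().[x^-1] * - x ^- 2).
    exact: (@is_derive1_comp _ (horner p) (fun x : R => x^-1) x).
  have d2 : is_derive x (1 : R) (expR \o (fun x : R => - x^-1)) (expR (- x^-1) * - (- x ^- 2)).
    have dN : is_derive x (1 : R) (fun x : R => - x^-1) (- (- x ^- 2)) := is_deriveN dV.
    exact: (@is_derive1_comp _ expR (fun x : R => - x^-1) x).
  have := is_deriveM d1 d2; move/is_derive_eq; apply.
  transitivity (p.[x^-1] * (expR (- x^-1) * - - x ^- 2) +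
    expR (- x^-1) * (p^`().[x^-1] * - x ^- 2)); first by [].
  rewrite hornerM hornerXn hornerD hornerN -exprVn; ring.
- have -> : exp_tail ('X^2 * (p - p^`())) 0 = 0 by rewrite /exp_tail ltxx.
  have [M hM] := exp_tail_bounded (p * 'X^2).
  have M0 : 0 <= M by exact: le_trans (hM 0).
  have e0 : exp_tail p 0 = 0 by rewrite /exp_tail ltxx.
  (* flatness at 0: the difference quotient at 0 is at most [M * `|h|] *)
  have bound (h : R) : `|exp_tail p h| <= M * h ^+ 2.
    rewrite /exp_tail; case: ifPn => h0; last by rewrite normr0 mulr_ge0// sqr_ge0.
    have := hM h; rewrite /exp_tail h0 hornerM hornerXn -mulrA [X in `|X|]mulrCA => {}hM.
    have hn0 : h != 0 by rewrite gt_eqF.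
    rewrite -[leLHS](_ : `|h ^- 1 ^+ 2 * (p.[h^-1] * expR (- h^-1))| * h ^+ 2 = _).
      by rewrite ler_wpM2r// sqr_ge0.
    rewrite normrM (ger0_norm (sqr_ge0 _)) mulrAC -exprMn mulVf// expr1n mul1r//.
  have cv : (fun h : R => h^-1 *: (exp_tail p (h *: 1 + 0) - exp_tail p 0)) @ 0^' --> (0 : R).
    apply/cvgrPdist_le => e e0'; near=> h; rewrite sub0r normrN e0 subr0 addr0.
    have hn0 : h != 0 by near: h; exact: nbhs_dnbhs_neq.
    rewrite [h *: 1]mulr1 normrM normfV ler_pdivrMl ?normr_gt0//.
    apply: (le_trans (bound h)).
    rewrite -[h ^+ 2](ger0_norm (sqr_ge0 _)) normrX expr2 mulrCA ler_wpM2l//.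
    have : `|h| < e / (M + 1).
      near: h; apply: dnbhs0_lt; rewrite divr_gt0// ltr_wpDl//.
    rewrite ltr_pdivlMr ?ltr_wpDl// => /ltW; apply: le_trans.
    by rewrite mulrC ler_wpM2l// lerDl.
  apply: DeriveDef; first by apply/cvg_ex; exists 0.
  by apply/cvg_lim.
Unshelve. all: by end_near. Qed.

End ExponentialTail.

Section TimeKernel.
Context {R : realType}.

Lemma profile_exp_tail (p : {poly R}) : profile (exp_tail p).
Proof.
apply/profileP => n; elim: n p => [|n IHn] p; split => //;
  try (split; [by move=> x; case: (is_derive_exp_tail p x)|exact: exp_tail_bounded]).
apply: bounded_derivs_ext (IHn ('X^2 * (p - p^`()))) => x; rewrite derive1E.
by rewrite (@derive_val _ _ _ _ _ _ _ (is_derive_exp_tail p x)).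
Qed.

Lemma profile_bmeas_shift d (T : measurableType d) (l : T -> R) (p : R -> R) (x : R) :
  profile p -> measurable_fun setT l -> bmeas (fun y => p (x - l y)).
Proof.
move=> hp ml; apply: (bmeas_comp _ (profile_bmeas hp)).
by apply: measurable_funB => //; exact: measurable_cst.
Qed.

Lemma profile_bmeas_shiftl (p : R -> R) (x : R) :
  profile p -> bmeas (fun y : R => p (x - y)).
Proof. by move=> hp; apply: profile_bmeas_shift. Qed.

Lemma profile_bmeas_shiftr (p : R -> R) (y : R) :
  profile p -> bmeas (fun x : R => p (x - y)).
Proof.
move=> hp; apply: (bmeas_comp _ (profile_bmeas hp)).
by apply: measurable_funB => //; exact: measurable_cst.
Qed.

Lemma profile_continuous_shiftl (p : R -> R) (x : R) :
  profile p -> continuous (fun y : R => p (x - y)).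
Proof.
move=> hp; have := profile_continuous (profile_affine (- 1) x hp).
by under eq_fun do rewrite mulN1r addrC.
Qed.

Lemma Rint_profile_shift (p : R -> R) (x a b : R) : a < b -> profile p ->
  \int[leb1]_(y in `]a, b[%classic) p^`()%classic (x - y) = p (x - a) - p (x - b).
Proof.
move=> ab hp.
have dF (y : R) : is_derive y (1 : R) (fun y => - p (x - y)) (p^`()%classic (x - y)).
  have := is_derive_affine (profile_is_derive (- 1 * y + x) hp).
  move=> /is_deriveN; rewrite mulrN1 opprK mulN1r addrC.
  rewrite (_ : - _ = fun y => - p (x - y))//.
  by apply/funext => z; rewrite fctE mulN1r addrC.
rewrite (Rint_derive_oo ab dF); first by rewrite opprK addrC.
by apply: profile_continuous_shiftl; exact: profile_derive.
Qed.

(** Moving [t] changes the integral only through the values of [p] at the two ends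
of the interval of integration. *)
Lemma Rint_profile_shift_cst (p : R -> R) (S T t : R) : 0 < S -> profile p ->
  0 <= t ->
  \int[leb1]_(s in `]0, S[%classic) p (t - s) - \int[leb1]_(s in `]0, S[%classic) p (0 - s) =
  \int[leb1]_(r in `[0, t]%classic) (p r - p (r - S)).
Proof.
move=> S0 hp t0.
pose Z t := \int[leb1]_(s in `]0, S[%classic) p (t - s).
rewrite -/(Z t) -/(Z 0); symmetry; apply: Rint_derive => //; last first.
  move=> x; apply: cvgB; first exact: profile_continuous.
  have := profile_continuous (profile_affine 1 (- S) hp).
  by under eq_fun do rewrite mul1r; exact.
move=> x.
have dZ : is_derive x (1 : R)
    (fun t => \int[leb1]_(s in `]0, S[%classic) (p (t - id s) * cst 1 s))
    (\int[leb1]_(s in `]0, S[%classic) (p^`()%classic (x - id s) * cst 1 s)).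
  apply: is_derive_bint => //; [exact: leb1_itv_fin|exact: bmeas_cst].
have -> : p x - p (x - S) = \int[leb1]_(s in `]0, S[%classic) p^`()%classic (x - s).
  by rewrite Rint_profile_shift// subr0.
rewrite (_ : Z = fun t => \int[leb1]_(s in `]0, S[%classic) (p (t - id s) * cst 1 s)).
  by under eq_Rintegral do rewrite -[p^`()%classic _]mulr1.
by apply/funext => t'; apply: eq_Rintegral => s _ /=; rewrite mulr1.
Qed.

(** The support of [b] forces [eta <= s - t <= 2 * eta] in an average of [g s]
against [b (t - s)]: the average looks strictly into the future of [t]. So it is
defined for [t = 0] without values of [g] at negative times, and has full mass as
long as [t + 2 * eta <= S]. In the other variable the mass can be smaller than 1,
because times [t] outside of [[0, T]] do not contribute. *)
Lemma time_kernel (eta S T : R) : 0 < eta -> 0 <= T -> T + 2 * eta <= S ->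
  exists b : R -> R, [/\ profile b, forall r, 0 <= b r,
    forall r, - eta <= r -> b r = 0, forall r, r <= - (2 * eta) -> b r = 0 &
    (forall t, 0 <= t <= T -> \int[leb1]_(s in `]0, S[%classic) b (t - s) = 1) /\
    (forall s, 0 <= s <= S -> \int[leb1]_(t in `]0, T[%classic) b (t - s) <= 1)].
Proof.
move=> eta0 T0 TS.
have S0 : 0 < S by apply: lt_le_trans TS; rewrite ltr_wpDl// mulr_gt0.
pose e : R -> R := exp_tail 1.
have he : profile e by exact: profile_exp_tail.
have e_ge0 (x : R) : 0 <= e x.
  by rewrite /e /exp_tail; case: ifP => // _; rewrite hornerE mul1r expR_ge0.
have e0 (x : R) : x <= 0 -> e x = 0 by rewrite /e /exp_tail ltNge => ->.
have e_gt0 (x : R) : 0 < x -> 0 < e x.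
  by move=> x0; rewrite /e /exp_tail x0 hornerE mul1r expR_gt0.
pose g : R -> R := (fun r => e (1 * r + 2 * eta)) * (fun r => e (- 1 * r + - eta)).
have hg : profile g by apply: profileM; exact: profile_affine.
have g_ge0 (r : R) : 0 <= g r by rewrite /g mulr_ge0.
have g0r (r : R) : - eta <= r -> g r = 0.
  by move=> h; rewrite /g fctE (e0 (- 1 * r + - eta)) ?mulr0//; lra.
have g0l (r : R) : r <= - (2 * eta) -> g r = 0.
  by move=> h; rewrite /g fctE (e0 (1 * r + 2 * eta)) ?mul0r//; lra.
pose Z := \int[leb1]_(s in `]0, S[%classic) g (0 - s).
have Zcst (t : R) : 0 <= t <= T -> \int[leb1]_(s in `]0, S[%classic) g (t - s) = Z.
  move=> /andP[t0 tT]; apply/eqP; rewrite -subr_eq0 Rint_profile_shift_cst//.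
  have -> : \int[leb1]_(r in `[0, t]%classic) (g r - g (r - S)) =
      \int[leb1]_(r in `[0, t]%classic) 0.
    apply: eq_Rintegral => r; rewrite inE/= in_itv/= => /andP[r0 rt].
    by rewrite g0r ?g0l ?subr0//; lra.
  by rewrite Rintegral_cst// mul0r.
have Z_ge0 : 0 <= Z by apply: Rintegral_ge0.
have Z_gt0 : 0 < Z.
  rewrite lt_neqAle Z_ge0 andbT eq_sym; apply/eqP => Z0.
  have mI : measurable (`]0, S[%classic : set (measurableTypeR R)) by [].
  have := bint_eq0_ae mI (leb1_itv_fin _ _ _ _)
    (profile_bmeas_shiftl 0 hg) (fun x => g_ge0 _) (Z0 : \int[leb1]_(s in `]0, S[%classic) g (0 - s) = 0).
  move=> [N [mN N0 sN]].
  have : (leb1 (`]eta, (2 * eta)%R[%classic : set R) <= leb1 N)%E.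
    apply: le_measure; rewrite ?inE//.
    move=> s /=; rewrite in_itv/= => /andP[s1 s2]; apply: sN => /=.
    apply/not_implyP; split; first by rewrite in_itv/=; apply/andP; split; lra.
    by apply/eqP; rewrite gt_eqF// /g fctE mulr_gt0// e_gt0//; lra.
  rewrite [leRHS]N0 leb1E lebesgue_measure_itv/= lte_fin ifT; last by lra.
  by rewrite -EFinB lee_fin; lra.
exists (g * cst Z^-1); split.
- by apply: profileM => //; exact: profile_cst.
- by move=> r; rewrite fctE mulr_ge0// invr_ge0.
- by move=> r h; rewrite fctE g0r// mul0r.
- by move=> r h; rewrite fctE g0l// mul0r.
- have E q (D : set R) : measurable D -> (leb1 D < +oo)%E -> bmeas (q : R -> R) ->
      \int[leb1]_(s in D) (q s / Z) = Z^-1 * \int[leb1]_(s in D) q s.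
    by move=> *; rewrite -bintZ//; under eq_Rintegral do rewrite mulrC.
  split=> [t tT|s /andP[s0 sS]].
    rewrite -[LHS]/(\int[leb1]_(s in `]0, S[%classic) (g (t - s) / Z)) E//.
    + by rewrite Zcst// mulVf// gt_eqF.
    + exact: leb1_itv_fin.
    + exact: profile_bmeas_shiftl.
  rewrite -[leLHS]/(\int[leb1]_(t in `]0, T[%classic) (g (t - s) / Z)) E//.
  + rewrite ler_pdivrMl// mulr1.
    move: T0; rewrite le_eqVlt => /orP[/eqP <-|T0].
      by rewrite set_itv_ge ?bnd_simp -?leNgt// Rintegral_set0.
    pose gr r := g (- 1 * r + 0); have hgr : profile gr by exact: profile_affine.
    have := @Rint_profile_shift_cst gr T 0 s T0 hgr s0.
    have E1 (x : R) : gr (s - x) = g (x - s) by rewrite /gr; congr g; ring.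
    under eq_Rintegral do rewrite E1.
    have -> : \int[leb1]_(x in `]0, T[%classic) gr (0 - x) =
        \int[leb1]_(x in `]0, T[%classic) 0.
      apply: eq_Rintegral => x; rewrite inE/= in_itv/= => /andP[x0 xT].
      by rewrite /gr g0r; lra.
    rewrite Rintegral_cst// mul0r subr0 => ->.
    apply: (@le_trans _ _ (\int[leb1]_(r in `[0, s]%classic) g (0 - r))).
      apply: le_bint => //.
      * exact: leb1_itv_fin.
      * apply: bmeasB; [exact: profile_bmeas|exact: profile_bmeas_shiftr].
      * exact: profile_bmeas_shiftl.
      * by move=> r _; rewrite /gr mulN1r addr0 sub0r lerBlDr lerDl.
    apply: bint_le_support => //; [exact: leb1_itv_fin|exact: profile_bmeas_shiftl|].
    move=> r; rewrite /= !in_itv/= => /andP[r0 rs] /negP; rewrite negb_and -!leNgt.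
    by move=> /orP[rle|rge]; [rewrite g0r|rewrite g0l]; rewrite ?mul0r//; lra.
  + exact: leb1_itv_fin.
  + exact: profile_bmeas_shiftr.
Qed.

End TimeKernel.

Section SpaceKernel.
Context {R : realType}.
Implicit Types (x y : R) (N : nat).

Let cpi (x : R) : R := cos (pi * x + 0).
Let spi (x : R) : R := sin (pi * x).

Let profile_cpi : profile cpi. Proof. exact: profile_affine profile_cos. Qed.

Let cpiE x : cpi x = cos (pi * x). Proof. by rewrite /cpi addr0. Qed.

Let is_derive_cpi x : is_derive x (1 : R) cpi (- spi x * pi).
Proof. by have := is_derive_affine (is_derive_cos (pi * x + 0)); rewrite /spi !addr0. Qed.

Let is_derive_spi x : is_derive x (1 : R) spi (cpi x * pi).
Proof.
have := is_derive_affine (is_derive_sin (pi * x + 0)); rewrite cpiE !addr0.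
by rewrite /spi; under eq_fun do rewrite addr0.
Qed.

Let spi2 x : spi x ^+ 2 = 1 - cpi x ^+ 2.
Proof. by rewrite cpiE -(cos2Dsin2 (pi * x)) addrAC subrr add0r. Qed.

Let cpiD1 x : cpi (x - 1) = - cpi x.
Proof. by rewrite !cpiE mulrBr mulr1 -[in RHS](subrK pi (pi * x)) cosDpi opprK. Qed.

Let spiD1 x : spi (x - 1) = - spi x.
Proof. by rewrite /spi mulrBr mulr1 -[in RHS](subrK pi (pi * x)) sinDpi opprK. Qed.

Let cos_moment N x := \int[leb1]_(y in `[0, 1[%classic) cpi (x - y) ^+ N.*2.

Let bmeas_moment N x : bmeas (fun y : R => cpi (x - y) ^+ N).
Proof. by apply: bmeasX; exact: profile_bmeas_shiftl. Qed.

Let cos_moment_rec N x :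
  (2 * N%:R + 2) * cos_moment N.+1 x = (2 * N%:R + 1) * cos_moment N x.
Proof.
(* the recursion is the vanishing of the integral over a period of the
   derivative of [F] *)
pose F y := spi (x - y) * cpi (x - y) ^+ N.*2.+1.
pose f y := pi * ((2 * N%:R + 1) * cpi (x - y) ^+ N.*2
  - (2 * N%:R + 2) * cpi (x - y) ^+ N.+1.*2).
have dF y : is_derive y (1 : R) F (f y).
  pose G z := spi z * cpi z ^+ N.*2.+1.
  have dG z : is_derive z (1 : R) G (pi * ((2 * N%:R + 2) * cpi z ^+ N.+1.*2
      - (2 * N%:R + 1) * cpi z ^+ N.*2)).
    rewrite (_ : G = spi * cpi ^+ N.*2.+1); last by rewrite exprfctE.
    have := is_deriveM (is_derive_spi z) (is_deriveX N.*2.+1 (is_derive_cpi z)).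
    move/is_derive_eq; apply.
    rewrite exprfctE; transitivity (spi z * (N.*2.+1%:R * cpi z ^+ N.*2 * (- spi z * pi)) +
      cpi z ^+ N.*2.+1 * (cpi z * pi)); first by [].
    rewrite -[N.*2.+1%:R]natr1 -mul2n natrM mul2n doubleS !exprS.
    have -> : spi z * ((2 * N%:R + 1) * cpi z ^+ N.*2 * (- spi z * pi)) =
      - ((2 * N%:R + 1) * cpi z ^+ N.*2 * (spi z ^+ 2 * pi)) by ring.
    rewrite spi2; ring.
  have := is_derive_affine (dG (- 1 * y + x)).
  rewrite (_ : (fun y => G _) = F); last first.
    by apply/funext => z; rewrite /F /G mulN1r addrC.
  move/is_derive_eq; apply; rewrite /f.
  have -> : - 1 * y + x = x - y by ring.
  ring.
have cf : continuous f.
  have c0 m (a : R) : continuous (fun y => a * cpi (x - y) ^+ m).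
    have := @profile_continuous_shiftl R _ x (profileM (profile_cst a) (profileX m profile_cpi)).
    by rewrite exprfctE.
  have -> : f = fun y => pi * (2 * N%:R + 1) * cpi (x - y) ^+ N.*2 -
      pi * (2 * N%:R + 2) * cpi (x - y) ^+ N.+1.*2.
    by apply/funext => y; rewrite /f mulrBr; congr (_ - _); rewrite [LHS]mulrA.
  by move=> y; apply: cvgB; exact: c0.
have := Rint_derive_co ler01 dF cf.
have -> : F 1 - F 0 = 0.
  rewrite /F subr0 cpiD1 spiD1 !exprS -mul2n !exprM sqrrN; ring.
have bZ m (a : R) : bmeas (fun y : R => a * cpi (x - y) ^+ m).
  by apply: bmeasZ; exact: bmeas_moment.
rewrite /f bintZ//; [|exact: leb1_itv_fin|by apply: bmeasB; exact: bZ].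
move/eqP; rewrite mulf_eq0 gt_eqF ?pi_gt0//= bintB//; [|exact: leb1_itv_fin|exact: bZ..].
rewrite !bintZ//; try exact: leb1_itv_fin; try exact: bmeas_moment.
by rewrite subr_eq0 => /eqP ->.
Qed.

Let cos_mass N : R := \prod_(m < N) ((2 * m%:R + 1) / (2 * m%:R + 2)).

Let cos_mass_gt0 N : 0 < cos_mass N.
Proof. by apply: prodr_gt0 => m _; rewrite divr_gt0// ltr_wpDl// mulr_ge0. Qed.

Let cos_momentE N x : cos_moment N x = cos_mass N.
Proof.
elim: N => [|N IHN].
  rewrite /cos_moment /cos_mass big_ord0.
  under eq_Rintegral do rewrite expr0.
  rewrite Rintegral_cst// mul1r; transitivity (fine (1%E : \bar R)) => //.
  by apply: (congr1 fine); exact: leb1_itv01.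
have n0 : 2 * N%:R + 2 != 0 :> R by rewrite gt_eqF// ltr_wpDl// mulr_ge0.
rewrite /cos_mass big_ord_recr/= -/(cos_mass N) -IHN.
by apply: (mulfI n0); rewrite cos_moment_rec; field.
Qed.

(** The kernel is a multiple of [cos (pi * x) ^+ (2 * N)]. Its mass over a period is
the Wallis product, and its second moment, measured by the periodic function
[sin (pi * x) ^+ 2], is computed from the recursion for that product; both are
independent of the phase. *)
Lemma space_kernel N : exists k : R -> R, [/\ profile k, forall x, 0 <= k x,
    forall x, k (x + 1) = k x,
    forall x, \int[leb1]_(y in `[0, 1[%classic) k (x - y) = 1 /\
      \int[leb1]_(y in `[0, 1[%classic) k (y - x) = 1 &
    forall x, \int[leb1]_(y in `[0, 1[%classic) (k (x - y) * sin (pi * (x - y)) ^+ 2)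
      <= N.+1%:R^-1].
Proof.
pose Z := cos_mass N; have Z0 : Z != 0 by rewrite gt_eqF ?cos_mass_gt0.
pose k : R -> R := cpi ^+ N.*2 * cst Z^-1.
have kE x : k x = Z^-1 * cpi x ^+ N.*2.
  by rewrite /k exprfctE fctE mulrC.
have int1 x : \int[leb1]_(y in `[0, 1[%classic) k (x - y) = 1.
  under eq_Rintegral do rewrite kE.
  rewrite bintZ//; [|exact: leb1_itv_fin|exact: bmeas_moment].
  by rewrite -/(cos_moment N x) cos_momentE mulVf.
exists k; split.
- apply: profileM; last exact: profile_cst.
  by apply: profileX; exact: profile_cpi.
- move=> x; rewrite kE; apply: mulr_ge0; first by rewrite invr_ge0 ltW ?cos_mass_gt0.
  by rewrite -mul2n exprM exprn_ge0// sqr_ge0.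
- by move=> x; rewrite !kE -{2}(addrK 1 x) cpiD1 -mul2n !exprM sqrrN.
- move=> x; split; first exact: int1.
  rewrite -[RHS](int1 x); apply: eq_Rintegral => y _; rewrite !kE !cpiE.
  by rewrite -opprB mulrN cosN.
- move=> x.
  have -> : \int[leb1]_(y in `[0, 1[%classic) (k (x - y) * sin (pi * (x - y)) ^+ 2) =
     \int[leb1]_(y in `[0, 1[%classic) (Z^-1 * (cpi (x - y) ^+ N.*2 - cpi (x - y) ^+ N.+1.*2)).
    apply: eq_Rintegral => y _; rewrite kE -/(spi (x - y)) spi2 doubleS !exprS; ring.
  rewrite bintZ//; [|exact: leb1_itv_fin|by apply: bmeasB; exact: bmeas_moment].
  rewrite bintB//; [|exact: leb1_itv_fin|exact: bmeas_moment..].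
  rewrite -/(cos_moment N x) -/(cos_moment N.+1 x) !cos_momentE.
  have -> : cos_mass N.+1 = Z * ((2 * N%:R + 1) / (2 * N%:R + 2)).
    by rewrite /cos_mass big_ord_recr.
  rewrite -/Z.
  have n1 : 0 < 2 * N%:R + 2 :> R by rewrite ltr_wpDl// mulr_ge0.
  have n2 : 0 < N.+1%:R :> R by rewrite ltr0n.
  rewrite [leLHS](_ : _ = (2 * N%:R + 2)^-1); last first.
    field; apply/andP; split => //; rewrite gt_eqF.
  by rewrite lef_pV2 ?posrE// -natr1; have : 0 <= N%:R :> R by []; lra.
Qed.

End SpaceKernel.

(** * Mollification on the torus *)

Section Convolution.
Context {R : realType}.
Implicit Types (p : 'I_3 -> R -> R) (q : R -> R) (f g : spacetime R -> R)
  (z : spacetime R) (k j : 'I_3).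

Definition xcoord (j : 'I_3) (x : space3 R) : R :=
  if j == 0%N :> nat then x.1.1 else if j == 1%N :> nat then x.1.2 else x.2.

Definition ex k : spacetime R := (Defs.basis k, 0).
Definition et : spacetime R := (0, 1).

Lemma coord_line j k (s : R) z :
  xcoord j (s *: ex k + z).1 = (if j == k then s else 0) + xcoord j z.1.
Proof.
rewrite -val_eqE; case: j => -[|[|[|//]]] ?; case: k => -[|[|[|//]]] ?;
  rewrite /xcoord/= /GRing.scale/= ?mulr1 ?mulr0//.
Qed.

Lemma time_line k (s : R) z : (s *: ex k + z).2 = z.2.
Proof. by rewrite /= scaler0 add0r. Qed.

Lemma coord_line_time j (s : R) z : xcoord j (s *: et + z).1 = xcoord j z.1.
Proof.
by case: j => -[|[|[|//]]] ?; rewrite /xcoord/= /GRing.scale/= ?mulr0 ?add0r.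
Qed.

Lemma time_line_time (s : R) z : (s *: et + z).2 = s + z.2.
Proof. by rewrite /= [_ *: 1]mulr1. Qed.

Lemma measurable_coord j : measurable_fun setT (fun z : spacetime R => xcoord j z.1).
Proof.
have m1 : measurable_fun setT (fun z : spacetime R => z.1) by exact: measurable_fst.
have m2 : measurable_fun setT (fun z : spacetime R => z.1.1).
  by apply: measurableT_comp m1; exact: measurable_fst.
rewrite /xcoord; case: (j == 0%N :> nat); [|case: (j == 1%N :> nat)].
- by apply: measurableT_comp m2; exact: measurable_fst.
- by apply: measurableT_comp m2; exact: measurable_snd.
- by apply: measurableT_comp m1; exact: measurable_snd.
Qed.

Lemma measurable_time : measurable_fun setT (fun z : spacetime R => z.2).
Proof. exact: measurable_snd. Qed.

Definition kern p q z z' : R :=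
  (\prod_j p j (xcoord j z.1 - xcoord j z'.1)) * q (z.2 - z'.2).

Lemma bmeas_prod d (T : measurableType d) (I : Type) (s : seq I) (P : pred I)
    (F : I -> T -> R) :
  (forall i, bmeas (F i)) -> bmeas (fun x => \prod_(i <- s | P i) F i x).
Proof.
move=> bF; elim: s => [|i s IHs].
  by under eq_fun do rewrite big_nil; exact: bmeas_cst.
under eq_fun do rewrite big_cons; case: (P i) => //; exact: bmeasM.
Qed.

Lemma bmeas_kern2 p q : (forall j, profile (p j)) -> profile q ->
  bmeas (fun zz : spacetime R * spacetime R => kern p q zz.1 zz.2).
Proof.
move=> hp hq; apply: bmeasM.
  apply: bmeas_prod => j; apply: (bmeas_comp _ (profile_bmeas (hp j))).
  apply: measurable_funB.
    exact: (measurableT_comp (measurable_coord j) measurable_fst).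
  exact: (measurableT_comp (measurable_coord j) measurable_snd).
apply: (bmeas_comp _ (profile_bmeas hq)); apply: measurable_funB.
  exact: (measurableT_comp measurable_time measurable_fst).
exact: (measurableT_comp measurable_time measurable_snd).
Qed.

Lemma bmeas_kern p q z : (forall j, profile (p j)) -> profile q ->
  bmeas (fun z' => kern p q z z').
Proof.
by move=> hp hq; have := bmeas_kern2 hp hq; exact: (@bmeas_pair2 R _ _ _ _ _ z).
Qed.

Definition slab (S : R) : set (spacetime R) := cylinder `]0, S[%classic.

Lemma measurable_slab S : measurable (slab S).
Proof. exact: measurable_cylinder. Qed.

Lemma leb4_slab_fin S : (leb4 (slab S) < +oo)%E.
Proof. by apply: leb4_cylinder_fin => //; exact: leb1_itv_fin. Qed.

(** The kernels are periodic in space, so that integrating over one cell is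
convolution on the torus. Only the values of [f] at times between 0 and [S]
enter. *)
Definition mollify S p q f z : R := \int[leb4]_(z' in slab S) (kern p q z z' * f z').

Section mollify.
Variables (S : R) (p : 'I_3 -> R -> R) (q : R -> R).
Hypothesis (hp : forall j, profile (p j)) (hq : profile q).
Let mS := measurable_slab S.
Let finS := leb4_slab_fin S.

Lemma bmeas_mollify f : bmeas f -> bmeas (mollify S p q f).
Proof.
move=> bf; have := @bmeas_bint2 R _ _ _ _ leb4 (slab S) mS finS
  (fun zz => kern p q zz.1 zz.2 * f zz.2); apply.
apply: bmeasM; first exact: bmeas_kern2.
by apply: (bmeas_comp _ bf); exact: measurable_snd.
Qed.

Lemma bmeas_kernM f z : bmeas f -> bmeas (fun z' => kern p q z z' * f z').
Proof. by move=> bf; apply: bmeasM => //; exact: bmeas_kern. Qed.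

Lemma mollifyD f g z : bmeas f -> bmeas g ->
  mollify S p q (fun z => f z + g z) z = mollify S p q f z + mollify S p q g z.
Proof.
move=> bf bg; rewrite /mollify -bintD//; try exact: bmeas_kernM.
by apply: eq_Rintegral => z' _; rewrite mulrDr.
Qed.

Lemma mollifyB f g z : bmeas f -> bmeas g ->
  mollify S p q (fun z => f z - g z) z = mollify S p q f z - mollify S p q g z.
Proof.
move=> bf bg; rewrite /mollify -bintB//; try exact: bmeas_kernM.
by apply: eq_Rintegral => z' _; rewrite mulrBr.
Qed.

Lemma mollifyZ (r : R) f z : bmeas f ->
  mollify S p q (fun z => r * f z) z = r * mollify S p q f z.
Proof.
move=> bf; rewrite /mollify -bintZ//; try exact: bmeas_kernM.
by apply: eq_Rintegral => z' _; rewrite mulrCA.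
Qed.

Lemma mollifyN f z : bmeas f ->
  mollify S p q (fun z => - f z) z = - mollify S p q f z.
Proof.
move=> bf; rewrite /mollify -bintN//; try exact: bmeas_kernM.
by apply: eq_Rintegral => z' _; rewrite mulrN.
Qed.

Lemma mollify_sum (I : Type) (s : seq I) (P : pred I) (F : I -> spacetime R -> R) z :
  (forall i, bmeas (F i)) ->
  mollify S p q (fun z => \sum_(i <- s | P i) F i z) z =
  \sum_(i <- s | P i) mollify S p q (F i) z.
Proof.
move=> bF; rewrite /mollify -bint_sum//; last by move=> i; exact: bmeas_kernM.
by apply: eq_Rintegral => z' _; rewrite mulr_sumr.
Qed.

Lemma mollify_ae_eq f g z : bmeas f -> bmeas g ->
  (\forall z \ae leb4, slab S z -> f z = g z) -> mollify S p q f z = mollify S p q g z.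
Proof.
move=> bf bg fg; apply: bint_ae_eq => //; try exact: bmeas_kernM.
by apply: (aeS _ fg) => z' h Sz'; rewrite h.
Qed.

End mollify.

(** The factors of the kernel after differentiation in the [k]-th variable. *)
Definition dprof p k j : R -> R := if j == k then (p j)^`()%classic else p j.

Lemma profile_dprof p k : (forall j, profile (p j)) -> forall j, profile (dprof p k j).
Proof. by move=> hp j; rewrite /dprof; case: ifP => // _; exact: profile_derive. Qed.

Lemma is_derive_mollify_x S p q f k z : (forall j, profile (p j)) -> profile q ->
  bmeas f -> is_derive z (ex k) (mollify S p q f) (mollify S (dprof p k) q f z).
Proof.
move=> hp hq bf; apply/is_derive_line0.
pose h z' := (\prod_(j | j != k) p j (xcoord j z.1 - xcoord j z'.1)) *
  q (z.2 - z'.2) * f z'.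
have bh : bmeas h.
  apply: bmeasM => //; apply: bmeasM.
    apply: bmeas_prod => j; apply: profile_bmeas_shift => //.
    exact: measurable_coord.
  by apply: profile_bmeas_shift => //; exact: measurable_time.
have ml : measurable_fun setT (fun z' : spacetime R => xcoord k z'.1 - xcoord k z.1).
  by apply: measurable_funB; [exact: measurable_coord|exact: measurable_cst].
have := @is_derive_bint R _ _ leb4 (slab S) (p k)
  (fun z' => xcoord k z'.1 - xcoord k z.1) h 0 (measurable_slab S) (leb4_slab_fin S)
  (hp k) ml bh.
rewrite (_ : (fun a => _) = (fun s => mollify S p q f (s *: ex k + z))); last first.
  apply/funext => s; apply: eq_Rintegral => z' _; rewrite /kern time_line (bigD1 k)//=.
  rewrite coord_line eqxx /h -!mulrA; congr (p k _ * _).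
    by rewrite opprB addrA -addrA.
  by congr (_ * _); apply: eq_bigr => j /negPf jk; rewrite coord_line jk add0r.
move=> /is_derive_eq; apply; apply: eq_Rintegral => z' _.
rewrite /kern (bigD1 k)//= {1}/dprof eqxx /h -!mulrA; congr (_ * _).
  by congr (_^`()%classic _); rewrite sub0r opprB.
by congr (_ * _); apply: eq_bigr => j /negPf jk; rewrite /dprof jk.
Qed.

Lemma is_derive_mollify_t S p q f z : (forall j, profile (p j)) -> profile q ->
  bmeas f -> is_derive z et (mollify S p q f) (mollify S p q^`()%classic f z).
Proof.
move=> hp hq bf; apply/is_derive_line0.
pose h z' := (\prod_j p j (xcoord j z.1 - xcoord j z'.1)) * f z'.
have bh : bmeas h.
  apply: bmeasM => //; apply: bmeas_prod => j; apply: profile_bmeas_shift => //.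
  exact: measurable_coord.
have ml : measurable_fun setT (fun z' : spacetime R => z'.2 - z.2).
  by apply: measurable_funB; [exact: measurable_time|exact: measurable_cst].
have := @is_derive_bint R _ _ leb4 (slab S) q
  (fun z' => z'.2 - z.2) h 0 (measurable_slab S) (leb4_slab_fin S) hq ml bh.
rewrite (_ : (fun a => _) = (fun s => mollify S p q f (s *: et + z))); last first.
  apply/funext => s; apply: eq_Rintegral => z' _; rewrite /kern time_line_time.
  rewrite /h mulrCA mulrA; congr (_ * _ * _).
    by apply: eq_bigr => j _; rewrite coord_line_time.
  by congr q; rewrite opprB addrA.
move=> /is_derive_eq; apply; apply: eq_Rintegral => z' _.
by rewrite /kern /h mulrCA mulrA; congr (_ * _ * _); congr (_^`()%classic _);
  rewrite sub0r opprB.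
Qed.

End Convolution.

(** * Integration by parts on the torus cylinder *)

Section IntegrationByParts.
Context {R : realType}.
Implicit Types (F dF : spacetime R -> R) (k : 'I_3).

Lemma unit_line_integral (F f : R -> R) :
  (forall s : R, is_derive s (1 : R) F (f s)) -> continuous f -> F 1 = F 0 ->
  \int[leb1]_(s in `[0, 1[%classic) f s = 0.
Proof. by move=> dF cf F10; rewrite (Rint_derive_co ler01 dF cf) F10 subrr. Qed.

Lemma bint0 d (T : measurableType d) (mu : {measure set T -> \bar R}) (D : set T)
  (f : T -> R) : measurable D -> (forall x, D x -> f x = 0) ->
  \int[mu]_(x in D) f x = 0.
Proof.
move=> mD f0; transitivity (\int[mu]_(x in D) (0 : R)).
  by apply: eq_Rintegral => x; rewrite inE; exact: f0.
by rewrite Rintegral_cst// mul0r.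
Qed.

Lemma basis_line (s x0 x1 x2 : R) (k : 'I_3) :
  s *: Defs.basis k + (x0, x1, x2) =
  (s * (k == 0%N :> nat)%:R + x0, s * (k == 1%N :> nat)%:R + x1,
   s * (k == 2%N :> nat)%:R + x2).
Proof. by []. Qed.

(** By Fubini's theorem the integral over the cell can be computed along the lines
in direction [k] first. *)
Lemma cell_integral_dx k (g : space3 R -> R) : bmeas g ->
  (forall x : space3 R,
    \int[leb1]_(s in `[0, 1[%classic) g (s *: Defs.basis k + x) = 0) ->
  \int[leb3]_(x in cell) g x = 0.
Proof.
move=> bg g0.
have m1 : measurable (`[0, 1[%classic : set (measurableTypeR R)) by [].
have f1 := @leb1_itv_fin R true true 0 1.
have m2 := measurableX m1 m1.
have f2 := prod_measureX_fin m1 f1 m1 f1.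
case: k g0 => -[|[|[|//]]] ? g0.
- transitivity (\int[leb1]_(x2 in `[0, 1[%classic) \int[leb1]_(x1 in `[0, 1[%classic)
    \int[leb1]_(x0 in `[0, 1[%classic) g (x0, x1, x2)).
    rewrite [LHS](bint_fubini2 m2 f2 m1 f1 bg); apply: eq_Rintegral => x2 _.
    by rewrite (bint_fubini2 m1 f1 m1 f1)//; exact: bmeas_pair1.
  apply: bint0 => // x2 _; apply: bint0 => // x1 _.
  rewrite -[RHS](g0 (0, x1, x2)); apply: eq_Rintegral => x0 _; congr g.
  by rewrite basis_line/= mulr1 !mulr0 addr0 !add0r.
- transitivity (\int[leb1]_(x2 in `[0, 1[%classic) \int[leb1]_(x0 in `[0, 1[%classic)
    \int[leb1]_(x1 in `[0, 1[%classic) g (x0, x1, x2)).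
    rewrite [LHS](bint_fubini2 m2 f2 m1 f1 bg); apply: eq_Rintegral => x2 _.
    by rewrite (bint_fubini1 m1 f1 m1 f1)//; exact: bmeas_pair1.
  apply: bint0 => // x2 _; apply: bint0 => // x0 _.
  rewrite -[RHS](g0 (x0, 0, x2)); apply: eq_Rintegral => x1 _; congr g.
  by rewrite basis_line/= mulr1 !mulr0 addr0 !add0r.
- rewrite [LHS](bint_fubini1 m2 f2 m1 f1 bg); apply: bint0 => // -[x0 x1] _.
  rewrite -[RHS](g0 (x0, x1, 0)); apply: eq_Rintegral => x2 _; congr g.
  by rewrite basis_line/= mulr1 !mulr0 addr0 !add0r.
Qed.

Lemma ex_line (s t : R) k x : s *: ex k + (x, t) = (s *: Defs.basis k + x, t).
Proof.
by rewrite [LHS]surjective_pairing time_line.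
Qed.

Lemma et_line (s t : R) (x : space3 R) : s *: et + (x, t) = (x, s + t).
Proof.
by rewrite [LHS]surjective_pairing time_line_time /= scaler0 add0r.
Qed.

Lemma slab_fubini1 (T : R) (f : spacetime R -> R) : bmeas f ->
  \int[leb4]_(z in slab T) f z =
  \int[leb3]_(x in cell) \int[leb1]_(t in `]0, T[%classic) f (x, t).
Proof.
move=> bf; have mI : measurable (`]0, T[%classic : set (measurableTypeR R)) by [].
exact: (@bint_fubini1 R _ _ _ _ leb3 leb1 cell _ measurable_cell leb3_cell_fin
  mI (leb1_itv_fin _ _ _ _) f bf).
Qed.

Lemma slab_fubini2 (T : R) (f : spacetime R -> R) : bmeas f ->
  \int[leb4]_(z in slab T) f z =
  \int[leb1]_(t in `]0, T[%classic) \int[leb3]_(x in cell) f (x, t).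
Proof.
move=> bf; have mI : measurable (`]0, T[%classic : set (measurableTypeR R)) by [].
exact: (@bint_fubini2 R _ _ _ _ leb3 leb1 cell _ measurable_cell leb3_cell_fin
  mI (leb1_itv_fin _ _ _ _) f bf).
Qed.

(** The derivative [dF] is known on whole coordinate lines but need not be bounded
there, as weights in time grow; [g] is a bounded function that agrees with it on
the slab. *)
Lemma slab_integral_dx (T : R) k F dF (g : spacetime R -> R) : bmeas g ->
  (forall z, 0 < z.2 < T -> dF z = g z) ->
  (forall z, is_derive z (ex k) F (dF z)) ->
  (forall z, continuous (fun s : R => dF (s *: ex k + z))) ->
  (forall z, F (ex k + z) = F z) -> \int[leb4]_(z in slab T) g z = 0.
Proof.
move=> bg dFg dFd cdF perF.
rewrite slab_fubini2//.
apply: bint0 => // t; rewrite /= in_itv/= => tT; apply: (@cell_integral_dx k).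
  exact: bmeas_pair1.
move=> x.
have dl s : is_derive s (1 : R) (fun s => F (s *: ex k + (x, t))) (dF (s *: ex k + (x, t))).
  exact: (proj1 (@is_derive_lineP R _ F (x, t) (ex k) s _) (dFd _)).
have per : F (1 *: ex k + (x, t)) = F (0 *: ex k + (x, t)).
  by rewrite scale1r scale0r add0r perF.
rewrite -[RHS](unit_line_integral dl (cdF _) per).
by apply: eq_Rintegral => s _; rewrite ex_line dFg.
Qed.

Lemma slab_integral_dt (T : R) F dF (g : spacetime R -> R) : 0 < T -> bmeas g ->
  (forall z, 0 < z.2 < T -> dF z = g z) ->
  (forall z, is_derive z et F (dF z)) ->
  (forall z, continuous (fun s : R => dF (s *: et + z))) ->
  \int[leb4]_(z in slab T) g z = \int[leb3]_(x in cell) (F (x, T) - F (x, 0)).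
Proof.
move=> T0 bg dFg dFd cdF.
rewrite slab_fubini1//.
apply: eq_Rintegral => x _.
have dl s : is_derive s (1 : R) (fun s => F (s *: et + (x, 0))) (dF (s *: et + (x, 0))).
  exact: (proj1 (@is_derive_lineP R _ F (x, 0) et s _) (dFd _)).
have := Rint_derive_oo T0 dl (cdF _).
rewrite !et_line addr0 add0r => <-.
apply: eq_Rintegral => t; rewrite inE/= in_itv/= => tT.
by rewrite et_line addr0 dFg.
Qed.

End IntegrationByParts.

(** * Kernels as test functions *)

Section SmoothKernels.
Context {R : realType}.
Implicit Types (f g phi : spacetime R -> R) (v z : spacetime R) (k j : 'I_3).

(** Differentiability up to order [n + 1], in a form that permits induction on [n]
with the Leibniz rule; directions are chosen one at a time. *)
Fixpoint diffs n f : Prop := (forall z, differentiable f z) /\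
  (if n is n'.+1 then forall v, diffs n' ('D_v f) else True).

Lemma diffs_smooth f : (forall n, diffs n f) -> smooth f.
Proof.
move=> df vs; have := df (size vs); elim/last_ind: vs f {df} => [|vs v IHvs] f.
  by case.
by rewrite size_rcons foldr_rcons => -[_ /(_ v)]; exact: IHvs.
Qed.

Lemma diffs_le n f : diffs n.+1 f -> diffs n f.
Proof. by elim: n f => [|n IHn] f [] // df hf; split => // v; exact: IHn. Qed.

Lemma diffsD n f g : diffs n f -> diffs n g -> diffs n (fun z => f z + g z).
Proof.
elim: n f g => [|n IHn] f g [df hf] [dg hg]; split => //; try (move=> z; exact: differentiableD).
move=> v; rewrite (_ : 'D_v _ = fun z => 'D_v f z + 'D_v g z).
  by apply: IHn; [exact: hf|exact: hg].
by apply/funext => z; rewrite deriveD//; exact: diff_derivable.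
Qed.

Lemma diffsM n f g : diffs n f -> diffs n g -> diffs n (fun z => f z * g z).
Proof.
elim: n f g => [|n IHn] f g [df hf] [dg hg]; split => //; try (move=> z; exact: differentiableM).
move=> v; rewrite (_ : 'D_v _ = fun z => f z * 'D_v g z + g z * 'D_v f z).
  by apply: diffsD; apply: IHn; try (by apply: diffs_le; split); [exact: hg|exact: hf].
by apply/funext => z; rewrite deriveM//; exact: diff_derivable.
Qed.

Lemma diffs_cst n (r : R) : diffs n (fun=> r).
Proof.
elim: n r => [|n IHn] r; split => //; try (move=> z; exact: differentiable_cst).
move=> v; rewrite (_ : 'D_v _ = fun=> 0); first exact: IHn.
by apply/funext => z; exact: derive_cst.
Qed.

Lemma diffs_prod n (I : Type) (s : seq I) (F : I -> spacetime R -> R) :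
  (forall i, diffs n (F i)) -> diffs n (fun z => \prod_(i <- s) F i z).
Proof.
move=> dF; elim: s => [|i s IHs].
  by under eq_fun do rewrite big_nil; exact: diffs_cst.
by under eq_fun do rewrite big_cons; exact: diffsM.
Qed.

Lemma diffs_profile n (p : R -> R) (l : spacetime R -> R) (c : spacetime R -> R) :
  profile p -> (forall z, differentiable l z) ->
  (forall (s : R) v z, l (s *: v + z) = s * c v + l z) ->
  diffs n (fun z => p (l z)).
Proof.
move=> + dl lE; elim: n p => [|n IHn] p hp.
  split=> // z; apply: (differentiable_comp (g := p)) => //.
  by apply/derivable1_diffP; case: (profile_is_derive (l z) hp).
split=> [z|v].
  apply: (differentiable_comp (g := p)) => //.
  by apply/derivable1_diffP; case: (profile_is_derive (l z) hp).
rewrite (_ : 'D_v _ = fun z => p^`()%classic (l z) * c v).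
  by apply: diffsM; [apply: IHn; exact: profile_derive|exact: diffs_cst].
apply/funext => z; apply: (@derive_val _ _ _ _ _ _ _ _).
apply/is_derive_line0.
have := is_derive_affine (profile_is_derive (c v * 0 + l z) hp).
rewrite mulr0 add0r (_ : (fun x : R => p (c v * x + l z)) = fun s => p (l (s *: v + z)))//.
by apply/funext => s; rewrite lE mulrC.
Qed.

Lemma differentiable_fstT (V W : normedModType R) (x : V * W) : differentiable fst x.
Proof. by apply: (@linear_differentiable _ _ _ fst) => y; exact: cvg_fst. Qed.

Lemma differentiable_sndT (V W : normedModType R) (x : V * W) : differentiable snd x.
Proof. by apply: (@linear_differentiable _ _ _ snd) => y; exact: cvg_snd. Qed.

Lemma differentiable_coord j z : differentiable (fun z : spacetime R => xcoord j z.1) z.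
Proof.
have d1 := @differentiable_fstT _ _ z.
have d2 : differentiable (fun z : spacetime R => z.1.1) z.
  by apply: (differentiable_comp (g := fst)) => //; exact: differentiable_fstT.
rewrite /xcoord; case: (j == 0%N :> nat); [|case: (j == 1%N :> nat)].
- by apply: (differentiable_comp (g := fst)) => //; exact: differentiable_fstT.
- by apply: (differentiable_comp (g := snd)) => //; exact: differentiable_sndT.
- by apply: (differentiable_comp (g := snd)) => //; exact: differentiable_sndT.
Qed.

Lemma differentiable_time z : differentiable (fun z : spacetime R => z.2) z.
Proof. exact: differentiable_sndT. Qed.

Lemma coord_linear j (s : R) v z :
  xcoord j (s *: v + z).1 = s * xcoord j v.1 + xcoord j z.1.
Proof. by case: j => -[|[|[|//]]] ?. Qed.

Lemma kern_smooth p q z : (forall j, profile (p j)) -> profile q ->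
  smooth (kern p q z).
Proof.
move=> hp hq; apply: diffs_smooth => n; apply: diffsM.
  apply: diffs_prod => j; apply: (@diffs_profile _ _ (fun z' => xcoord j z.1 - xcoord j z'.1)
    (fun v => - xcoord j v.1)) => //.
  + by move=> z'; apply: differentiableB; [exact: differentiable_cst|exact: differentiable_coord].
  + by move=> s v z'; rewrite coord_linear; ring.
apply: (@diffs_profile _ _ (fun z' => z.2 - z'.2) (fun v => - v.2)) => //.
- by move=> z'; apply: differentiableB; [exact: differentiable_cst|exact: differentiable_time].
- by move=> s v z'; rewrite /= /GRing.scale/=; ring.
Qed.

Lemma is_derive_reflect (p : R -> R) (a x : R) : profile p ->
  is_derive x (1 : R) (fun s => p (a - s)) (- p^`()%classic (a - x)).
Proof.
move=> hp; have := is_derive_affine (profile_is_derive (- 1 * x + a) hp).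
rewrite mulrN1 (_ : (fun x => p (-1 * x + a)) = fun s => p (a - s)).
  by rewrite mulN1r addrC.
by apply/funext => s; rewrite mulN1r addrC.
Qed.

Lemma dx_kern p q z z' k : (forall j, profile (p j)) -> profile q ->
  dx k (kern p q z) z' = - kern (dprof p k) q z z'.
Proof.
move=> hp hq; apply: (@derive_val _ _ _ _ _ _ _ _); apply/is_derive_line0.
pose r := (\prod_(j | j != k) p j (xcoord j z.1 - xcoord j z'.1)) * q (z.2 - z'.2).
have := is_deriveM (is_derive_reflect (xcoord k z.1 - xcoord k z'.1) 0 (hp k))
  (is_derive_cst r (0 : R) (1 : R)).
rewrite (_ : _ * cst r = fun s : R => kern p q z (s *: ex k + z')); last first.
  apply/funext => s; rewrite /kern time_line (bigD1 k)//= coord_line eqxx.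
  rewrite fctE /r mulrA; congr (_ * _ * _).
    by congr (p k _); rewrite opprD addrA addrAC.
  by apply: eq_bigr => j /negPf jk; rewrite coord_line jk add0r.
move/is_derive_eq; apply; rewrite scaler0 add0r subr0 /kern (bigD1 k)//=.
rewrite {1}/dprof eqxx.
transitivity (r * - (p k)^`()%classic (xcoord k z.1 - xcoord k z'.1)) => //.
rewrite mulrN mulrC /r mulrA; congr (- (_ * _ * _)).
by apply: eq_bigr => j /negPf jk; rewrite /dprof jk.
Qed.

Lemma dt_kern p q z z' : (forall j, profile (p j)) -> profile q ->
  dt (kern p q z) z' = - kern p q^`()%classic z z'.
Proof.
move=> hp hq; apply: (@derive_val _ _ _ _ _ _ _ _); apply/is_derive_line0.
pose r := \prod_j p j (xcoord j z.1 - xcoord j z'.1).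
have := is_deriveM (is_derive_reflect (z.2 - z'.2) 0 hq)
  (is_derive_cst r (0 : R) (1 : R)).
rewrite (_ : _ * cst r = fun s : R => kern p q z (s *: et + z')); last first.
  apply/funext => s; rewrite /kern time_line_time fctE mulrC; congr (_ * _).
    by apply: eq_bigr => j _; rewrite coord_line_time.
  by congr q; rewrite opprD addrA addrAC.
move/is_derive_eq; apply; rewrite scaler0 add0r subr0 /kern.
by transitivity (r * - q^`()%classic (z.2 - z'.2)) => //; rewrite mulrN.
Qed.

(** In time the test function is supported in [[z.2 + eta, z.2 + 2 * eta]], hence
away from the initial time even when [z.2 = 0]. *)
Lemma kern_test p q (eta : R) z : (forall j, profile (p j)) -> profile q ->
  (forall j x, p j (x + 1) = p j x) -> 0 < eta -> 0 <= z.2 ->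
  (forall r, - eta <= r -> q r = 0) -> (forall r, r <= - (2 * eta) -> q r = 0) ->
  interior_test_function (kern p q z).
Proof.
move=> hp hq per eta0 z0 qr ql.
split; first split.
- exact: kern_smooth.
- move=> t k x; rewrite /kern; congr (_ * _); apply: eq_bigr => j _.
  have := coord_line j k 1 (x, t); rewrite ex_line/= scale1r [_ + x]addrC => ->.
  case: ifP => _; last by rewrite add0r.
  by rewrite -[LHS]per; congr (p j _); ring.
- exists (z.2 + 2 * eta) => x t zt; rewrite /kern/= ql ?mulr0//; lra.
- exists eta => // x t te; rewrite /kern/= qr ?mulr0//; lra.
Qed.

End SmoothKernels.

(** * Bounded representatives of a solution *)

Section Cleaning.
Context {R : realType}.
Implicit Types (f g h : spacetime R -> R) (z : spacetime R) (S : R).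

Definition halfspace : set (spacetime R) := cylinder `]0, +oo[%classic.

Lemma measurable_halfspace : measurable (halfspace : set (spacetime R)).
Proof. exact: measurable_cylinder. Qed.

Lemma slab_halfspace S : slab S `<=` halfspace.
Proof.
by move=> [x t] [/= xc]; rewrite !in_itv/= => /andP[t0 _]; split; rewrite //= in_itv/= t0.
Qed.

Lemma halfspace_slab S z : halfspace z -> z.2 < S -> slab S z.
Proof.
case: z => x t [/= xc]; rewrite !in_itv/= andbT => t0 tS; split => //=.
by rewrite in_itv/= t0.
Qed.

Lemma slab_lt S z : slab S z -> 0 < z.2 < S.
Proof. by case: z => x t [/= _]; rewrite in_itv. Qed.

Lemma ae_halfspace_slab (P : spacetime R -> Prop) S :
  (\forall z \ae leb4, halfspace z -> P z) -> \forall z \ae leb4, slab S z -> P z.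
Proof. by apply: aeS => z h Sz; apply: h; exact: slab_halfspace Sz. Qed.

Lemma Rint_ae_eq d (T : measurableType d) (mu : {measure set T -> \bar R})
    (D : set T) (f g : T -> R) : measurable D -> measurable_fun D f ->
  measurable_fun D g -> (\forall x \ae mu, D x -> f x = g x) ->
  \int[mu]_(x in D) f x = \int[mu]_(x in D) g x.
Proof.
move=> mD mf mg fg; congr fine; apply: ae_eq_integral => //; try exact/measurable_EFinP.
by apply: filterS fg => x fgx Dx /=; rewrite fgx.
Qed.

(** Passes from the functions of the weak formulation to bounded representatives, and
from an infinite time interval to the support of the test function. *)
Lemma Rint_halfspace_slab h g S : measurable_fun halfspace h -> bmeas g ->
  (\forall z \ae leb4, halfspace z -> h z = g z) ->
  (forall z, halfspace z -> S <= z.2 -> g z = 0) ->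
  \int[leb4]_(z in halfspace) h z = \int[leb4]_(z in slab S) g z.
Proof.
move=> mh [mg _] hg g0.
have -> : \int[leb4]_(z in halfspace) h z = \int[leb4]_(z in halfspace) g z.
  apply: (@Rint_ae_eq _ _ leb4 halfspace h g measurable_halfspace mh _ hg).
  exact: measurable_funTS.
apply: Rint_support => z.
  move=> Qz nSz; apply: g0 => //; rewrite leNgt; apply/negP => zS.
  exact/nSz/halfspace_slab.
by move=> /slab_halfspace Qz nQz.
Qed.

Definition clip (a b x : R) : R := Num.max a (Num.min b x).

Lemma clip_id a b x : a <= x <= b -> clip a b x = x.
Proof. by move=> /andP[ax xb]; rewrite /clip (min_idPr _)// (max_idPr _). Qed.

Lemma clip_bound a b x : a <= b -> a <= clip a b x <= b.
Proof. by move=> ab; rewrite /clip le_max lexx/= ge_max ab ge_min lexx. Qed.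

Lemma bmeas_clip_restrict (a b : R) f : a <= b -> measurable_fun halfspace f ->
  bmeas ((fun z => clip a b (f z)) \_ halfspace).
Proof.
move=> ab mf; split.
  apply/(measurable_restrictT _ measurable_halfspace).
  by apply: measurable_maxr => //; apply: measurable_minr.
exists (`|a| + `|b|) => z; rewrite patchE; case: ifP => _; last first.
  by rewrite normr0 addr_ge0.
have /andP[h1 h2] := clip_bound (f z) ab; rewrite ler_norml; apply/andP; split.
  by apply: le_trans h1; rewrite opprD lerBlDr ler_wpDr// lerNl -normrN ler_norm.
by apply: (le_trans h2); rewrite (le_trans (ler_norm b))// lerDr.
Qed.

End Cleaning.

Section FluxSolutions.
Context {R : realType} {n : nat}.
Implicit Types (D : 'I_n -> 'I_n -> R) (c : 'I_n -> spacetime R -> R)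
  (J : 'I_n -> 'I_3 -> spacetime R -> R) (u : 'I_n -> 'I_3 -> spacetime R -> R)
  (p : 'I_3 -> R -> R) (q : R -> R) (z : spacetime R).

Definition friction D c J i k z : R :=
  - \sum_(j | j != i) (c j z * J i k z - c i z * J j k z) / D i j.

(** The last two fields say that the average of [g s] against [q (t - s)] only sees
times [s] with [eta <= s - t <= 2 * eta]. *)
Record mollifier (eta : R) p q : Prop := Mollifier {
  moll_p : forall j, profile (p j);
  moll_per : forall j x, p j (x + 1) = p j x;
  moll_q : profile q;
  moll_right : forall r, - eta <= r -> q r = 0;
  moll_left : forall r, r <= - (2 * eta) -> q r = 0
}.

(** What the energy estimate uses of a solution with bounded fluxes: bounded
representatives of the concentrations and fluxes, the algebraic constraints, and
the mass balance and the friction law tested against kernels. The condition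
[z.2 + 2 * eta < S] makes the integrals over [slab S] see the whole support of
the kernel. *)
Record bounded_flux_solution D (B : R) c J : Prop := BoundedFluxSolution {
  sol_bmeas : forall i, bmeas (c i);
  sol_bmeas_flux : forall i k, bmeas (J i k);
  sol_bounds : forall i z, 0 <= c i z <= 1;
  sol_flux_bound : forall i k z, `|J i k z| <= B;
  sol_sum : \forall z \ae leb4, halfspace z -> \sum_i c i z = 1;
  sol_sum_flux : forall k, \forall z \ae leb4, halfspace z -> \sum_i J i k z = 0;
  sol_mass : forall eta p q S z i, mollifier eta p q -> 0 < eta -> 0 <= z.2 ->
    z.2 + 2 * eta < S ->
    mollify S p q^`()%classic (c i) z + \sum_k mollify S (dprof p k) q (J i k) z = 0;
  sol_friction : forall eta p q S z i k, mollifier eta p q -> 0 < eta -> 0 <= z.2 ->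
    z.2 + 2 * eta < S ->
    mollify S (dprof p k) q (c i) z = mollify S p q (friction D c J i k) z
}.

Lemma mollifier_test eta p q z : mollifier eta p q -> 0 < eta -> 0 <= z.2 ->
  interior_test_function (kern p q z).
Proof. by case=> hp per hq qr ql eta0 z0; exact: (@kern_test _ _ _ eta). Qed.

Lemma kern_far p q (eta S : R) z z' : (forall r, r <= - (2 * eta) -> q r = 0) ->
  z.2 + 2 * eta < S -> S <= z'.2 -> kern p q z z' = 0.
Proof. by move=> ql zS Sz'; rewrite /kern ql ?mulr0//; lra. Qed.

Lemma profile_derive_far q (a r : R) : profile q -> (forall r, r <= a -> q r = 0) ->
  r < a -> q^`()%classic r = 0.
Proof.
move=> hq q0 ra; rewrite derive1E; apply: (@derive_val _ _ _ _ _ _ _ _).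
apply: (near_eq_is_derive _ (is_derive_cst (0 : R) r (1 : R))).
near=> y; rewrite q0// ltW//; near: y; exact: lt_nbhsl.
Unshelve. all: by end_near. Qed.

Lemma kern_derive_far p q (eta S : R) z z' : profile q ->
  (forall r, r <= - (2 * eta) -> q r = 0) ->
  z.2 + 2 * eta < S -> S <= z'.2 -> kern p q^`()%classic z z' = 0.
Proof.
by move=> hq ql zS Sz'; rewrite /kern (profile_derive_far hq ql) ?mulr0//; lra.
Qed.

(** When the space is a null set the norm is 0 by convention rather than an essential
supremum, but then the bound holds almost everywhere for a trivial reason. *)
Lemma Lfun_infty_bounded d (T : measurableType d) (mu : {measure set T -> \bar R})
    (f : T -> R) : f \in Lfun mu +oo%E ->
  measurable_fun setT f /\ exists M : R, \forall z \ae mu, `|f z| <= M.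
Proof.
move=> /andP[]; rewrite !inE/= => mf; rewrite /finite_norm unlock => fin.
split; first by [].
move: fin; case: ifPn => [_|].
  by move=> /ess_supr_bounded.
rewrite -leNgt measure_le0 => /eqP mu0 _; exists 0.
by exists setT; split => //; exact: subsetT.
Qed.

(** Truncation turns bounds that hold almost everywhere into bounds that hold
everywhere; the value 0 at times [t <= 0] makes the function measurable on the
whole space. *)
Definition clean_mass c i : spacetime R -> R :=
  (fun z => clip 0 1 (c i z)) \_ halfspace.
Definition clean_flux (B : R) c u i k : spacetime R -> R :=
  (fun z => clip (- B) B (flux c u i k z)) \_ halfspace.

Lemma C2_halfline_id : C2_halfline (@id R) (fun=> 1) (fun=> 0).
Proof.
split.
- by apply: continuous_subspaceT => x; exact: cvg_id.
- by apply: continuous_subspaceT => x; exact: cvg_cst.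
- by apply: continuous_subspaceT => x; exact: cvg_cst.
- by move=> s _; exact: is_derive_id.
- by move=> s _; exact: is_derive_cst.
Qed.

Section Clean.
Variables (D : 'I_n -> 'I_n -> R) (init : 'I_n -> space3 R -> R)
  (c : 'I_n -> spacetime R -> R) (u g : 'I_n -> 'I_3 -> spacetime R -> R).
Hypothesis (sol : renormalized_with_gradient D init c u g)
  (fl : bounded_fluxes c u).

Lemma measurable_flux i k : measurable_fun halfspace (flux c u i k).
Proof.
have [mf _] := Lfun_infty_bounded (fl i k).
by apply/(measurable_restrictT _ measurable_halfspace).
Qed.

(** This function is [sqrt c * (sqrt c * u)], also at the points of the null set
where [c] is negative: there the square root is 0. *)
Lemma measurable_positive_part_flux i k :
  measurable_fun halfspace (fun z => if 0 < c i z then flux c u i k z else 0).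
Proof.
apply: measurable_fun_if => //.
- exact: measurable_halfspace.
- apply: measurable_fun_ltr; first exact: measurable_cst.
  exact: (renorm_measurable sol).
- apply: measurable_funS (@measurable_flux i k); first exact: measurable_halfspace.
  exact: subIsetl.
Qed.

Lemma flux_bound : exists2 B : R, 0 <= B &
  forall i k, \forall z \ae leb4, halfspace z -> `|flux c u i k z| <= B.
Proof.
have /choice[M hM] : forall ik : 'I_n * 'I_3, exists M : R,
    \forall z \ae leb4, `|(flux c u ik.1 ik.2 \_ halfspace) z| <= M.
  by move=> ik; have [] := Lfun_infty_bounded (fl ik.1 ik.2).
exists (\sum_ik `|M ik|); first exact: sumr_ge0.
move=> i k; apply: (aeS _ (hM (i, k))) => z; rewrite patchE => + Qz.
rewrite mem_set// => /le_trans; apply; rewrite (le_trans (ler_norm _))//.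
by rewrite (bigD1 (i, k))//= lerDl sumr_ge0.
Qed.

Lemma clean_mass_ae i : \forall z \ae leb4, halfspace z -> clean_mass c i z = c i z.
Proof.
apply: (aeS _ (renorm_bounds sol i)) => z h Qz.
by rewrite /clean_mass patchE mem_set// clip_id// h.
Qed.

Lemma clean_flux_ae B i k :
  (forall i k, \forall z \ae leb4, halfspace z -> `|flux c u i k z| <= B) ->
  \forall z \ae leb4, halfspace z -> clean_flux B c u i k z = flux c u i k z.
Proof.
move=> hB; apply: (aeS _ (hB i k)) => z h Qz.
by rewrite /clean_flux patchE mem_set// clip_id// -ler_norml h.
Qed.

(** For [beta = id] the term with [beta''] drops out of the renormalized equation,
and so does the initial term, since the kernels vanish near the initial time.
Derivatives of the kernel with respect to its second argument are opposite to
those with respect to its first one, which turns the weak formulation into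
equations between derivatives of mollified fields. *)
Lemma clean_solution : exists2 B : R, 0 <= B &
  bounded_flux_solution D B (clean_mass c) (clean_flux B c u).
Proof.
have [B B0 hB] := flux_bound; exists B => //.
have NB : - B <= B by lra.
have cm := clean_mass_ae.
have cf i k := @clean_flux_ae B i k hB.
have bc i : bmeas (clean_mass c i).
  by apply: bmeas_clip_restrict => //; exact: (renorm_measurable sol).
have bJ i k : bmeas (clean_flux B c u i k).
  by apply: bmeas_clip_restrict => //; exact: measurable_flux.
split => //.
- move=> i z; rewrite /clean_mass patchE; case: ifP => _; last by rewrite lexx ler01.
  by apply: clip_bound; exact: ler01.
- move=> i k z; rewrite /clean_flux patchE; case: ifP => _; last by rewrite normr0.
  by rewrite ler_norml; exact: clip_bound.
- apply: (aeS2 _ (renorm_sum sol) (ae_all_ord cm)) => z h1 h2 Qz.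
  by rewrite -[RHS](h1 Qz); apply: eq_bigr => i _; rewrite h2.
- move=> k; have [_ /(_ k)] := renorm_system sol.
  move=> h; apply: (aeS2 _ h (ae_all_ord (cf^~ k))) => z h1 h2 Qz.
  by rewrite -[RHS](h1 Qz); apply: eq_bigr => i _; rewrite h2.
- move=> eta p q S z i mol eta0 z0 zS.
  have [hp per hq qr ql] := mol.
  have [test [a a0 phi0]] := mollifier_test mol eta0 z0.
  have := renorm_equation sol i test C2_halfline_id; cbv zeta; rewrite -/halfspace.
  set I1 := (X in X + _ + _ + _ = 0); set I2 := (X in _ + X + _ + _ = 0).
  set I3 := (X in _ + _ + X + _ = 0); set I4 := (X in _ + _ + _ + 2 * X = 0).
  have -> : I1 = 0.
    apply: bint0; first exact: measurable_cell.
    by move=> x _; rewrite phi0 ?mulr0// ltW.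
  have -> : I4 = 0.
    apply: bint0; first exact: measurable_halfspace.
    by move=> z' _; rewrite big1// => k _; rewrite mulr0 !mul0r.
  rewrite mulr0 addr0 add0r.
  have -> : I2 = - mollify S p q^`()%classic (clean_mass c i) z.
    rewrite /mollify -bintN//; [|exact: measurable_slab|exact: leb4_slab_fin|
      by apply: bmeas_kernM => //; exact: profile_derive].
    apply: Rint_halfspace_slab.
    + apply: measurable_funM; first exact: (renorm_measurable sol).
      rewrite (_ : dt _ = fun z' => - kern p q^`()%classic z z'); last first.
        by apply/funext => z'; rewrite dt_kern.
      apply: measurableT_comp => //; apply: measurable_funTS.
      by case: (bmeas_kern z hp (profile_derive hq)).
    + by apply: bmeasN; apply: bmeas_kernM => //; exact: profile_derive.
    + apply: (aeS _ (cm i)) => z' h Qz'.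
      by rewrite dt_kern// h// mulrN mulrC.
    + by move=> z' _ Sz'; rewrite (kern_derive_far _ hq ql zS Sz') mul0r oppr0.
  have -> : I3 = - \sum_k mollify S (dprof p k) q (clean_flux B c u i k) z.
    have bkJ k : bmeas (fun z' => kern (dprof p k) q z z' * clean_flux B c u i k z').
      by apply: bmeas_kernM => //; exact: profile_dprof.
    rewrite /mollify -bint_sum//; [|exact: measurable_slab|exact: leb4_slab_fin].
    rewrite -bintN//; [|exact: measurable_slab|exact: leb4_slab_fin|exact: bmeas_sum].
    apply: Rint_halfspace_slab.
    + apply: measurable_sum => k; apply: measurable_funM.
        rewrite (_ : (fun z => _) = fun z => if 0 < c i z then flux c u i k z else 0).
          exact: measurable_positive_part_flux.
        apply/funext => x; rewrite mulr1 /wvel mulrA -expr2; case: ifPn => [c0|].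
          by rewrite sqr_sqrtr// ltW.
        by rewrite -leNgt => c0; rewrite ler0_sqrtr// expr0n mul0r.
      rewrite (_ : dx k _ = fun z' => - kern (dprof p k) q z z'); last first.
        by apply/funext => z'; rewrite dx_kern.
      apply: measurableT_comp => //; apply: measurable_funTS.
      by case: (bmeas_kern z (profile_dprof k hp) hq).
    + by apply: bmeasN; exact: bmeas_sum.
    + apply: (aeS2 _ (ae_all_ord (cf i)) (renorm_bounds sol i)) => z' h1 h2 Qz'.
      rewrite -sumrN; apply: eq_bigr => k _; rewrite dx_kern// h1// mulr1 mulrN.
      rewrite mulrC; congr (- (_ * _)); rewrite /wvel mulrA -expr2 sqr_sqrtr//.
      by have /andP[] := h2 Qz'.
    + move=> z' _ Sz'; rewrite big1 ?oppr0// => k _.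
      by rewrite (kern_far _ ql zS Sz') mul0r.
  by move/eqP; rewrite -opprD oppr_eq0 => /eqP.
- move=> eta p q S z i k mol eta0 z0 zS.
  have [hp per hq qr ql] := mol.
  have test := mollifier_test mol eta0 z0.
  have [+ _] := renorm_system sol => /(_ i k)[_ _ /(_ _ test)].
  rewrite -/halfspace; set I1 := (X in X = _); set I2 := (X in _ = - X).
  have bG : bmeas (friction D (clean_mass c) (clean_flux B c u) i k).
    apply: bmeasN; apply: bmeas_sum => j; apply: bmeasM; last exact: bmeas_cst.
    by apply: bmeasB; exact: bmeasM.
  have -> : I1 = - mollify S (dprof p k) q (clean_mass c i) z.
    have bk : bmeas (fun z' => kern (dprof p k) q z z' * clean_mass c i z').
      by apply: bmeas_kernM => //; exact: profile_dprof.
    rewrite /mollify -bintN//; [|exact: measurable_slab|exact: leb4_slab_fin].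
    apply: Rint_halfspace_slab.
    + apply: measurable_funM; first exact: (renorm_measurable sol).
      rewrite (_ : dx k _ = fun z' => - kern (dprof p k) q z z'); last first.
        by apply/funext => z'; rewrite dx_kern.
      apply: measurableT_comp => //; apply: measurable_funTS.
      by case: (bmeas_kern z (profile_dprof k hp) hq).
    + exact: bmeasN.
    + apply: (aeS _ (cm i)) => z' h Qz'.
      by rewrite dx_kern// h// mulrN mulrC.
    + by move=> z' _ Sz'; rewrite (kern_far _ ql zS Sz') mul0r oppr0.
  have -> : I2 = mollify S p q (friction D (clean_mass c) (clean_flux B c u) i k) z.
    have mc j := renorm_measurable sol j.
    apply: Rint_halfspace_slab.
    + apply: measurable_funM; last first.
        by apply: measurable_funTS; case: (bmeas_kern z hp hq).
      apply: measurableT_comp => //.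
      under eq_fun do rewrite big_mkcond.
      apply: measurable_sum => j; case: (j != i); last exact: measurable_cst.
      apply: measurable_funM; last exact: measurable_cst.
      by apply: measurable_funB; apply: measurable_funM => //; exact: measurable_flux.
    + exact: bmeas_kernM.
    + apply: (aeS2 _ (ae_all_ord cm) (ae_all_ord (cf^~ k))) => z' h1 h2 Qz'.
      rewrite mulrC /friction h1//; congr (_ * - _); last first.
      by apply: eq_bigr => j _; rewrite h1// !h2.
    + by move=> z' _ Sz'; rewrite (kern_far _ ql zS Sz') mul0r.
  by move=> /oppr_inj.
Qed.

Lemma measurable_time_section i (t : R) : 0 < t ->
  measurable_fun (cell : set (space3 R)) (fun x => c i (x, t)).
Proof.
move=> t0.
have m1 : measurable_fun setT (c i \_ halfspace).
  apply/(measurable_restrictT _ measurable_halfspace).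
  exact: (renorm_measurable sol).
have m2 := measurable_fun_pair1 t m1.
apply: (eq_measurable_fun (fun x => (c i \_ halfspace) (x, t))).
  move=> x; rewrite inE => xc; rewrite patchE mem_set//; split => //=.
  by rewrite in_itv/= t0.
exact: measurable_funTS.
Qed.

End Clean.

Lemma clip_contract (x y : R) : `|clip 0 1 x - clip 0 1 y| <= `|x - y|.
Proof.
rewrite /clip /Num.max /Num.min.
by repeat case: ifPn; rewrite -?leNgt => *; rewrite ler_norml; apply/andP; split;
  have := ler_norm (x - y); have := ler_norm (- (x - y)); rewrite normrN; lra.
Qed.

(** Both solutions are close to the initial data in the mean for small times, and
truncation is a contraction. *)
Lemma initial_trace D init c cb u ub g gb i (eps : R) :
  initial_data init -> renormalized_with_gradient D init c u g ->
  renormalized_with_gradient D init cb ub gb -> 0 < eps ->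
  exists2 delta : R, 0 < delta & \forall t \ae leb1, 0 < t < delta ->
    \int[leb3]_(x in cell) `|clean_mass c i (x, t) - clean_mass cb i (x, t)| <= eps.
Proof.
move=> hinit sol solb eps0.
have e2 : 0 < eps / 2 by rewrite divr_gt0.
have [d1 d10 h1] := renorm_initial sol i C2_halfline_id e2.
have [d2 d20 h2] := renorm_initial solb i C2_halfline_id e2.
exists (Num.min d1 d2); first by rewrite lt_min d10.
apply: (aeS2 _ h1 h2) => t + + /andP[t0]; rewrite lt_min => + + /andP[t1 t2].
rewrite t0 t1 t2 => /(_ erefl) H1 /(_ erefl) H2.
have mc := measurable_time_section sol i t0.
have mcb := measurable_time_section solb i t0.
have mi : measurable_fun (cell : set (space3 R)) (init i).
  have [mi _] := Lfun_infty_bounded (init_bounded hinit i).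
  by apply/(measurable_restrictT _ measurable_cell).
have bw : bmeas (fun x => `|clean_mass c i (x, t) - clean_mass cb i (x, t)|).
  apply: bmeas_norm; apply: bmeasB; apply: bmeas_pair1; apply: bmeas_clip_restrict => //.
    exact: (renorm_measurable sol).
  exact: (renorm_measurable solb).
rewrite -lee_fin bint_EFin//; [|exact: measurable_cell|exact: leb3_cell_fin].
apply: (@le_trans _ _ (\int[leb3]_(x in cell) (`|c i (x, t) - init i x|%:E
    + `|cb i (x, t) - init i x|%:E))%E).
  apply: ge0_le_integral => //.
  - exact: measurable_cell.
  - by apply/measurable_EFinP/measurable_funTS; case: bw.
  - by apply: emeasurable_funD; apply/measurable_EFinP; apply: measurableT_comp => //;
      exact: measurable_funB.
  - move=> x xc; rewrite -EFinD lee_fin /clean_mass !patchE mem_set; last first.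
      by split => //=; rewrite in_itv/= t0.
    apply: (le_trans (clip_contract _ _)); rewrite [X in `|_ - X|](_ : _ = cb i (x, t))//.
    by rewrite -(subrKA (init i x)) (distrC (cb i (x, t))) ler_normD.
rewrite ge0_integralD//; last 3 first.
- exact: measurable_cell.
- by apply/measurable_EFinP; apply: measurableT_comp => //; exact: measurable_funB.
- by apply/measurable_EFinP; apply: measurableT_comp => //; exact: measurable_funB.
by rewrite [eps](splitr eps) EFinD leeD// ltW.
Qed.

End FluxSolutions.

(** * Averaging kernels *)

Section KernelMass.
Context {R : realType}.
Implicit Types (h : 'I_3 -> R -> R) (p : 'I_3 -> R -> R) (q : R -> R) (z : spacetime R).

Lemma bmeas_xcoord h : (forall j, bmeas (h j)) ->
  bmeas (fun x : space3 R => \prod_j h j (xcoord j x)).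
Proof.
move=> bh; apply: bmeas_prod => j; apply: (bmeas_comp _ (bh j)).
have := measurable_fun_pair1 (0 : R) (@measurable_coord R j).
exact.
Qed.

Lemma cell_integral_prod h : (forall j, bmeas (h j)) ->
  \int[leb3]_(x in cell) \prod_j h j (xcoord j x) =
  \prod_j \int[leb1]_(s in `[0, 1[%classic) h j s.
Proof.
move=> bh; have bH := bmeas_xcoord bh.
have m1 : measurable (`[0, 1[%classic : set (measurableTypeR R)) by [].
have f1 := @leb1_itv_fin R true true 0 1.
have m2 := measurableX m1 m1.
have f2 := prod_measureX_fin m1 f1 m1 f1.
rewrite [LHS](bint_fubini1 m2 f2 m1 f1 bH).
have E (x : R * R) : \int[leb1]_(y in `[0, 1[%classic) \prod_j h j (xcoord j (x, y)) =
    (\int[leb1]_(s in `[0, 1[%classic) h ord_max s) *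
      (h (inord 0) x.1 * h (inord 1) x.2).
  rewrite mulrC -bintZ; [|exact: m1|exact: f1|exact: bh]; apply: eq_Rintegral => y _.
  rewrite !big_ord_recr big_ord0/= mul1r /xcoord/=.
  by congr (h _ _ * h _ _ * h _ _); apply/val_inj; rewrite //= inordK.
apply: etrans; first by apply: eq_Rintegral => x _; exact: E.
have b0 : bmeas (fun x : R * R => h (inord 0) x.1 * h (inord 1) x.2).
  by apply: bmeasM; apply: (bmeas_comp _ (bh _)); [exact: measurable_fst|exact: measurable_snd].
rewrite bintZ; [|exact: m2|exact: f2|exact: b0].
rewrite [X in _ * X](bint_fubini1 m1 f1 m1 f1 b0).
have E2 (x : R) : \int[leb1]_(y in `[0, 1[%classic) (h (inord 0) x * h (inord 1) y) =
    (\int[leb1]_(s in `[0, 1[%classic) h (inord 1) s) * h (inord 0) x.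
  by rewrite mulrC bintZ; [|exact: m1|exact: f1|exact: bh].
apply: (@etrans _ _ ((\int[leb1]_(s in `[0, 1[%classic) h ord_max s) *
   \int[leb1]_(x in `[0, 1[%classic)
     ((\int[leb1]_(s in `[0, 1[%classic) h (inord 1) s) * h (inord 0) x))).
  by congr (_ * _); apply: eq_Rintegral => x _; exact: E2.
rewrite bintZ; [|exact: m1|exact: f1|exact: bh].
rewrite !big_ord_recr big_ord0/= mul1r mulrC [X in X * _]mulrC.
by congr (_ * _ * _); apply: eq_Rintegral => s _; congr (h _ _);
  apply/val_inj; rewrite //= inordK.
Qed.

Lemma slab_integral_prod S h q : (forall j, bmeas (h j)) -> bmeas q ->
  \int[leb4]_(z in slab S) ((\prod_j h j (xcoord j z.1)) * q z.2) =
  (\prod_j \int[leb1]_(s in `[0, 1[%classic) h j s) *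
    \int[leb1]_(t in `]0, S[%classic) q t.
Proof.
move=> bh bq.
rewrite slab_fubini1; last first.
  apply: bmeasM; first by apply: (bmeas_comp _ (bmeas_xcoord bh)); exact: measurable_fst.
  by apply: (bmeas_comp _ bq); exact: measurable_snd.
have E (x : space3 R) : \int[leb1]_(t in `]0, S[%classic)
    ((\prod_j h j (xcoord j x)) * q t) =
    (\int[leb1]_(t in `]0, S[%classic) q t) * \prod_j h j (xcoord j x).
  by rewrite mulrC -bintZ//; exact: leb1_itv_fin.
apply: etrans; first by apply: eq_Rintegral => x _; exact: E.
rewrite bintZ ?cell_integral_prod 1?mulrC//.
- exact: measurable_cell.
- exact: leb3_cell_fin.
- exact: bmeas_xcoord.
Qed.

End KernelMass.

Section AveragingKernel.
Context {R : realType}.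
Implicit Types (p q : R -> R) (z : spacetime R).

(** Nonnegative kernels of mass 1. The space kernel has second moment at most [eta],
and the time kernel has support of size [2 * eta]. The mass of the time kernel in
its second argument is at most 1 only, because no average is taken at times
outside of [[0, T]]. *)
Record averaging_kernel (T S eta : R) p q : Prop := AveragingKernel {
  avg_moll : mollifier eta (fun=> p) q;
  avg_p_ge0 : forall x, 0 <= p x;
  avg_q_ge0 : forall r, 0 <= q r;
  avg_p_mass : forall x, \int[leb1]_(y in `[0, 1[%classic) p (x - y) = 1;
  avg_p_massC : forall x, \int[leb1]_(y in `[0, 1[%classic) p (y - x) = 1;
  avg_p_moment : forall x, \int[leb1]_(y in `[0, 1[%classic)
    (p (x - y) * sin (pi * (x - y)) ^+ 2) <= eta;
  avg_q_mass : forall t, 0 <= t <= T -> \int[leb1]_(s in `]0, S[%classic) q (t - s) = 1;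
  avg_q_massC : forall s, 0 <= s <= S -> \int[leb1]_(t in `]0, T[%classic) q (t - s) <= 1
}.

Lemma averaging_kernel_exists (T : R) N : 0 <= T ->
  exists p q, averaging_kernel T (T + 3) N.+1%:R^-1 p q.
Proof.
(* the time kernel looks ahead by at most [2 / N.+1%:R], which is less than 3 *)
move=> T0; have eta0 : 0 < N.+1%:R^-1 :> R by rewrite invr_gt0.
have eta1 : N.+1%:R^-1 <= 1 :> R by rewrite invf_le1// ler1n.
have TS : T + 2 * N.+1%:R^-1 <= T + 3.
  by move: (N.+1%:R^-1) eta0 eta1 => e e0 e1; lra.
have [q [hq q0 qr ql [qm qmC]]] := time_kernel eta0 T0 TS.
have [p [hp p0 per pm pm2]] := @space_kernel R N.
exists p, q; split => //; try (by move=> x; have [] := pm x).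
Qed.

Section kernel.
Variables (T S eta : R) (p q : R -> R).
Hypothesis avg : averaging_kernel T S eta p q.
Let K := kern (fun=> p) q.
Let hp : profile p := moll_p (avg_moll avg) ord0.
Let hq : profile q := moll_q (avg_moll avg).

Lemma avg_kern_ge0 z z' : 0 <= K z z'.
Proof. by rewrite mulr_ge0 ?(avg_q_ge0 avg)// prodr_ge0// => j _; exact: (avg_p_ge0 avg). Qed.

Lemma avg_kern_mass z : 0 <= z.2 <= T -> \int[leb4]_(z' in slab S) K z z' = 1.
Proof.
move=> zT; rewrite /K /kern.
rewrite (@slab_integral_prod R S (fun j s => p (xcoord j z.1 - s)) (fun s => q (z.2 - s))).
- by rewrite big1 ?mul1r ?(avg_q_mass avg)// => j _; exact: (avg_p_mass avg).
- by move=> j; exact: profile_bmeas_shiftl.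
- exact: profile_bmeas_shiftl.
Qed.

Lemma avg_kern_massC z' : slab S z' -> \int[leb4]_(z in slab T) K z z' <= 1.
Proof.
move=> /slab_lt/andP[s0 sS]; rewrite /K /kern.
rewrite (@slab_integral_prod R T (fun j s => p (s - xcoord j z'.1)) (fun s => q (s - z'.2))).
- rewrite big1 ?mul1r ?(avg_q_massC avg)//; first by rewrite !ltW.
  by move=> j _; exact: (avg_p_massC avg).
- by move=> j; exact: profile_bmeas_shiftr.
- exact: profile_bmeas_shiftr.
Qed.

Lemma avg_cell_massC z' : \int[leb3]_(x in cell) \prod_j p (xcoord j x - xcoord j z'.1) = 1.
Proof.
rewrite (@cell_integral_prod R (fun j s => p (s - xcoord j z'.1))).
  by rewrite big1// => j _; exact: (avg_p_massC avg).
by move=> j; exact: profile_bmeas_shiftr.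
Qed.

Lemma bmeas_sin_shift (x : R) : bmeas (fun y : R => sin (pi * (x - y)) ^+ 2).
Proof.
have E y : sin (pi * (x - y)) ^+ 2 = 1 - cos (pi * (x - y) + 0) ^+ 2.
  by rewrite addr0 -(cos2Dsin2 (pi * (x - y))) addrAC subrr add0r.
under eq_fun do rewrite E; apply: bmeasB; first exact: bmeas_cst.
apply: bmeasX.
exact: (@profile_bmeas_shiftl R (fun y => cos (pi * y + 0)) x (profile_affine pi 0 (@profile_cos R))).
Qed.

Lemma avg_kern_moment j z : 0 <= z.2 <= T ->
  \int[leb4]_(z' in slab S) (K z z' * sin (pi * (xcoord j z.1 - xcoord j z'.1)) ^+ 2) <= eta.
Proof.
move=> zT.
pose h i s := p (xcoord i z.1 - s) * (if i == j then sin (pi * (xcoord i z.1 - s)) ^+ 2 else 1).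
have bh i : bmeas (h i).
  apply: bmeasM; first exact: profile_bmeas_shiftl.
  by case: (i == j); [exact: bmeas_sin_shift|exact: bmeas_cst].
have -> : \int[leb4]_(z' in slab S) (K z z' * sin (pi * (xcoord j z.1 - xcoord j z'.1)) ^+ 2) =
    \int[leb4]_(z' in slab S) ((\prod_i h i (xcoord i z'.1)) * q (z.2 - z'.2)).
  apply: eq_Rintegral => z' _; rewrite /K /kern /h big_split/= -big_mkcond/= big_pred1_eq.
  by rewrite mulrAC.
rewrite (@slab_integral_prod R S h (fun s => q (z.2 - s)))//; last exact: profile_bmeas_shiftl.
rewrite (avg_q_mass avg)// mulr1 (bigD1 j)//= big1.
  by rewrite mulr1 /h eqxx; exact: (avg_p_moment avg).
move=> i /negPf ij; rewrite /h ij -[RHS](avg_p_mass avg (xcoord i z.1)).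
by apply: eq_Rintegral => s _; rewrite mulr1.
Qed.

End kernel.
End AveragingKernel.

(** * Vanishing of the oscillation *)

Section Oscillation.
Context {R : realType}.
Variables (T S : R) (p q : nat -> R -> R).
Hypotheses (T0 : 0 < T) (TS : T <= S)
  (avg : forall N, averaging_kernel T S N.+1%:R^-1 (p N) (q N)).
Implicit Types (f g : spacetime R -> R) (z : spacetime R).

Let K N := kern (fun=> p N) (q N).
Let hp N : profile (p N) := moll_p (avg_moll (avg N)) ord0.
Let hq N : profile (q N) := moll_q (avg_moll (avg N)).
Let fT := leb4_slab_fin T.
Let fS := leb4_slab_fin S.
Let mT := measurable_slab T.
Let mS := measurable_slab S.

Lemma slabTS : slab T `<=` slab S.
Proof.
move=> [x t] [/= xc]; rewrite !in_itv/= => /andP[t0 tT]; split => //=.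
by rewrite in_itv/= t0 (lt_le_trans tT).
Qed.

Definition avg2 N (G : spacetime R -> spacetime R -> R) : R :=
  \int[leb4]_(z in slab T) \int[leb4]_(z' in slab S) (K N z z' * G z z').

Definition bmeas2 (G : spacetime R -> spacetime R -> R) : Prop :=
  bmeas (fun zz : spacetime R * spacetime R => G zz.1 zz.2).

Let bK2 N : bmeas2 (K N). Proof. exact: bmeas_kern2. Qed.

Let bKG N G : bmeas2 G -> bmeas2 (fun z z' => K N z z' * G z z').
Proof. by move=> bG; apply: bmeasM; [exact: bK2|exact: bG]. Qed.

Let b2 G z : bmeas2 G -> bmeas (G z).
Proof. exact: (@bmeas_pair2 R _ _ _ _ _ z). Qed.

Let b2i G : bmeas2 G -> bmeas (fun z => \int[leb4]_(z' in slab S) G z z').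
Proof. exact: (@bmeas_bint2 R _ _ _ _ leb4 (slab S) mS fS). Qed.

Lemma avg2_le N G H : bmeas2 G -> bmeas2 H ->
  (forall z z', slab T z -> slab S z' -> K N z z' * G z z' <= K N z z' * H z z') ->
  avg2 N G <= avg2 N H.
Proof.
move=> bG bH GH; apply: (@le_bint R _ _ leb4 _ mT fT _ _ (b2i (bKG N bG)) (b2i (bKG N bH))) => z Tz.
apply: (@le_bint R _ _ leb4 _ mS fS _ _ (b2 z (bKG N bG)) (b2 z (bKG N bH))) => z' Sz'.
exact: GH.
Qed.

Lemma avg2D N G H : bmeas2 G -> bmeas2 H ->
  avg2 N (fun z z' => G z z' + H z z') = avg2 N G + avg2 N H.
Proof.
move=> bG bH; rewrite /avg2 -(@bintD R _ _ leb4 _ mT fT _ _ (b2i (bKG N bG)) (b2i (bKG N bH))).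
apply: eq_Rintegral => z _; rewrite -(@bintD R _ _ leb4 _ mS fS _ _ (b2 z (bKG N bG)) (b2 z (bKG N bH))).
by apply: eq_Rintegral => z' _; rewrite mulrDr.
Qed.

Lemma avg2Z N (r : R) G : bmeas2 G -> avg2 N (fun z z' => r * G z z') = r * avg2 N G.
Proof.
move=> bG; rewrite /avg2 -(@bintZ R _ _ leb4 _ mT fT r _ (b2i (bKG N bG))).
apply: eq_Rintegral => z _; rewrite -(@bintZ R _ _ leb4 _ mS fS r _ (b2 z (bKG N bG))).
by apply: eq_Rintegral => z' _; rewrite mulrCA.
Qed.

Let bmeas2_fst g : bmeas g -> bmeas2 (fun z _ => g z).
Proof. by move=> bg; apply: (bmeas_comp _ bg); exact: measurable_fst. Qed.

Let bmeas2_snd g : bmeas g -> bmeas2 (fun _ z' => g z').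
Proof. by move=> bg; apply: (bmeas_comp _ bg); exact: measurable_snd. Qed.

Lemma avg2_fst N g : bmeas g -> avg2 N (fun z _ => g z) = \int[leb4]_(z in slab T) g z.
Proof.
move=> bg; apply: eq_Rintegral => z; rewrite inE => /slab_lt/andP[z0 zT].
transitivity (g z * \int[leb4]_(z' in slab S) K N z z').
  rewrite -(@bintZ R _ _ leb4 _ mS fS (g z) _ (b2 z (bK2 N))).
  by apply: eq_Rintegral => z' _; rewrite mulrC.
by rewrite (avg_kern_mass (avg N)) ?mulr1//; rewrite !ltW.
Qed.

Lemma avg2_snd N g : bmeas g -> (forall z, 0 <= g z) ->
  avg2 N (fun _ z' => g z') <= \int[leb4]_(z in slab S) g z.
Proof.
move=> bg g0; rewrite /avg2.
have bK := bKG N (bmeas2_snd bg).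
rewrite (@bint_swap R _ _ _ _ leb4 leb4 _ _ mT fT mS fS _ bK)/=.
apply: (@le_bint R _ _ leb4 _ mS fS _ _ (@bmeas_bint1 R _ _ _ _ leb4 (slab T) mT fT _ bK) bg) => z' Sz'.
have -> : \int[leb4]_(z in slab T) (K N z z' * g z') =
    g z' * \int[leb4]_(z in slab T) K N z z'.
  rewrite -(@bintZ R _ _ leb4 _ mT fT (g z') _ (@bmeas_pair1 R _ _ _ _ _ z' (bK2 N))).
  by apply: eq_Rintegral => z _; rewrite mulrC.
by rewrite ler_piMr//; exact: (avg_kern_massC (avg N)).
Qed.

(** The modulus of continuity of [f] in the mean, at the scale of the [N]-th
kernel. *)
Definition osc N f : R := avg2 N (fun z z' => `|f z - f z'|).

Let bosc f : bmeas f -> bmeas2 (fun z z' => `|f z - f z'|).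
Proof.
by move=> bf; apply: bmeas_norm; apply: bmeasB; [exact: bmeas2_fst|exact: bmeas2_snd].
Qed.

Lemma osc_ge0 N f : 0 <= osc N f.
Proof.
apply: Rintegral_ge0 => z _; apply: Rintegral_ge0 => z' _.
by rewrite mulr_ge0//; exact: (avg_kern_ge0 (avg N)).
Qed.

(** Both marginals of the kernel have density at most 1, hence the oscillation of
[f - g] is at most twice the integral of [`|f - g|]. *)
Lemma osc_le_near N f g : bmeas f -> bmeas g ->
  osc N f <= osc N g + 2 * \int[leb4]_(z in slab S) `|f z - g z|.
Proof.
move=> bf bg.
have bd : bmeas (fun z => `|f z - g z|) by apply: bmeas_norm; exact: bmeasB.
have b1 := bosc bg; have b3 := bmeas2_fst bd; have b4 := bmeas2_snd bd.
apply: (@le_trans _ _ (avg2 N (fun z z' => `|g z - g z'| + (`|f z - g z| + `|f z' - g z'|)))).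
  apply: avg2_le.
  - exact: bosc.
  - by apply: bmeasD => //; exact: bmeasD.
  - move=> z z' _ _; apply: ler_wpM2l; first exact: (avg_kern_ge0 (avg N)).
    have -> : f z - f z' = (g z - g z') + ((f z - g z) - (f z' - g z')) by ring.
    by apply: (le_trans (ler_normD _ _)); rewrite lerD2l; exact: ler_normB.
rewrite avg2D//; last exact: bmeasD.
rewrite avg2D// lerD2l mulr2n mulrDl mul1r avg2_fst//; apply: lerD.
  by apply: bint_le_support => // z /slabTS.
exact: avg2_snd.
Qed.

Definition vanishing f : Prop :=
  forall e : R, 0 < e -> exists N0, forall N, (N0 <= N)%N -> osc N f <= e.

(** Functions of vanishing oscillation are closed under convergence in the mean. *)
Lemma vanishing_lim f : bmeas f ->
  (forall e : R, 0 < e -> exists g, [/\ bmeas g, vanishing g &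
    \int[leb4]_(z in slab S) `|f z - g z| <= e]) -> vanishing f.
Proof.
move=> bf approx e e0.
have [g [bg vg fg]] := approx (e / 4) (divr_gt0 e0 (ltr0Sn _ 3)).
have [N0 hN] := vg (e / 4) (divr_gt0 e0 (ltr0Sn _ 3)).
exists N0 => N /hN hg; apply: (le_trans (osc_le_near N bf bg)); lra.
Qed.

Lemma vanishing_cvg (g : nat -> spacetime R -> R) f M :
  (forall m, bmeas (g m)) -> (forall m z, `|g m z| <= M) -> bmeas f ->
  (forall m, vanishing (g m)) ->
  (forall z, slab S z -> g m z @[m --> \oo] --> f z) -> vanishing f.
Proof.
move=> bg gM bf vg cg; apply: vanishing_lim => // e e0.
have [M' fM'] : exists M', forall z, `|f z| <= M' by case: bf.
have c0 : \int[leb4]_(z in slab S) `|f z - g m z| @[m --> \oo] -->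
    \int[leb4]_(z in slab S) (0 : R).
  apply: (@cvg_bint _ _ _ leb4 _ mS fS _ _ (M' + M)).
  - by move=> m; have [] := bmeas_norm (bmeasB bf (bg m)).
  - by move=> m z; rewrite normr_id (le_trans (ler_normB _ _))// lerD.
  - exact: bmeas_cst.
  - move=> z Sz; rewrite -(normr0 R) -(subrr (f z)).
    by apply: cvg_norm; apply: cvgB; [exact: cvg_cst|exact: cg].
rewrite Rintegral_cst// mul0r in c0.
have [m _ hm] : \forall m \near \oo, \int[leb4]_(z in slab S) `|f z - g m z| <= e.
  move/cvgrPdist_le : c0 => /(_ e e0); apply: filterS => m.
  by rewrite sub0r normrN; apply: le_trans; exact: ler_norm.
by exists (g m); split => //; apply: hm => /=.
Qed.

(** Vanishing oscillation is inherited by Lipschitz functions of [g]. *)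
Lemma vanishing_le f g (L : R) : bmeas f -> bmeas g -> 0 <= L -> vanishing g ->
  (forall z z', slab S z -> slab S z' -> `|f z - f z'| <= L * `|g z - g z'|) ->
  vanishing f.
Proof.
move=> bf bg L0 vg fg e e0.
have L1 : 0 < L + 1 by rewrite ltr_wpDl.
have [N0 hN] := vg (e / (L + 1)) (divr_gt0 e0 L1).
exists N0 => N /hN hg.
apply: (@le_trans _ _ (avg2 N (fun z z' => L * `|g z - g z'|))).
  apply: avg2_le; first exact: bosc.
    by apply: bmeasZ; exact: bosc.
  move=> z z' /slabTS Sz Sz'; apply: ler_wpM2l; first exact: (avg_kern_ge0 (avg N)).
  exact: fg.
rewrite avg2Z; last exact: bosc.
apply: (@le_trans _ _ (L * (e / (L + 1)))); first exact: ler_wpM2l.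
by rewrite mulrA ler_pdivrMr// mulrC ler_wpM2l ?lerDl// ltW.
Qed.

Lemma vanishingD f g : bmeas f -> bmeas g -> vanishing f -> vanishing g ->
  vanishing (fun z => f z + g z).
Proof.
move=> bf bg vf vg e e0; have e2 : 0 < e / 2 by rewrite divr_gt0.
have [N1 h1] := vf _ e2; have [N2 h2] := vg _ e2.
exists (maxn N1 N2) => N; rewrite geq_max => /andP[/h1 H1 /h2 H2].
have b1 := bosc bf; have b3 := bosc bg.
apply: (@le_trans _ _ (avg2 N (fun z z' => `|f z - f z'| + `|g z - g z'|))).
  apply: avg2_le.
  - by apply: bosc; exact: bmeasD.
  - exact: bmeasD.
  - move=> z z' _ _; apply: ler_wpM2l; first exact: (avg_kern_ge0 (avg N)).
    by rewrite opprD addrACA ler_normD.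
by rewrite (avg2D N b1 b3) [e]splitr lerD.
Qed.

Lemma vanishing_cst (r : R) : vanishing (fun=> r).
Proof.
move=> e e0; exists 0%N => N _; rewrite /osc /avg2 bint0 ?ltW// => z _.
by apply: bint0 => // z' _; rewrite subrr normr0 mulr0.
Qed.

Lemma vanishing_sum (I : Type) (s : seq I) (F : I -> spacetime R -> R) :
  (forall i, bmeas (F i)) -> (forall i, vanishing (F i)) ->
  vanishing (fun z => \sum_(i <- s) F i z).
Proof.
move=> bF vF; elim: s => [|i s IHs].
  by under eq_fun do rewrite big_nil; exact: vanishing_cst.
under eq_fun do rewrite big_cons.
exact: (vanishingD (bF i) (bmeas_sum s xpredT bF) (vF i) IHs).
Qed.

End Oscillation.

Section VanishingOscillation.
Context {R : realType}.
Variables (T S : R) (p q : nat -> R -> R).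
Hypotheses (T0 : 0 < T) (TS : T <= S)
  (avg : forall N, averaging_kernel T S N.+1%:R^-1 (p N) (q N)).
Implicit Types (f g : spacetime R -> R) (z : spacetime R) (A B : set (spacetime R)).

Local Notation vanishing := (vanishing T S p q).
Let fT := leb4_slab_fin T.
Let fS := leb4_slab_fin S.
Let mT := measurable_slab T.
Let mS := measurable_slab S.

Lemma vanishing_ext f g : bmeas f -> bmeas g ->
  (forall z, slab S z -> f z = g z) -> vanishing g -> vanishing f.
Proof.
move=> bf bg fg vg; apply: (vanishing_le TS avg bf bg ler01 vg) => z z' Sz Sz'.
by rewrite mul1r !fg.
Qed.

(** The measurable sets whose indicator has vanishing oscillation; they turn out to
be all measurable sets. *)
Definition regular_sets : set (set (spacetime R)) :=
  [set A | measurable A /\ vanishing \1_A].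

Lemma regular_setU A B : regular_sets A -> regular_sets B -> regular_sets (A `|` B).
Proof.
move=> [mA vA] [mB vB]; split; first exact: measurableU.
have bA := bmeas_indic (R := R) mA; have bB := bmeas_indic (R := R) mB.
have bAB := bmeas_indic (R := R) (measurableU _ _ mA mB).
apply: (vanishing_le TS avg bAB (bmeasD bA bB) ler01 (vanishingD avg bA bB vA vB)) => z z' _ _.
rewrite !indicE !in_setU mul1r.
by case: (z \in A); case: (z \in B); case: (z' \in A); case: (z' \in B);
  rewrite /= ?addr0 ?add0r ?subrr ?subr0 ?sub0r ?normr0 ?normrN //;
  rewrite ?normr1 ?(@ger0_norm _ (1 + 1)) // ?addrK ?normr1 ?opprD ?addrA ?subrr ?sub0r ?normrN ?normr1 ?normr0//; lra.
Qed.

Lemma regular_set0 : regular_sets set0.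
Proof.
split => //; apply: (@vanishing_ext _ (fun=> 0)).
- exact: bmeas_indic.
- exact: bmeas_cst.
- by move=> z _; rewrite indicE in_set0.
- exact: vanishing_cst.
Qed.

(** The indicator of a complement or of a finite union oscillates no more than the
indicators it is made of, and a countable union is the pointwise limit of finite
unions. *)
Lemma regular_sigma_algebra : sigma_algebra setT regular_sets.
Proof.
split.
- exact: regular_set0.
- move=> A [mA vA]; split; first exact: measurableD.
  have mCA : measurable (setT `\` A) by exact: measurableD.
  apply: (vanishing_le TS avg (bmeas_indic mCA) (bmeas_indic mA) ler01 vA) => z z' _ _.
  rewrite setTD !indicE !in_setC mul1r.
  by case: (z \in A); case: (z' \in A); rewrite /= ?subrr ?subr0 ?sub0r ?normrN.
- move=> F rF; have mF i : measurable (F i) by case: (rF i).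
  have mU : measurable (\bigcup_k F k) by exact: bigcupT_measurable.
  split => //.
  pose U m := \big[setU/set0]_(i < m) F i.
  have rU m : regular_sets (U m).
    rewrite /U; elim: m => [|m IHm]; first by rewrite big_ord0; exact: regular_set0.
    rewrite big_ord_recr; exact: (regular_setU IHm (rF m)).
  apply: (@vanishing_cvg _ _ _ _ _ TS avg (fun m => \1_(U m)) _ 1).
  + by move=> m; apply: bmeas_indic; case: (rU m).
  + by move=> m z; rewrite indicE; case: (_ \in _); rewrite ?normr1 ?normr0.
  + exact: bmeas_indic.
  + by move=> m; case: (rU m).
  + move=> z _; have [[k _ Fkz]|nUz] := pselect ((\bigcup_k F k) z).
      apply: cvg_near_cst; exists k.+1 => // m /= km.
      rewrite !indicE !mem_set//; first by exists k.
      rewrite /U -bigcup_mkord; exists k => //.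
    apply: cvg_near_cst; apply: nearW => m.
    rewrite !indicE !memNset//; rewrite /U -bigcup_mkord => -[k _ Fkz].
    by apply: nUz; exists k.
Qed.

(** The indicator is the pointwise limit of the truncations of [m%:R * f], and such a
truncation is a Lipschitz function of [f]. *)
Lemma regular_pos f : bmeas f -> vanishing f -> regular_sets [set z | 0 < f z].
Proof.
move=> bf vf; have mA : measurable [set z | 0 < f z].
  rewrite (_ : [set _ | _] = setT `&` f @^-1` `]0, +oo[).
    by case: bf => mf _; apply: mf.
  by apply/seteqP; split => z /=; rewrite in_itv/= andbT; [|case].
split; first exact: mA.
have bm m : bmeas (fun z => clip 0 1 (m%:R * f z)).
  have [mf _] := bmeasZ m%:R bf; split.
    by apply: measurable_maxr => //; exact: measurable_minr.
  exists 1 => z; have /andP[c0 c1] := clip_bound (m%:R * f z) (@ler01 R).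
  by rewrite ger0_norm.
apply: (@vanishing_cvg _ _ _ _ _ TS avg (fun m z => clip 0 1 (m%:R * f z)) _ 1).
- exact: bm.
- move=> m z; have /andP[c0 c1] := clip_bound (m%:R * f z) (@ler01 R).
  by rewrite ger0_norm.
- exact: bmeas_indic.
- move=> m; apply: (vanishing_le TS avg (bm m) bf (ler0n R m) vf) => z z' _ _.
  apply: (le_trans (clip_contract _ _)).
  by rewrite -mulrBr normrM ger0_norm.
- move=> z _; have [fz|fz] := ltP 0 (f z).
    apply: cvg_near_cst; exists (Num.bound (f z)^-1) => // m /= mb.
    rewrite indicE mem_set//= /clip (min_idPl _) ?(max_idPr _)//.
    rewrite -ler_pdivrMr// div1r; apply: le_trans (_ : (Num.bound (f z)^-1)%:R <= _).
      by apply: ltW; apply: archi_boundP; rewrite invr_ge0 ltW.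
    by rewrite ler_nat.
  apply: cvg_near_cst; apply: nearW => m.
  rewrite indicE memNset/=; last by apply/negP; rewrite -leNgt.
  rewrite /clip (max_idPl _)// ge_min; apply/orP; right.
  by rewrite mulr_ge0_le0.
Qed.

Let K N := kern (fun=> p N) (q N).

Let bK2 N : bmeas2 (K N).
Proof. exact: bmeas_kern2 (fun=> moll_p (avg_moll (avg N)) ord0) (moll_q (avg_moll (avg N))). Qed.

(** The form in which a bound on second moments enters, through
[s <= l + l^-1 * s ^+ 2]. First [l] is chosen, then [N]. *)
Lemma osc_le_inverse (M : R) (o : nat -> R) : 0 <= M ->
  (forall N (l : R), 0 < l -> o N <= l * M + l^-1 * (N.+1%:R^-1 * M)) ->
  forall e : R, 0 < e -> exists N0, forall N, (N0 <= N)%N -> o N <= e.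
Proof.
move=> M0 h e e0; pose l := e / (2 * (M + 1)).
have l0 : 0 < l by rewrite divr_gt0// mulr_gt0// ltr_wpDl.
pose x := 2 * M * l^-1 / e; have x0 : 0 <= x by rewrite !mulr_ge0// ?invr_ge0 ltW.
exists (Num.bound x) => N hN; apply: (le_trans (h N l l0)).
rewrite [leRHS](splitr e); apply: lerD.
  rewrite /l invfM mulrA mulrAC ler_pdivrMr ?ltr_wpDl// ler_wpM2l ?lerDl//.
  by rewrite divr_ge0// ltW.
have xN : x <= N.+1%:R.
  apply: le_trans (_ : (Num.bound x)%:R <= _); first by apply: ltW; exact: archi_boundP.
  by rewrite ler_nat (leq_trans hN).
rewrite mulrCA ler_pdivrMl ?ltr0n//.
move: xN; rewrite /x ler_pdivrMr//.
by move: (l^-1) (N.+1%:R) => r m; lra.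
Qed.

(** A function with period 1 in [xcoord j] which, for [0 <= a < 1], is positive on
the cell exactly where [a < xcoord j z.1]. Periodicity is essential: the space kernels do not
distinguish the two ends of the cell. *)
Definition tent (j : 'I_3) (a : R) z : R :=
  sin (pi * xcoord j z.1) * sin (pi * (xcoord j z.1 - a)).

Lemma bmeas_sin (l : spacetime R -> R) : measurable_fun setT l ->
  bmeas (fun z => sin (l z)).
Proof.
move=> ml; split.
  apply: measurableT_comp ml; apply: continuous_measurable_fun; exact: continuous_sin.
by exists 1 => z; rewrite ler_norml sin_geN1 sin_le1.
Qed.

Lemma bmeas_tent j a : bmeas (tent j a).
Proof.
apply: bmeasM; apply: bmeas_sin; apply: measurable_funM => //.
  exact: measurable_coord.
by apply: measurable_funB; [exact: measurable_coord|exact: measurable_cst].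
Qed.

Lemma sin_product_difference (x y a : R) :
  sin x * sin (x - a) - sin y * sin (y - a) = sin (x - y) * sin (x + y - a).
Proof.
rewrite !(sinB, sinD, cosD).
transitivity (cos a * (sin x ^+ 2 * (cos y ^+ 2 + sin y ^+ 2) - sin y ^+ 2 * (cos x ^+ 2 + sin x ^+ 2))
  - sin a * (sin x * cos x * (cos y ^+ 2 + sin y ^+ 2) - sin y * cos y * (cos x ^+ 2 + sin x ^+ 2))).
  by rewrite !cos2Dsin2; ring.
ring.
Qed.

(** By the product formula, increments of the function are bounded by
[`|sin (pi * (x - y))|], whose square is the moment controlled by the kernel. *)
Lemma vanishing_tent j a : vanishing (tent j a).
Proof.
pose M := fine (leb4 (slab T)); have M0 : 0 <= M by rewrite fine_ge0.
apply: (@osc_le_inverse M) => // N l l0.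
pose s2 z z' : R := sin (pi * (xcoord j z.1 - xcoord j z'.1)) ^+ 2.
have bs2 : bmeas2 s2.
  apply: bmeasX; split.
    apply: measurableT_comp; first by apply: continuous_measurable_fun; exact: continuous_sin.
    apply: measurable_funM => //; apply: measurable_funB.
      exact: (measurableT_comp (measurable_coord j) measurable_fst).
    exact: (measurableT_comp (measurable_coord j) measurable_snd).
  by exists 1 => zz; rewrite ler_norml sin_geN1 sin_le1.
have bcst (r : R) : bmeas2 (fun _ _ => r) by exact: bmeas_cst.
have btent : bmeas2 (fun z z' => `|tent j a z - tent j a z'|).
  apply: bmeas_norm; apply: bmeasB; apply: (bmeas_comp _ (bmeas_tent j a)).
    exact: measurable_fst.
  exact: measurable_snd.
apply: (@le_trans _ _ (avg2 T S p q N (fun z z' => l * 1 + l^-1 * s2 z z'))).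
  apply: (avg2_le avg btent).
    by apply: bmeasD; apply: bmeasZ => //; exact: bcst.
  move=> z z' _ _; apply: ler_wpM2l; first exact: (avg_kern_ge0 (avg N)).
  set s := sin (pi * (xcoord j z.1 - xcoord j z'.1)).
  have h1 : `|tent j a z - tent j a z'| <= `|s|.
    rewrite /tent !(mulrBr pi _ a) sin_product_difference -mulrBr normrM ler_piMr//.
    by rewrite ler_norml sin_geN1 sin_le1.
  apply: (le_trans h1); rewrite mulr1 /s2 -/s.
  have [sl|ls] := leP `|s| l.
    by rewrite ler_wpDr// mulr_ge0// ?sqr_ge0// invr_ge0 ltW.
  have sl : `|s| <= l^-1 * s ^+ 2.
    rewrite mulrC ler_pdivlMr// -(ger0_norm (sqr_ge0 s)) normrX expr2.
    by rewrite ler_wpM2l// ltW.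
  by apply: (le_trans sl); rewrite lerDr ltW.
have bl : bmeas2 (fun _ _ => l * 1) by exact: bmeas_cst.
have bls : bmeas2 (fun z z' => l^-1 * s2 z z') by apply: bmeasZ; exact: bs2.
rewrite (avg2D avg N bl bls) (avg2Z avg N l (bcst 1)) (avg2Z avg N l^-1 bs2).
rewrite (avg2_fst avg N (bmeas_cst _ 1)) Rintegral_cst// mul1r lerD2l.
rewrite ler_pM2l ?invr_gt0//.
apply: (@le_bint_cst R _ _ leb4 _ mT fT _ _
  (@bmeas_bint2 R _ _ _ _ leb4 (slab S) mS fS _ (bmeasM (bK2 N) bs2))).
move=> z /slab_lt/andP[z0 zT]; apply: (avg_kern_moment (avg N)).
by rewrite !ltW.
Qed.

Definition time_step (a : R) z : R := clip 0 1 (z.2 - a).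

Lemma bmeas_time_step a : bmeas (time_step a).
Proof.
split.
  apply: measurable_maxr => //; apply: measurable_minr => //.
  by apply: measurable_funB; [exact: measurable_time|exact: measurable_cst].
exists 1 => z; have /andP[c0 c1] := clip_bound (z.2 - a) (@ler01 R).
by rewrite ger0_norm.
Qed.

(** The function is Lipschitz in time, and the time kernel has support of size
[2 / N.+1%:R]. *)
Lemma vanishing_time_step a : vanishing (time_step a).
Proof.
pose M := fine (leb4 (slab T)); have M0 : 0 <= M by rewrite fine_ge0.
have b0 : bmeas2 (fun z z' => `|time_step a z - time_step a z'|).
  apply: bmeas_norm; apply: bmeasB; apply: (bmeas_comp _ (bmeas_time_step a)).
    exact: measurable_fst.
  exact: measurable_snd.
move=> e e0; pose x := 2 * M / e; have x0 : 0 <= x by rewrite !mulr_ge0// invr_ge0 ltW.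
exists (Num.bound x) => N hN.
have xN : x <= N.+1%:R.
  apply: le_trans (_ : (Num.bound x)%:R <= _); first by apply: ltW; exact: archi_boundP.
  by rewrite ler_nat (leq_trans hN).
apply: (@le_trans _ _ (avg2 T S p q N (fun z z' => 2 * N.+1%:R^-1))).
  apply: (avg2_le avg b0); first exact: bmeas_cst.
  move=> z z' _ _.
  have qr := moll_right (avg_moll (avg N)); have ql := moll_left (avg_moll (avg N)).
  have [h1|h1] := leP (- N.+1%:R^-1) (z.2 - z'.2); first by rewrite /kern qr// mulr0 !mul0r.
  have [h2|h2] := leP (z.2 - z'.2) (- (2 * N.+1%:R^-1)); first by rewrite /kern ql// mulr0 !mul0r.
  apply: ler_wpM2l; first exact: (avg_kern_ge0 (avg N)).
  apply: (le_trans (clip_contract _ _)); rewrite opprD addrACA opprK addNr addr0.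
  have eta0 : 0 < N.+1%:R^-1 :> R by rewrite invr_gt0.
  by rewrite ler_norml; move: (N.+1%:R^-1) eta0 h1 h2 => eta *; apply/andP; split; lra.
rewrite (avg2_fst avg N (bmeas_cst _ _)) Rintegral_cst// -/M mulrAC.
rewrite ler_pdivrMr ?ltr0n//; move: xN; rewrite /x ler_pdivrMr//.
by rewrite [e * _]mulrC.
Qed.

Lemma tent_gt0 j a z : 0 <= a < 1 -> slab S z -> (0 < tent j a z) = (a < xcoord j z.1).
Proof.
move=> /andP[a0 a1] [zc _].
have /andP[x0 x1] : 0 <= xcoord j z.1 < 1.
  case: zc => -[]; rewrite /= !in_itv/= /xcoord => *.
  by case: ifP => // _; case: ifP.
rewrite /tent; move: (xcoord j z.1) x0 x1 => x x0 x1.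
have pi0 := pi_gt0 R.
have [ax|xa] := ltP a x.
  rewrite mulr_gt0// sin_gt0_pi//; apply/andP; split.
  - by rewrite mulr_gt0//; lra.
  - by rewrite -[ltRHS]mulr1 ltr_pM2l.
  - by rewrite mulr_gt0// subr_gt0.
  - by rewrite -[ltRHS]mulr1 ltr_pM2l//; lra.
apply/negbTE; rewrite -leNgt mulr_ge0_le0//.
  apply: sin_ge0_pi; rewrite mulr_ge0//=; last exact: ltW.
  by rewrite -[leRHS]mulr1 ler_pM2l// ltW.
rewrite -opprB mulrN sinN oppr_le0; apply: sin_ge0_pi.
rewrite mulr_ge0//=; [|exact: ltW|by rewrite subr_ge0].
by rewrite -[leRHS]mulr1 ler_pM2l//; lra.
Qed.

Lemma regular_xcoord_gt j a : regular_sets [set z | a < xcoord j z.1].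
Proof.
have mA : measurable [set z : spacetime R | a < xcoord j z.1].
  rewrite (_ : [set _ | _] = setT `&` (fun z : spacetime R => xcoord j z.1) @^-1` `]a, +oo[).
    by apply: measurable_coord.
  by apply/seteqP; split => z /=; rewrite in_itv/= andbT; [|case].
have bA := bmeas_indic (R := R) mA.
split => //.
have xb z : slab S z -> 0 <= xcoord j z.1 < 1.
  move=> [zc _]; case: zc => -[]; rewrite /= !in_itv/= /xcoord => *.
  by case: ifP => // _; case: ifP.
have [a0|a0] := ltP a 0.
  apply: (vanishing_ext bA (bmeas_cst _ 1)); last exact: vanishing_cst.
  move=> z /xb/andP[x0 x1]; rewrite indicE mem_set//=; lra.
have [a1|a1] := ltP a 1; last first.
  apply: (vanishing_ext bA (bmeas_cst _ 0)); last exact: vanishing_cst.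
  by move=> z /xb/andP[x0 x1]; rewrite indicE memNset//=; apply/negP; rewrite -leNgt; lra.
have [mB vB] := regular_pos (bmeas_tent j a) (vanishing_tent j a).
apply: (vanishing_ext bA (bmeas_indic mB) _ vB) => z Sz.
rewrite !indicE; congr (_%:R); congr nat_of_bool; apply/idP/idP; rewrite !inE/=.
  by rewrite tent_gt0// a0.
by rewrite tent_gt0// a0.
Qed.

Lemma regular_time_gt a : regular_sets [set z | a < z.2].
Proof.
have := regular_pos (bmeas_time_step a) (vanishing_time_step a).
rewrite (_ : [set z | 0 < time_step a z] = [set z | a < z.2])//.
apply/seteqP; split => z /=; rewrite /time_step /clip lt_max ltxx/= lt_min ltr01/=.
  by rewrite subr_gt0.
by rewrite subr_gt0.
Qed.

(** The coordinate functions are measurable for the sigma-algebra of regular sets, and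
the Borel sets of a product are generated by the coordinates. *)
Lemma regular_measurable A : measurable A -> regular_sets A.
Proof.
move=> mA.
pose X := g_sigma_algebraType regular_sets.
have mX (B : set X) : measurable B = regular_sets B.
  by rewrite (measurable_g_measurableTypeE regular_sigma_algebra).
have mreal (h : X -> R) : (forall a, regular_sets [set z | a < h z]) ->
    measurable_fun setT h.
  move=> hh; apply: (measurability (@RGenOInfty.G R)).
    exact: RGenOInfty.measurableE.
  move=> _ [_ [a ->] <-]; rewrite setTI mX.
  rewrite (_ : h @^-1` _ = [set z | a < h z]); first exact: hh.
  by apply/seteqP; split => z /=; rewrite in_itv/= andbT.
have mid : measurable_fun setT (fun z : X => (z : spacetime R)).
  apply/measurable_fun_pairP; split; last exact: (mreal (fun z => z.2) regular_time_gt).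
  apply/measurable_fun_pairP; split; last exact: (mreal (fun z => z.1.2) (regular_xcoord_gt (@Ordinal 3 2 isT))).
  apply/measurable_fun_pairP; split.
    exact: (mreal (fun z => z.1.1.1) (regular_xcoord_gt (@Ordinal 3 0 isT))).
  exact: (mreal (fun z => z.1.1.2) (regular_xcoord_gt (@Ordinal 3 1 isT))).
by have := mid measurableT A mA; rewrite setTI mX.
Qed.

(** The sum counts the integers in [[1, y]]; it is used to approximate a function by
indicators of its superlevel sets. *)
Lemma floor_sum (m : nat) (y : R) : 0 <= y <= m%:R ->
  y - 1 <= \sum_(l < m) (l.+1%:R <= y)%R%:R <= y.
Proof.
have low (k : nat) : k%:R <= y -> \sum_(l < k) (l.+1%:R <= y)%R%:R = k%:R :> R.
  move=> ky; rewrite (eq_bigr (fun=> 1)) ?sumr_const ?card_ord// => l _.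
  by rewrite (le_trans _ ky)// ler_nat.
move=> /andP[y0]; elim: m => [|m IHm] ym.
  by rewrite big_ord0 y0 andbT; lra.
rewrite big_ord_recr/=; have [my|my] := leP m.+1%:R y.
  rewrite low; last by apply: le_trans my; rewrite ler_nat.
  by move: ym my; rewrite -natr1 /=; lra.
rewrite addr0; have [ym'|ym'] := leP y m%:R; first exact: IHm.
by rewrite low ?ltW//; move: my; rewrite -natr1; lra.
Qed.

(** A bounded measurable function is a uniform limit of combinations of indicators of
its superlevel sets. *)
Lemma oscillation_vanishes f : bmeas f -> (forall z, 0 <= f z <= 1) -> vanishing f.
Proof.
move=> bf f01; apply: (vanishing_lim TS avg bf) => e e0.
pose M := fine (leb4 (slab S)); have M0 : 0 <= M by rewrite fine_ge0.
pose x := M / e; have x0 : 0 <= x by rewrite !mulr_ge0// invr_ge0 ltW.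
pose m := (Num.bound x).+1.
have m0 : 0 < m%:R :> R by rewrite ltr0n.
pose A (l : nat) := [set z : spacetime R | l.+1%:R <= m%:R * f z].
have mA l : measurable (A l).
  rewrite (_ : A l = setT `&` (fun z => m%:R * f z) @^-1` `[l.+1%:R, +oo[).
    by have [mf _] := bmeasZ m%:R bf; apply: mf.
  by apply/seteqP; split => z /=; rewrite in_itv/= andbT; [|case].
pose g z : R := \sum_(l < m) m%:R^-1 * \1_(A l) z.
have bg : bmeas g by apply: bmeas_sum => l; apply: bmeasZ; exact: bmeas_indic.
exists g; split => //.
  apply: (vanishing_sum avg) => l; first by apply: bmeasZ; exact: bmeas_indic.
  have [_ vA] := regular_measurable (mA l).
  apply: (vanishing_le TS avg _ (bmeas_indic (mA l)) _ vA (L := m%:R^-1)).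
  - by apply: bmeasZ; exact: bmeas_indic.
  - by rewrite invr_ge0.
  - by move=> z z' _ _; rewrite -mulrBr normrM ger0_norm// invr_ge0.
apply: (@le_trans _ _ (m%:R^-1 * M)).
  apply: le_bint_cst => //; first by apply: bmeas_norm; exact: bmeasB.
  move=> z _.
  have gE : g z = m%:R^-1 * \sum_(l < m) (l.+1%:R <= m%:R * f z)%R%:R.
    rewrite mulr_sumr; apply: eq_bigr => l _; congr (_ * _); rewrite indicE.
    by congr (_%:R); congr nat_of_bool; apply/idP/idP; rewrite inE.
  have /floor_sum/andP[h1 h2] : 0 <= m%:R * f z <= m%:R.
    by have /andP[f0 f1] := f01 z; rewrite mulr_ge0//= ler_piMr.
  rewrite gE; move: (\sum_(l < m) _) h1 h2 => s h1 h2.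
  have -> : f z - m%:R^-1 * s = m%:R^-1 * (m%:R * f z - s) by field; rewrite gt_eqF.
  rewrite normrM ger0_norm ?invr_ge0// ler_piMr ?invr_ge0//.
  by rewrite ger0_norm; lra.
rewrite ler_pdivrMl// -ler_pdivrMr//.
apply: le_trans (_ : (Num.bound x)%:R <= _); first by apply: ltW; exact: archi_boundP.
by rewrite ler_nat.
Qed.

End VanishingOscillation.

(** * The weighted energy identity *)

Section LineCalculus.
Context {R : realType}.
Implicit Types (f g : spacetime R -> R) (z v : spacetime R) (a b : R).

(** Continuity along the lines of one direction: all that the fundamental theorem of
calculus along these lines requires. *)
Definition line_continuous v f : Prop :=
  forall z, continuous (fun s : R => f (s *: v + z)).

Lemma line_continuous_derive v f df : (forall z, is_derive z v f (df z)) ->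
  line_continuous v f.
Proof.
move=> dfd z; apply: derivable_continuousT => s.
by have [] := proj1 (@is_derive_lineP R _ f z v s _) (dfd _).
Qed.

Lemma line_continuousD v f g : line_continuous v f -> line_continuous v g ->
  line_continuous v (fun z => f z + g z).
Proof. by move=> cf cg z s; apply: cvgD; [exact: cf|exact: cg]. Qed.

Lemma line_continuousN v f : line_continuous v f -> line_continuous v (fun z => - f z).
Proof. by move=> cf z s; apply: cvgN; exact: cf. Qed.

Lemma line_continuousB v f g : line_continuous v f -> line_continuous v g ->
  line_continuous v (fun z => f z - g z).
Proof. by move=> cf cg; apply: line_continuousD => //; exact: line_continuousN. Qed.

Lemma line_continuousM v f g : line_continuous v f -> line_continuous v g ->
  line_continuous v (fun z => f z * g z).
Proof. by move=> cf cg z s; apply: cvgM; [exact: cf|exact: cg]. Qed.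

Lemma line_continuous_cst v a : line_continuous v (fun=> a).
Proof. by move=> z s; exact: cvg_cst. Qed.

(** The rules of calculus below are stated for functions written pointwise, the form
in which the integrands appear. *)
Lemma isD_M z v f g a b : is_derive z v f a -> is_derive z v g b ->
  is_derive z v (fun z => f z * g z) (f z * b + g z * a).
Proof. by move=> df dg; exact: is_deriveM df dg. Qed.

Lemma isD_B z v f g a b : is_derive z v f a -> is_derive z v g b ->
  is_derive z v (fun z => f z - g z) (a - b).
Proof. by move=> df dg; exact: is_deriveB df dg. Qed.

Lemma isD_Z z v f (r : R) a : is_derive z v f a ->
  is_derive z v (fun z => r * f z) (r * a).
Proof. by move=> df; exact: is_deriveZ df. Qed.

Lemma isD_V z v f a : f z != 0 -> is_derive z v f a ->
  is_derive z v (fun z => (f z)^-1) (- (f z) ^- 2 * a).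
Proof.
move=> fz df; apply/is_derive_line0.
have dl := proj1 (@is_derive_line0 R _ f z v a) df.
have f0 : (fun s : R => f (s *: v + z)) 0 != 0 by rewrite scale0r add0r.
have := @is_deriveV R (fun s : R => f (s *: v + z)) 0 a 1 f0 dl.
by rewrite scale0r add0r.
Qed.

Lemma isD_eq z v f a b : is_derive z v f a -> a = b -> is_derive z v f b.
Proof. by move=> ? <-. Qed.

End LineCalculus.

Section EnergyIdentity.
Context {R : realType}.
Variables (T lam kap : R).
Hypotheses (T0 : 0 < T) (kap0 : 0 < kap) (lam0 : 0 <= lam).
Implicit Types (z : spacetime R) (k : 'I_3).

(** The factor [T - t] removes the boundary term at time [T], and the exponential
makes the derivative as negative as desired compared to the weight itself. *)
Definition weight (t : R) : R := (T - t) * expR (- lam * t).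
Definition weight' (t : R) : R := - expR (- lam * t) - lam * weight t.

Lemma is_derive_exp_time (t : R) :
  is_derive t (1 : R) (fun t => expR (- lam * t)) (- lam * expR (- lam * t)).
Proof.
have := is_derive_affine (is_derive_expR (- lam * t + 0)).
rewrite addr0 mulrC (_ : (fun x => expR (- lam * x + 0)) = fun t => expR (- lam * t))//.
by apply/funext => x; rewrite addr0.
Qed.

Lemma is_derive_weight (t : R) : is_derive t (1 : R) weight (weight' t).
Proof.
have d1 : is_derive t (1 : R) (fun t => T - t) (0 - 1) by exact: is_deriveB.
have := is_deriveM d1 (is_derive_exp_time t).
move/is_derive_eq; apply.
transitivity ((T - t) * (- lam * expR (- lam * t)) + expR (- lam * t) * (0 - 1)) => //.
by rewrite /weight' /weight; ring.
Qed.

Lemma is_derive_time_fun (f : R -> R) (d : R) z : is_derive z.2 (1 : R) f d ->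
  is_derive z et (fun z => f z.2) d.
Proof.
move=> df; apply/is_derive_line0.
have := @is_derive_affine _ f 1 z.2 0 d; rewrite mulr0 add0r => /(_ df).
rewrite mulr1 (_ : (fun x => f (1 * x + z.2)) = fun s => f (s *: et + z).2)//.
by apply/funext => s; rewrite time_line_time mul1r.
Qed.

Lemma is_derive_space_fun (f : R -> R) z k :
  is_derive z (ex k) (fun z => f z.2) 0.
Proof.
apply/is_derive_line0; rewrite (_ : (fun s => _) = cst (f z.2)).
  exact: is_derive_cst.
by apply/funext => s; rewrite time_line.
Qed.

Lemma line_continuous_time_fun (f : R -> R) : continuous f ->
  line_continuous et (fun z => f z.2).
Proof.
move=> cf z s; under eq_fun do rewrite time_line_time.
have : (fun s => f (s + z.2)) = f \o (fun s => s + z.2) by [].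
move=> ->; apply: continuous_comp; last exact: cf.
by apply: cvgD; [exact: cvg_id|exact: cvg_cst].
Qed.

Lemma line_continuous_space_fun (f : R -> R) k :
  line_continuous (ex k) (fun z => f z.2).
Proof. by move=> z s; under eq_fun do rewrite time_line; exact: cvg_cst. Qed.

(** The clipped time agrees with the time where [0 <= t <= T] and makes unbounded
weights bounded. *)
Lemma bmeas_clip_time (f : R -> R) : continuous f ->
  bmeas (fun z : spacetime R => f (clip 0 T z.2)).
Proof.
move=> cf; split.
  apply: measurableT_comp; first exact: continuous_measurable_fun.
  apply: measurable_maxr => //; apply: measurable_minr => //.
have cn : {within `[0, T]%classic, continuous (fun t => `|f t|)}.
  by apply: continuous_subspaceT => t; apply: cvg_norm; exact: cf.
have [c _ hc] := EVT_max (ltW T0) cn.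
exists `|f c| => z; apply: hc; rewrite in_itv/=.
by apply: clip_bound; exact: ltW.
Qed.

Lemma weight_continuous : continuous weight.
Proof. by apply: derivable_continuousT => t; case: (is_derive_weight t). Qed.

Lemma exp_time_continuous : continuous (fun t => expR (- lam * t)).
Proof. by apply: derivable_continuousT => t; case: (is_derive_exp_time t). Qed.

Lemma weight'_continuous : continuous weight'.
Proof.
move=> t; apply: cvgB; first by apply: cvgN; exact: exp_time_continuous.
by apply: cvgM; [exact: cvg_cst|exact: weight_continuous].
Qed.

Variables (C Ct W Wt : spacetime R -> R) (Cx Wx F Fx J Jx : 'I_3 -> spacetime R -> R).
Hypotheses (bC : bmeas C) (bCt : bmeas Ct) (bW : bmeas W) (bWt : bmeas Wt)
  (bCx : forall k, bmeas (Cx k)) (bWx : forall k, bmeas (Wx k))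
  (bF : forall k, bmeas (F k)) (bFx : forall k, bmeas (Fx k))
  (bJ : forall k, bmeas (J k)) (bJx : forall k, bmeas (Jx k)).
Hypotheses (dCt : forall z, is_derive z et C (Ct z))
  (dWt : forall z, is_derive z et W (Wt z))
  (dCx : forall k z, is_derive z (ex k) C (Cx k z))
  (dWx : forall k z, is_derive z (ex k) W (Wx k z))
  (dFx : forall k z, is_derive z (ex k) (F k) (Fx k z))
  (dJx : forall k z, is_derive z (ex k) (J k) (Jx k z)).
Hypotheses (cCt : line_continuous et Ct) (cWt : line_continuous et Wt)
  (cCx : forall k, line_continuous (ex k) (Cx k))
  (cWx : forall k, line_continuous (ex k) (Wx k))
  (cFx : forall k, line_continuous (ex k) (Fx k))
  (cJx : forall k, line_continuous (ex k) (Jx k)).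
Hypotheses (perC : forall k z, C (ex k + z) = C z) (perW : forall k z, W (ex k + z) = W z)
  (perF : forall k z, F k (ex k + z) = F k z) (perJ : forall k z, J k (ex k + z) = J k z).
Hypotheses (C_ge0 : forall z, 0 <= C z)
  (massC : forall z, 0 < z.2 < T -> Ct z = - \sum_k Jx k z)
  (massW : forall z, 0 < z.2 < T -> Wt z = - \sum_k Fx k z).

Let h z := C z + kap.
Let Y z := W z / h z.

Let h_gt0 z : 0 < h z. Proof. by rewrite /h ltr_wpDl. Qed.
Let h_neq0 z : h z != 0. Proof. by rewrite gt_eqF. Qed.

Lemma bmeas_inv_shift : bmeas (fun z => (h z)^-1).
Proof.
have [mC _] := bC; split.
  have mh : measurable_fun setT h by apply: measurable_funD.
  rewrite (_ : (fun x => _) = fun x => (h x) `^ (-1)).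
    exact: measurableT_comp (measurable_powR (-1)) mh.
  by apply/funext => x; rewrite powR_inv1// ltW.
exists kap^-1 => z; have hV : 0 <= (h z)^-1 by rewrite invr_ge0 ltW.
by rewrite ger0_norm// lef_pV2 ?posrE// /h lerDr.
Qed.

Lemma bmeas_density : bmeas Y.
Proof. by apply: bmeasM => //; exact: bmeas_inv_shift. Qed.

Let dY (v : spacetime R) (z : spacetime R) (w c : R) :
  is_derive z v W w -> is_derive z v C c ->
  is_derive z v Y ((w - Y z * c) / h z).
Proof.
move=> dw dc; have dh : is_derive z v h c.
  by have := is_deriveD dc (is_derive_cst kap z v); rewrite addr0.
apply: (isD_eq (isD_M dw (isD_V (h_neq0 z) dh))).
by rewrite /Y; field.
Qed.

Let Yx k z := (Wx k z - Y z * Cx k z) / h z.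
Let Yt z := (Wt z - Y z * Ct z) / h z.

(** Let [th] be the weight. The identity integrates over the slab the divergence of
the field with time component [th * (W * Y)] and space components
[th * (2 * Y * F k - Y ^+ 2 * J k)]. Periodicity removes the boundary terms in
space, and the weight the one at time [T]. The mass balances of [C] and [W]
cancel their derivatives in time against the divergences of [J] and [F]. *)
Lemma energy_identity :
  \int[leb4]_(z in slab T)
    (weight' (clip 0 T z.2) * (W z * Y z) + 2 * weight (clip 0 T z.2) *
      \sum_k (F k z - Y z * J k z) * Yx k z) =
  - T * \int[leb3]_(x in cell) (W (x, 0) * Y (x, 0)).
Proof.
have bY := bmeas_density.
have bth := bmeas_clip_time weight_continuous.
have bth' := bmeas_clip_time weight'_continuous.
have bV := bmeas_inv_shift.
have bYx k : bmeas (Yx k).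
  by apply: bmeasM => //; apply: bmeasB => //; exact: bmeasM.
have dYt z := dY (dWt z) (dCt z); have dYx k z := dY (dWx k z) (dCx k z).
have cYt := line_continuous_derive dYt.
have cYx k := line_continuous_derive (dYx k).
have dV v z c : is_derive z v C c -> is_derive z v (fun z => (h z)^-1) (- (h z) ^- 2 * c).
  move=> dc; apply: isD_V => //.
  by have := is_deriveD dc (is_derive_cst kap z v); rewrite addr0.
have cVx k := line_continuous_derive (fun z => dV _ _ _ (dCx k z)).
have ct z : 0 < z.2 < T -> clip 0 T z.2 = z.2.
  by move=> /andP[z0 zT]; rewrite clip_id// !ltW.
pose gt z := weight' (clip 0 T z.2) * (W z * Y z) +
  weight (clip 0 T z.2) * (2 * Y z * Wt z - Y z ^+ 2 * Ct z).
pose gx k z := weight (clip 0 T z.2) * (2 * Y z * Fx k z - Y z ^+ 2 * Jx k z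
  + 2 * (F k z - Y z * J k z) * Yx k z).
have bgt : bmeas gt.
  apply: bmeasD; apply: bmeasM => //; first exact: bmeasM.
  by apply: bmeasB; apply: bmeasM => //; [exact: bmeasZ|exact: bmeasX].
have bgx k : bmeas (gx k).
  apply: bmeasM => //; apply: bmeasD; last first.
    by apply: bmeasM => //; apply: bmeasZ; apply: bmeasB => //; exact: bmeasM.
  by apply: bmeasB; apply: bmeasM => //; [exact: bmeasZ|exact: bmeasX].
have It : \int[leb4]_(z in slab T) gt z =
    - T * \int[leb3]_(x in cell) (W (x, 0) * Y (x, 0)).
  pose G z := weight z.2 * (W z * Y z).
  pose dG z := weight' z.2 * (W z * Y z) +
    weight z.2 * (2 * Y z * Wt z - Y z * Y z * Ct z).
  have dGd z : is_derive z et G (dG z).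
    apply: (isD_eq (isD_M (is_derive_time_fun (is_derive_weight z.2))
      (isD_M (dWt z) (dYt z)))).
    by rewrite /dG /Y; field.
  have cdG : line_continuous et dG.
    have cW := line_continuous_derive dWt.
    apply: line_continuousD; apply: line_continuousM.
    - exact: line_continuous_time_fun weight'_continuous.
    - exact: line_continuousM.
    - exact: line_continuous_time_fun weight_continuous.
    - apply: line_continuousB; apply: line_continuousM => //.
        by apply: line_continuousM => //; exact: line_continuous_cst.
      exact: line_continuousM.
  have dGg z : 0 < z.2 < T -> dG z = gt z by move=> zT; rewrite /dG /gt ct// expr2.
  rewrite (slab_integral_dt T0 bgt dGg dGd cdG).
  rewrite -bintZ; last 3 first.
  - exact: measurable_cell.
  - exact: leb3_cell_fin.
  - by apply: (@bmeas_pair1 _ _ _ _ _ (fun z => W z * Y z)); exact: bmeasM.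
  apply: eq_Rintegral => x _; rewrite /G /weight /= subrr !mul0r sub0r subr0.
  by rewrite mulr0 expR0 mulr1 mulNr.
have Ix k : \int[leb4]_(z in slab T) gx k z = 0.
  pose G z := weight z.2 * (2 * (Y z * F k z) - Y z * Y z * J k z).
  pose dG z := weight z.2 * (2 * Y z * Fx k z - Y z * Y z * Jx k z
    + 2 * (F k z - Y z * J k z) * Yx k z).
  have dGd z : is_derive z (ex k) G (dG z).
    apply: (isD_eq (isD_M (is_derive_space_fun weight z k)
      (isD_B (isD_Z 2 (isD_M (dYx k z) (dFx k z)))
        (isD_M (isD_M (dYx k z) (dYx k z)) (dJx k z))))).
    by rewrite /dG -/(Yx k z); ring.
  have cF := line_continuous_derive (dFx k).
  have cJ := line_continuous_derive (dJx k).
  have c2 := @line_continuous_cst R (ex k) 2.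
  have cdG : line_continuous (ex k) dG.
    apply: line_continuousM; first exact: line_continuous_space_fun.
    apply: line_continuousD.
      apply: line_continuousB; apply: line_continuousM => //; exact: line_continuousM.
    apply: line_continuousM.
      by apply: line_continuousM => //; apply: line_continuousB => //; exact: line_continuousM.
    apply: line_continuousM => //.
    by apply: line_continuousB => //; exact: line_continuousM.
  have dGg z : 0 < z.2 < T -> dG z = gx k z by move=> zT; rewrite /dG /gx ct// expr2.
  apply: (slab_integral_dx (bgx k) dGg dGd cdG).
  - move=> z; rewrite /G /Y /h perC perW perF perJ.
    by rewrite [(ex k + z).2]add0r.
have Ix0 : \sum_k \int[leb4]_(z in slab T) gx k z = 0 by apply: big1 => k _; exact: Ix.
rewrite -It -[RHS]addr0 -[X in _ = _ + X]Ix0.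
rewrite -bint_sum//; [|exact: measurable_slab|exact: leb4_slab_fin].
rewrite -bintD//; [|exact: measurable_slab|exact: leb4_slab_fin|exact: bmeas_sum].
apply: eq_Rintegral => z; rewrite inE => /slab_lt zT.
have -> : \sum_k gx k z = weight (clip 0 T z.2) * (2 * Y z * (\sum_k Fx k z) -
    Y z ^+ 2 * (\sum_k Jx k z) + 2 * \sum_k (F k z - Y z * J k z) * Yx k z).
  rewrite /gx -mulr_sumr; congr (_ * _).
  rewrite !mulr_sumr -sumrB -big_split; apply: eq_bigr => k _ /=.
  by rewrite (mulrA 2 (_ - _)).
by rewrite /gt massC// massW//; ring.
Qed.

End EnergyIdentity.

(** * Commutators *)

Section Mollification.
Context {R : realType}.
Variables (T S : R) (p q : nat -> R -> R) (N : nat).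
Hypotheses (T0 : 0 < T) (TS : T <= S)
  (avg : forall N, averaging_kernel T S N.+1%:R^-1 (p N) (q N)).
Implicit Types (f g h : spacetime R -> R) (z : spacetime R) (k j : 'I_3).

Let K := kern (fun=> p N) (q N).
Let A := mollify S (fun=> p N) (q N).
Let hp (j : 'I_3) : profile (p N) := moll_p (avg_moll (avg N)) j.
Let hq : profile (q N) := moll_q (avg_moll (avg N)).
Let K_ge0 := avg_kern_ge0 (avg N).

Lemma mollify_line_continuous_x (P : 'I_3 -> R -> R) (Q : R -> R) f k :
  (forall j, profile (P j)) -> profile Q -> bmeas f ->
  line_continuous (ex k) (mollify S P Q f).
Proof.
move=> hP hQ bf.
exact: line_continuous_derive (fun z => is_derive_mollify_x S k z hP hQ bf).
Qed.

Lemma mollify_line_continuous_t (P : 'I_3 -> R -> R) (Q : R -> R) f :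
  (forall j, profile (P j)) -> profile Q -> bmeas f ->
  line_continuous et (mollify S P Q f).
Proof.
move=> hP hQ bf.
exact: line_continuous_derive (fun z => is_derive_mollify_t S z hP hQ bf).
Qed.

Lemma mollify_periodic f k z : A f (ex k + z) = A f z.
Proof.
apply: eq_Rintegral => z' _; congr (_ * _); rewrite /kern; congr (_ * q N _).
  apply: eq_bigr => j _; have := coord_line j k 1 z; rewrite scale1r => ->.
  case: ifP => _; last by rewrite add0r.
  by rewrite -[RHS](moll_per (avg_moll (avg N)) j); congr (p N _); ring.
by congr (_ - _); rewrite /= add0r.
Qed.

Lemma mollify_ge0 f z : (forall z, 0 <= f z) -> 0 <= A f z.
Proof. by move=> f0; apply: Rintegral_ge0 => z' _; rewrite mulr_ge0//; exact: K_ge0. Qed.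

Lemma mollify_cst (r : R) z : 0 <= z.2 <= T -> A (fun=> r) z = r.
Proof.
move=> zT; transitivity (r * \int[leb4]_(z' in slab S) K z z').
  rewrite -bintZ; [|exact: measurable_slab|exact: leb4_slab_fin|exact: bmeas_kern].
  by apply: eq_Rintegral => z' _; rewrite mulrC.
by rewrite (avg_kern_mass (avg N))// mulr1.
Qed.

Lemma mollify_norm_le f g z : bmeas f -> bmeas g ->
  (forall z', slab S z' -> `|f z'| <= g z') -> `|A f z| <= A g z.
Proof.
move=> bf bg fg; apply: le_norm_bint; [exact: measurable_slab|exact: leb4_slab_fin|
  exact: bmeas_kernM|exact: bmeas_kernM|].
move=> z' Sz'; rewrite normrM ger0_norm; last exact: K_ge0.
by apply: ler_wpM2l; [exact: K_ge0|exact: fg].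
Qed.

Lemma mollify_bound f (M : R) z : bmeas f -> (forall z, `|f z| <= M) ->
  0 <= z.2 <= T -> `|A f z| <= M.
Proof.
move=> bf fM zT; rewrite -[leRHS](mollify_cst M zT).
by apply: mollify_norm_le => //; exact: bmeas_cst.
Qed.

(** The density whose integral over [slab T] is the oscillation [osc]. *)
Definition oscillation f z : R := A (fun z' => `|f z - f z'|) z.

Let bdiff f z : bmeas f -> bmeas (fun z' => `|f z - f z'|).
Proof. by move=> bf; apply: bmeas_norm; apply: bmeasB => //; exact: bmeas_cst. Qed.

Lemma oscillation_ge0 f z : 0 <= oscillation f z.
Proof. by apply: Rintegral_ge0 => z' _; rewrite mulr_ge0//; exact: K_ge0. Qed.

Lemma bmeas_oscillation f : bmeas f -> bmeas (oscillation f).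
Proof.
move=> bf.
apply: (@bmeas_bint2 R _ _ _ _ leb4 (slab S) (measurable_slab S) (leb4_slab_fin S)
  (fun zz => K zz.1 zz.2 * `|f zz.1 - f zz.2|)).
apply: bmeasM; first exact: bmeas_kern2.
apply: bmeas_norm; apply: bmeasB; apply: (bmeas_comp _ bf).
  exact: measurable_fst.
exact: measurable_snd.
Qed.

Lemma int_oscillation f : \int[leb4]_(z in slab T) oscillation f z = osc T S p q N f.
Proof. by []. Qed.

Lemma oscillationB f g z : bmeas f -> bmeas g ->
  oscillation (fun z => f z - g z) z <= oscillation f z + oscillation g z.
Proof.
move=> bf bg; rewrite /oscillation /A /mollify -bintD; last 4 first.
- exact: measurable_slab.
- exact: leb4_slab_fin.
- by apply: bmeas_kernM => //; exact: bdiff.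
- by apply: bmeas_kernM => //; exact: bdiff.
apply: le_bint; [exact: measurable_slab|exact: leb4_slab_fin| | |].
- by apply: bmeas_kernM => //; apply: bdiff; exact: bmeasB.
- by apply: bmeasD; apply: bmeas_kernM => //; exact: bdiff.
move=> z' _; rewrite -mulrDr; apply: ler_wpM2l; first exact: K_ge0.
have -> : f z - g z - (f z' - g z') = (f z - f z') - (g z - g z') by ring.
exact: ler_normB.
Qed.

Lemma mollify_close f z : bmeas f -> 0 <= z.2 <= T ->
  `|f z - A f z| <= oscillation f z.
Proof.
move=> bf zT; rewrite -{1}(mollify_cst (f z) zT) -mollifyB//; last exact: bmeas_cst.
by apply: mollify_norm_le => //; [apply: bmeasB => //; exact: bmeas_cst|exact: bdiff].
Qed.

(** Constants commute with mollification, so that [g] may be replaced by [g - g z]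
in both products, at the price of [mollify_close] for the second one. *)
Lemma mollify_commutator g h (M : R) z : bmeas g -> bmeas h ->
  (forall z, `|h z| <= M) -> 0 <= z.2 <= T ->
  `|A (fun z => g z * h z) z - A g z * A h z| <= 2 * M * oscillation g z.
Proof.
move=> bg bh hM zT; have bcst := bmeas_cst _ (g z).
have M0 : 0 <= M by exact: le_trans (hM z).
have -> : A (fun z => g z * h z) z - A g z * A h z =
    - A (fun z' => (g z - g z') * h z') z + (g z - A g z) * A h z.
  rewrite (_ : (fun z' => (g z - g z') * h z') = fun z' => g z * h z' - g z' * h z'); last first.
    by apply/funext => z'; rewrite mulrBl.
  rewrite /A mollifyB//; [|exact: bmeasZ|exact: bmeasM].
  by rewrite mollifyZ//; ring.
apply: (le_trans (ler_normD _ _)); rewrite normrN.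
rewrite (_ : 2 * M * _ = M * oscillation g z + M * oscillation g z); last by ring.
apply: lerD.
  rewrite -[leRHS]mollifyZ//; last exact: bdiff.
  apply: mollify_norm_le => //.
  - by apply: bmeasM => //; exact: bmeasB.
  - by apply: bmeasZ; exact: bdiff.
  - by move=> z' _; rewrite normrM mulrC ler_wpM2r.
rewrite normrM mulrC; apply: ler_pM => //.
  exact: mollify_bound.
exact: mollify_close.
Qed.

End Mollification.

Section FrictionMatrix.
Context {R : realType} {n : nat}.

(** In the friction term the diagonal entries are multiplied by 0; they are set to
[delta], so that all entries have a common positive lower bound. The value of
[mu] solves [(5 * Lam * n + delta) * mu = delta]. *)
Lemma friction_matrix (D : 'I_n -> 'I_n -> R) :
  (forall i j, i != j -> D i j = D j i) -> (forall i j, i != j -> 0 < D i j) ->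
  exists (a : 'I_n -> 'I_n -> R) (delta Lam mu : R),
    [/\ (forall i j, i != j -> a i j = (D i j)^-1), (forall i j, a i j = a j i),
      (forall i j, delta <= a i j <= Lam), 0 < delta <= Lam &
      0 < mu <= 1 /\ 5 * Lam * n%:R * mu <= delta].
Proof.
move=> Dsym D0.
pose s := \sum_(ij : 'I_n * 'I_n | ij.1 != ij.2) D ij.1 ij.2.
pose r := \sum_(ij : 'I_n * 'I_n | ij.1 != ij.2) (D ij.1 ij.2)^-1.
have s0 : 0 <= s by apply: sumr_ge0 => ij /D0/ltW.
have r0 : 0 <= r by apply: sumr_ge0 => ij /D0/ltW; rewrite invr_ge0.
pose delta := (1 + s)^-1; pose Lam := delta + r.
have d0 : 0 < delta by rewrite invr_gt0 ltr_pwDl.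
have L0 : 0 <= Lam by rewrite addr_ge0// ltW.
pose x := 5 * Lam * n%:R; have x0 : 0 <= x by rewrite !mulr_ge0.
have xd : 0 < x + delta by rewrite ltr_wpDl.
exists (fun i j => if i == j then delta else (D i j)^-1), delta, Lam, (delta / (x + delta)).
split.
- by move=> i j /negPf ->.
- by move=> i j; rewrite eq_sym; case: eqVneq => // /Dsym ->.
- move=> i j; case: eqVneq => [_|ij]; first by rewrite lexx/= /Lam lerDl.
  apply/andP; split.
    rewrite lef_pV2 ?posrE ?D0//; last by rewrite ltr_pwDl.
    apply: (@le_trans _ _ s); last by rewrite lerDr.
    rewrite /s (bigD1 (i, j))//= lerDl.
    by apply: sumr_ge0 => ij' /andP[/D0/ltW].
  apply: (@le_trans _ _ r); last by rewrite lerDr ltW.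
  rewrite /r (bigD1 (i, j))//= lerDl.
  by apply: sumr_ge0 => ij' /andP[/D0/ltW]; rewrite invr_ge0.
- by rewrite d0 lerDl.
- split; first by rewrite divr_gt0//= ler_pdivrMr// mul1r lerDr.
  by rewrite -/x mulrA ler_pdivrMr// [x * delta]mulrC ler_pM2l// lerDl ltW.
Qed.

End FrictionMatrix.

(** * The energy estimate *)

Section EnergyEstimate.
Context {R : realType} {n : nat}.
Variables (T B : R) (p q : nat -> R -> R) (D : 'I_n -> 'I_n -> R).
Let S := T + 3.
Hypotheses (T0 : 0 < T) (B0 : 0 <= B)
  (avg : forall N, averaging_kernel T S N.+1%:R^-1 (p N) (q N))
  (D_sym : forall i j, i != j -> D i j = D j i) (D_gt0 : forall i j, i != j -> 0 < D i j).
Variables (c cb : 'I_n -> spacetime R -> R) (J Jb : 'I_n -> 'I_3 -> spacetime R -> R).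
Hypotheses (sol : bounded_flux_solution D B c J)
  (solb : bounded_flux_solution D B cb Jb).
Implicit Types (i j : 'I_n) (k : 'I_3) (z : spacetime R).

Let TS : T <= S. Proof. by rewrite /S lerDl. Qed.
Let A N := mollify S (fun=> p N) (q N).
Let w i z := c i z - cb i z.
Let f i k z := J i k z - Jb i k z.
Let bc i : bmeas (c i) := sol_bmeas sol i.
Let bcb i : bmeas (cb i) := sol_bmeas solb i.
Let bJ i k : bmeas (J i k) := sol_bmeas_flux sol i k.
Let bJb i k : bmeas (Jb i k) := sol_bmeas_flux solb i k.
Let bw i : bmeas (w i). Proof. exact: bmeasB. Qed.
Let bf i k : bmeas (f i k). Proof. exact: bmeasB. Qed.
Let hP N (j : 'I_3) : profile (p N) := moll_p (avg_moll (avg N)) j.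
Let hQ N : profile (q N) := moll_q (avg_moll (avg N)).

Let bfric (d : 'I_n -> spacetime R -> R) (G : 'I_n -> 'I_3 -> spacetime R -> R) i k :
  (forall i, bmeas (d i)) -> (forall i k, bmeas (G i k)) -> bmeas (friction D d G i k).
Proof.
move=> bd bG; apply: bmeasN; apply: bmeas_sum => j; apply: bmeasM; last exact: bmeas_cst.
by apply: bmeasB; exact: bmeasM.
Qed.

Let time_ok N z : 0 <= z.2 <= T -> z.2 + 2 * N.+1%:R^-1 < S.
Proof.
move=> /andP[_ zT]; have : N.+1%:R^-1 <= 1 :> R by rewrite invf_le1// ler1n.
by rewrite /S; move: (N.+1%:R^-1) => e e1; lra.
Qed.

Let eta_gt0 N : 0 < N.+1%:R^-1 :> R. Proof. by rewrite invr_gt0. Qed.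

Let mass_eq N i z : 0 <= z.2 <= T ->
  mollify S (fun=> p N) (q N)^`()%classic (c i) z =
    - \sum_k mollify S (dprof (fun=> p N) k) (q N) (J i k) z.
Proof.
move=> zT; have /andP[z0 _] := zT.
by apply/eqP; rewrite -addr_eq0; apply/eqP;
  exact: (sol_mass sol i (avg_moll (avg N)) (eta_gt0 N) z0 (time_ok N zT)).
Qed.

Let mass_eqb N i z : 0 <= z.2 <= T ->
  mollify S (fun=> p N) (q N)^`()%classic (cb i) z =
    - \sum_k mollify S (dprof (fun=> p N) k) (q N) (Jb i k) z.
Proof.
move=> zT; have /andP[z0 _] := zT.
by apply/eqP; rewrite -addr_eq0; apply/eqP;
  exact: (sol_mass solb i (avg_moll (avg N)) (eta_gt0 N) z0 (time_ok N zT)).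
Qed.

Let mass_eqw N i z : 0 < z.2 < T ->
  mollify S (fun=> p N) (q N)^`()%classic (w i) z =
    - \sum_k mollify S (dprof (fun=> p N) k) (q N) (f i k) z.
Proof.
move=> /andP[z0 zT]; have zT' : 0 <= z.2 <= T by rewrite !ltW.
rewrite mollifyB//; [|exact: hP|by apply: profile_derive; exact: hQ].
rewrite mass_eq// mass_eqb// opprK addrC -sumrB -sumrN.
apply: eq_bigr => k _; rewrite mollifyB ?opprB//.
by apply: profile_dprof; exact: hP.
Qed.

Let C N i := A N (c i).
Let W N i := A N (w i).
Let F N i k := A N (f i k).
Let E N (a : 'I_n -> 'I_n -> R) i k z :=
  mollify S (dprof (fun=> p N) k) (q N) (w i) z +
  \sum_j (C N j z * F N i k z - C N i z * F N j k z +
    (W N j z * A N (Jb i k) z - W N i z * A N (Jb j k) z)) * a i j.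

Let V N z := \sum_j (oscillation S p q N (c j) z + oscillation S p q N (cb j) z).

(** The friction laws of both solutions express the derivative of [W] as a
mollification of the products [c j * f i + w j * Jb i] and their permutations,
and [E] compares it with the products of the mollified factors. *)
Lemma friction_commutator (a : 'I_n -> 'I_n -> R) (Lam : R) N i k z :
  (forall i j, i != j -> a i j = (D i j)^-1) -> (forall i j, 0 <= a i j <= Lam) ->
  0 <= z.2 <= T -> `|E N a i k z| <= n%:R * (12 * B * Lam) * V N z.
Proof.
move=> aD aL zT; have /andP[z0 _] := zT.
have Lam0 : 0 <= Lam by have /andP[a0] := aL i i; exact: le_trans.
have hp' := @profile_dprof R _ k (hP N).
pose t j z := c j z * f i k z - c i z * f j k z + (w j z * Jb i k z - w i z * Jb j k z).
have bt j : bmeas (t j) by apply: bmeasD; apply: bmeasB; exact: bmeasM.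
rewrite /E.
have -> : mollify S (dprof (fun=> p N) k) (q N) (w i) z =
    - \sum_j A N (t j) z * a i j.
  have bfc := bfric i k bc bJ; have bfcb := bfric i k bcb bJb.
  rewrite (mollifyB S hp' (hQ N) z (bc i) (bcb i)).
  rewrite (sol_friction sol i k (avg_moll (avg N)) (eta_gt0 N) z0 (time_ok N zT)).
  rewrite (sol_friction solb i k (avg_moll (avg N)) (eta_gt0 N) z0 (time_ok N zT)).
  rewrite -(mollifyB S (hP N) (hQ N) z bfc bfcb).
  have -> : (fun z => friction D c J i k z - friction D cb Jb i k z) =
      fun z => - \sum_j a i j * t j z.
    apply/funext => z'; rewrite /friction opprK addrC -opprB; congr (- _).
    rewrite -sumrB [RHS](bigD1 i)//= [X in _ = X + _](_ : _ = 0).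
      rewrite add0r; apply: eq_bigr => j ji.
      by rewrite aD 1?eq_sym// /t /w /f; ring.
    by rewrite /t !subrr addr0 mulr0.
  have bat j : bmeas (fun z => a i j * t j z) by exact: bmeasZ.
  have bsat := bmeas_sum (index_enum 'I_n) xpredT bat.
  rewrite (mollifyN S (hP N) (hQ N) z bsat).
  rewrite (mollify_sum S (hP N) (hQ N) _ _ z bat); congr (- _).
  by apply: eq_bigr => j _; rewrite (mollifyZ S (hP N) (hQ N) _ z (bt j)) mulrC.
rewrite addrC -sumrB.
apply: (le_trans (ler_norm_sum _ _ _)).
rewrite -[n%:R * _ * _]mulrA -[n in leRHS]card_ord mulr_natl -sumr_const.
apply: ler_sum => j _.
have bcf (i1 i2 : 'I_n) : bmeas (fun z => c i1 z * f i2 k z) by exact: bmeasM.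
have bwJ (i1 i2 : 'I_n) : bmeas (fun z => w i1 z * Jb i2 k z) by exact: bmeasM.
have tE : A N (t j) z = A N (fun z => c j z * f i k z) z - A N (fun z => c i z * f j k z) z
    + (A N (fun z => w j z * Jb i k z) z - A N (fun z => w i z * Jb j k z) z).
  rewrite /A -(mollifyB S (hP N) (hQ N) z (bcf j i) (bcf i j)).
  rewrite -(mollifyB S (hP N) (hQ N) z (bwJ j i) (bwJ i j)).
  by rewrite -(mollifyD S (hP N) (hQ N) z (bmeasB (bcf j i) (bcf i j)) (bmeasB (bwJ j i) (bwJ i j))).
have f2 i1 z' : `|f i1 k z'| <= 2 * B.
  rewrite mulr2n mulrDl mul1r; apply: (le_trans (ler_normB _ _)); apply: lerD.
    exact: (sol_flux_bound sol).
  exact: (sol_flux_bound solb).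
have V0 g : 0 <= oscillation S p q N g z by exact: (oscillation_ge0 N avg).
have Vc i1 : oscillation S p q N (c i1) z + oscillation S p q N (cb i1) z <= V N z.
  by rewrite /V (bigD1 i1)//= lerDl; apply: sumr_ge0 => j' _; rewrite addr_ge0.
have h1 i1 i2 : `|A N (fun z => c i1 z * f i2 k z) z - C N i1 z * F N i2 k z| <= 4 * B * V N z.
  apply: (le_trans (mollify_commutator N avg (bc i1) (bf i2 k) (f2 i2) zT)).
  rewrite mulrA; have -> : 2 * 2 * B = 4 * B by ring.
  by apply: ler_wpM2l; [rewrite mulr_ge0|apply: le_trans (Vc i1); rewrite lerDl].
have h2 i1 i2 : `|A N (fun z => w i1 z * Jb i2 k z) z - W N i1 z * A N (Jb i2 k) z| <= 2 * B * V N z.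
  apply: (le_trans (mollify_commutator N avg (bw i1) (bJb i2 k) (sol_flux_bound solb i2 k) zT)).
  apply: ler_wpM2l; first by rewrite mulr_ge0.
  by apply: le_trans (Vc i1); exact: (oscillationB N avg).
rewrite tE -mulrBl normrM; have /andP[a0 aLam] := aL i j; rewrite (ger0_norm a0).
rewrite (_ : 12 * B * Lam * V N z = 12 * B * V N z * Lam); last by ring.
apply: ler_pM => //.
have := h1 j i; have := h1 i j; have := h2 j i; have := h2 i j.
rewrite !ler_norml => /andP[a1 a2] /andP[a3 a4] /andP[a5 a6] /andP[a7 a8].
apply/andP; split; lra.
Qed.

Let zT_ok z : 0 < z.2 < T -> 0 <= z.2 <= T.
Proof. by move=> /andP[? ?]; rewrite !ltW. Qed.

Let C_sum N z : 0 <= z.2 <= T -> \sum_i C N i z = 1.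
Proof.
move=> zT; rewrite /C /A -(mollify_sum S (hP N) (hQ N) _ _ z bc).
rewrite -[RHS](mollify_cst N avg 1 zT).
apply: mollify_ae_eq; [exact: hP|exact: hQ|exact: bmeas_sum|exact: bmeas_cst|].
exact: ae_halfspace_slab (sol_sum sol).
Qed.

Let F_sum N k z : 0 <= z.2 <= T -> \sum_i F N i k z = 0.
Proof.
move=> zT; rewrite /F /A -(mollify_sum S (hP N) (hQ N) _ _ z (bf^~ k)).
rewrite -[RHS](mollify_cst N avg 0 zT).
apply: mollify_ae_eq; [exact: hP|exact: hQ|by apply: bmeas_sum => i; exact: bf|exact: bmeas_cst|].
apply: ae_halfspace_slab.
apply: (aeS2 _ (sol_sum_flux sol k) (sol_sum_flux solb k)) => z' h1 h2 Qz'.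
by rewrite /f sumrB h1// h2// subrr.
Qed.

Let w_le1 i z : `|w i z| <= 1.
Proof.
have /andP[c0 c1] := sol_bounds sol i z; have /andP[cb0 cb1] := sol_bounds solb i z.
by rewrite ler_norml /w; apply/andP; split; lra.
Qed.

Let f_le i k z : `|f i k z| <= 2 * B.
Proof.
rewrite mulr2n mulrDl mul1r; apply: (le_trans (ler_normB _ _)); apply: lerD.
  exact: (sol_flux_bound sol).
exact: (sol_flux_bound solb).
Qed.

Let C_ge0 N i z : 0 <= C N i z.
Proof. by apply: (mollify_ge0 N avg) => z'; have /andP[] := sol_bounds sol i z'. Qed.

Let friction_le (Lam : R) i k z : (forall j, j != i -> 0 <= (D i j)^-1 <= Lam) ->
  0 <= Lam -> `|friction D c J i k z| <= n%:R * (2 * B * Lam).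
Proof.
move=> DL L0; rewrite /friction normrN; apply: (le_trans (ler_norm_sum _ _ _)).
rewrite -[n in leRHS]card_ord mulr_natl -sumr_const big_mkcond.
apply: ler_sum => j _; case: ifP => ji; last by rewrite !mulr_ge0.
have /andP[D0 DLam] := DL j ji.
rewrite normrM (ger0_norm D0); apply: ler_pM => //.
have cJ i1 i2 : `|c i1 z * J i2 k z| <= B.
  rewrite normrM -[leRHS]mul1r; have /andP[c0 c1] := sol_bounds sol i1 z.
  by rewrite (ger0_norm c0); apply: ler_pM => //; exact: (sol_flux_bound sol).
apply: (le_trans (ler_normB _ _)); rewrite (_ : 2 * B = B + B); last by ring.
by apply: lerD.
Qed.

(** The constant does not depend on [N]. The estimate compares two evaluations of the
integral of the energy balance summed over all species: it equals the initial
energy up to the factor [- T] by [energy_identity], and pointwise its integrand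
is at most [- ex / 2 * \sum_i W i ^+ 2] plus a multiple of the oscillation, by
[energy_density_bound] and [friction_commutator]. *)
Lemma energy_estimate : exists2 Kc : R, 0 <= Kc & forall N,
  \int[leb4]_(z in slab T) \sum_i W N i z ^+ 2 <=
  Kc * (\sum_i \int[leb3]_(x in cell) `|W N i (x, 0)| +
    \sum_i (osc T S p q N (c i) + osc T S p q N (cb i))).
Proof.
have [a [delta [Lam [mu [aD asym adL /andP[d0 dL] [muB small]]]]]] :=
  friction_matrix D_sym D_gt0.
have Lam0 : 0 <= Lam by rewrite (le_trans (ltW d0)).
have a0L i j : 0 <= a i j <= Lam.
  by have /andP[h1 ->] := adL i j; rewrite (le_trans (ltW d0)).
pose B1 := n%:R * (2 * B * Lam); have B10 : 0 <= B1 by rewrite !mulr_ge0.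
have [K K0 hK] := energy_density_bound asym adL d0 Lam0 muB small B0 B10.
have /andP[mu0 mu1] := muB.
pose kap := mu ^+ 2; have kap0 : 0 < kap by rewrite exprn_gt0.
have kap1 : kap <= 1 by rewrite exprn_ile1// ltW.
(* three directions, a factor 2 in the energy balance and the bound
   [C i + kap <= 2] add up to 12 *)
pose lam := 12 * K; have lam0 : 0 <= lam by rewrite mulr_ge0.
pose ex := expR (- lam * T); have ex0 : 0 < ex by exact: expR_gt0.
(* a bound for the commutators: weight at most [T], three directions, [n] species,
   and [friction_commutator] for each of them *)
pose K1 := 2 * T * K * (3 * (n%:R * (n%:R * (12 * B * Lam)))).
have K10 : 0 <= K1 by rewrite !mulr_ge0// ltW.
exists (2 / ex * (K1 + T / kap)).
  by rewrite mulr_ge0 ?addr_ge0 ?divr_ge0// ltW.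
move=> N.
have hp := hP N; have hq := hQ N.
have hdp k := profile_dprof k hp.
pose Cx i k := mollify S (dprof (fun=> p N) k) (q N) (c i).
pose Wx i k := mollify S (dprof (fun=> p N) k) (q N) (w i).
pose Y i z := W N i z / (C N i z + kap).
pose G i z := weight' T lam (clip 0 T z.2) * (W N i z * Y i z) +
  2 * weight T lam (clip 0 T z.2) * \sum_k (F N i k z - Y i z * A N (J i k) z) *
    ((Wx i k z - Y i z * Cx i k z) / (C N i z + kap)).
have bA g : bmeas g -> bmeas (A N g) by exact: bmeas_mollify.
have bC i : bmeas (C N i) by exact: bA.
have bW i : bmeas (W N i) by exact: bA.
have bF i k : bmeas (F N i k) by exact: bA.
have bCx i k : bmeas (Cx i k) by exact: bmeas_mollify.
have bWx i k : bmeas (Wx i k) by exact: bmeas_mollify.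
have bV i : bmeas (fun z => (C N i z + kap)^-1).
  by apply: bmeas_inv_shift => // z; exact: C_ge0.
have bY i : bmeas (Y i) by exact: bmeasM.
have bG i : bmeas (G i).
  apply: bmeasD; apply: bmeasM.
  - exact: bmeas_clip_time T0 _ (@weight'_continuous R T lam).
  - exact: bmeasM.
  - by apply: bmeasZ; exact: bmeas_clip_time T0 _ (@weight_continuous R T lam).
  - apply: bmeas_sum => k; apply: bmeasM.
      by apply: bmeasB => //; apply: bmeasM => //; exact: bA.
    by apply: bmeasM => //; apply: bmeasB => //; exact: bmeasM.
have identity i : \int[leb4]_(z in slab T) G i z =
    - T * \int[leb3]_(x in cell) (W N i (x, 0) * Y i (x, 0)).
  apply: (@energy_identity R T lam kap T0 kap0 (C N i)
    (mollify S (fun=> p N) (q N)^`()%classic (c i)) (W N i)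
    (mollify S (fun=> p N) (q N)^`()%classic (w i)) (Cx i) (Wx i) (F N i)
    (fun k => mollify S (dprof (fun=> p N) k) (q N) (f i k)) (fun k => A N (J i k))
    (fun k => mollify S (dprof (fun=> p N) k) (q N) (J i k))) => //.
  - by apply: bmeas_mollify => //; exact: profile_derive.
  - by apply: bmeas_mollify => //; exact: profile_derive.
  - by move=> k; apply: bmeas_mollify.
  - by move=> k; apply: bmeas_mollify.
  - by move=> k; apply: bmeas_mollify.
  - by move=> z; exact: is_derive_mollify_t.
  - by move=> z; exact: is_derive_mollify_t.
  - by move=> k z; exact: is_derive_mollify_x.
  - by move=> k z; exact: is_derive_mollify_x.
  - by move=> k z; exact: is_derive_mollify_x.
  - by move=> k z; exact: is_derive_mollify_x.
  - by apply: mollify_line_continuous_t => //; exact: profile_derive.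
  - by apply: mollify_line_continuous_t => //; exact: profile_derive.
  - by move=> k; apply: mollify_line_continuous_x.
  - by move=> k; apply: mollify_line_continuous_x.
  - by move=> k; apply: mollify_line_continuous_x.
  - by move=> k; apply: mollify_line_continuous_x.
  - by move=> k z; exact: (mollify_periodic N avg).
  - by move=> k z; exact: (mollify_periodic N avg).
  - by move=> k z; exact: (mollify_periodic N avg).
  - by move=> k z; exact: (mollify_periodic N avg).
  - by move=> z /zT_ok; exact: mass_eq.
  - by move=> z; exact: mass_eqw.
have zT0 (x : space3 R) : 0 <= (x, 0 : R).2 <= T by rewrite /= lexx ltW.
have W1 i z : 0 <= z.2 <= T -> `|W N i z| <= 1.
  by move=> zT; exact: (mollify_bound N avg).
have Ck0 i z : 0 < C N i z + kap by rewrite ltr_wpDl.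
have C1 i z : 0 <= z.2 <= T -> C N i z <= 1.
  by move=> zT; rewrite -(C_sum N zT) (bigD1 i)//= lerDl; apply: sumr_ge0.
have density z : 0 < z.2 < T ->
    \sum_i G i z <= - (ex / 2) * (\sum_i W N i z ^+ 2) + K1 * V N z.
  move=> z0T; have zT := zT_ok z0T; have /andP[z0 z1] := z0T.
  pose SW := \sum_i W N i z ^+ 2.
  have SW0 : 0 <= SW by apply: sumr_ge0 => i _; exact: sqr_ge0.
  pose th := weight T lam z.2.
  have e1 : expR (- lam * z.2) <= 1 by rewrite -expR0 ler_expR mulNr oppr_le0 mulr_ge0// ltW.
  have th0 : 0 <= th by rewrite mulr_ge0 ?expR_ge0// subr_ge0 ltW.
  have thT : th <= T.
    by rewrite -[leRHS]mulr1 ler_pM ?expR_ge0// ?subr_ge0 ?ltW// ltrBlDr ltrDl.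
  pose P := \sum_i W N i z * Y i z.
  have SWP : SW / 2 <= P.
    rewrite mulr_suml; apply: ler_sum => i _.
    rewrite /Y mulrA -expr2 ler_wpM2l ?sqr_ge0// lef_pV2 ?posrE//.
    by have := C1 i z zT; lra.
  pose V1 := n%:R * (n%:R * (12 * B * Lam) * V N z).
  have hk k : \sum_i (F N i k z - Y i z * A N (J i k) z) *
      ((Wx i k z - Y i z * Cx i k z) / (C N i z + kap)) <= K * (SW + V1).
    have -> : \sum_i (F N i k z - Y i z * A N (J i k) z) *
        ((Wx i k z - Y i z * Cx i k z) / (C N i z + kap)) =
      \sum_i (F N i k z - W N i z / (C N i z + mu ^+ 2) * A N (J i k) z) *
        ((- (\sum_j (C N j z * F N i k z - C N i z * F N j k z +
            (W N j z * A N (Jb i k) z - W N i z * A N (Jb j k) z)) * a i j)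
        + E N a i k z - W N i z / (C N i z + mu ^+ 2) * Cx i k z) / (C N i z + mu ^+ 2)).
      apply: eq_bigr => i _; congr (_ * ((_ - _) / _)).
      by rewrite /E addrC addrK.
    have CxB i : `|Cx i k z| <= B1.
      rewrite /Cx (sol_friction sol i k (avg_moll (avg N)) (eta_gt0 N) (ltW z0) (time_ok N zT)).
      apply: (mollify_bound N avg) => //; first exact: bfric.
      by move=> z'; apply: friction_le => // j ji; rewrite -aD 1?eq_sym.
    apply: (le_trans (hK (C N ^~ z) (fun i => F N i k z) (W N ^~ z)
      (fun i => A N (J i k) z) (fun i => A N (Jb i k) z) (fun i => Cx i k z)
      (fun i => E N a i k z) _ _ _ _ _ _ _ CxB)) => //.
    - exact: C_sum.
    - exact: F_sum.
    - by move=> i; exact: W1.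
    - by move=> i; apply: (mollify_bound N avg) => // z'; exact: (sol_flux_bound sol).
    - by move=> i; apply: (mollify_bound N avg) => // z'; exact: (sol_flux_bound solb).
    - by move=> i; apply: (mollify_bound N avg).
    apply: ler_wpM2l => //; apply: lerD => //.
    rewrite /V1 -[X in X%:R * (_ * _)]card_ord mulr_natl -sumr_const.
    by apply: ler_sum => i _; exact: (friction_commutator N i k aD a0L zT).
  have -> : \sum_i G i z = (- expR (- lam * z.2) - lam * th) * P +
      2 * th * \sum_k \sum_i (F N i k z - Y i z * A N (J i k) z) *
      ((Wx i k z - Y i z * Cx i k z) / (C N i z + kap)).
    rewrite /G clip_id// big_split/= -mulr_sumr; congr (_ + _).
    by rewrite -mulr_sumr exchange_big.
  apply: (@le_trans _ _ ((- ex - lam * th) * (SW / 2) + 2 * th * (3 * (K * (SW + V1))))).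
    apply: lerD.
      rewrite -!opprD !mulNr lerN2.
      apply: ler_pM => //; last 1 first.
      - by apply: lerD => //; rewrite /ex ler_expR !mulNr lerN2 ler_wpM2l// ltW.
      - by apply: addr_ge0; [exact: ltW|exact: mulr_ge0].
      - by rewrite divr_ge0.
    apply: ler_wpM2l; first by rewrite mulr_ge0.
    apply: (@le_trans _ _ (\sum_(k < 3) K * (SW + V1))).
      by apply: ler_sum => k _; exact: hk.
    by rewrite sumr_const card_ord mulr_natl.
  have V10 : 0 <= K * V1.
    rewrite mulr_ge0// /V1 !mulr_ge0//; apply: sumr_ge0 => j _.
    by rewrite addr_ge0//; exact: (oscillation_ge0 N avg).
  have -> : K1 * V N z = 6 * (T * (K * V1)) by rewrite /K1 /V1; ring.
  have : th * (K * V1) <= T * (K * V1) by apply: ler_wpM2r.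
  rewrite -/SW /lam; nra.
have bSW : bmeas (fun z => \sum_i W N i z ^+ 2) by apply: bmeas_sum => i; exact: bmeasX.
have bVN : bmeas (V N).
  by apply: bmeas_sum => j; apply: bmeasD; exact: (bmeas_oscillation N avg).
set ISW := \int[leb4]_(z in slab T) _.
have mT := measurable_slab T; have fT := leb4_slab_fin T.
have upper : \int[leb4]_(z in slab T) (\sum_i G i z) <=
    - (ex / 2) * ISW + K1 * \sum_i (osc T S p q N (c i) + osc T S p q N (cb i)).
  have -> : \sum_i (osc T S p q N (c i) + osc T S p q N (cb i)) =
      \int[leb4]_(z in slab T) V N z.
    rewrite /V bint_sum//; last by move=> j; apply: bmeasD; exact: (bmeas_oscillation N avg).
    apply: eq_bigr => j _; rewrite bintD//; exact: (bmeas_oscillation N avg).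
  rewrite -!bintZ// -bintD//; [|exact: bmeasZ|exact: bmeasZ].
  apply: le_bint => //; [exact: bmeas_sum|by apply: bmeasD; exact: bmeasZ|].
  by move=> z [_]; rewrite /= in_itv/= => /density.
have lower : - (T / kap * \sum_i \int[leb3]_(x in cell) `|W N i (x, 0)|) <=
    \int[leb4]_(z in slab T) (\sum_i G i z).
  rewrite bint_sum// (eq_bigr _ (fun i _ => identity i)) -mulr_sumr mulNr lerN2 -mulrA.
  apply: ler_wpM2l; first exact: ltW.
  rewrite mulr_sumr; apply: ler_sum => i _.
  have mc := @measurable_cell R; have fc := @leb3_cell_fin R.
  have bW0 : bmeas (fun x => `|W N i (x, 0)|) by apply: bmeas_norm; exact: bmeas_pair1.
  rewrite -bintZ//; apply: le_bint => //.
  - by apply: (@bmeas_pair1 _ _ _ _ _ (fun z => W N i z * Y i z)); exact: bmeasM.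
  - exact: bmeasZ.
  move=> x _; rewrite /Y mulrA -expr2 -real_normK ?num_real// mulrC expr2.
  apply: ler_pM.
  - by rewrite invr_ge0 ltW.
  - by rewrite mulr_ge0.
  - by rewrite lef_pV2 ?posrE// lerDr.
  - by rewrite -[leRHS]mulr1 ler_wpM2l// W1.
set I0 := \sum_i \int[leb3]_(x in cell) `|W N i (x, 0)| in lower *.
set VV := \sum_i (osc T S p q N (c i) + osc T S p q N (cb i)) in upper *.
have I00 : 0 <= I0 by apply: sumr_ge0 => i _; exact: Rintegral_ge0.
have VV0 : 0 <= VV.
  by apply: sumr_ge0 => i _; rewrite addr_ge0//; exact: (osc_ge0 avg).
have : ex / 2 * ISW <= K1 * VV + T / kap * I0 by move: lower upper; lra.
rewrite -ler_pdivlMl; last by rewrite divr_gt0.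
move=> /le_trans; apply; rewrite invf_div -[leRHS]mulrA ler_wpM2l//.
  by rewrite divr_ge0// ltW.
have : 0 <= T / kap by rewrite divr_ge0// ltW.
move: (T / kap) => r r0.
rewrite mulrDl !mulrDr.
have := mulr_ge0 K10 I00; have := mulr_ge0 r0 VV0.
move: (K1 * I0) (K1 * VV) => y y1; lra.
Qed.

End EnergyEstimate.

(** * The initial trace *)

Section InitialTraceMollified.
Context {R : realType}.
Variables (T S : R) (p q : nat -> R -> R).
Hypotheses (T0 : 0 < T)
  (avg : forall N, averaging_kernel T S N.+1%:R^-1 (p N) (q N)).

Lemma bmeas_min d (X : measurableType d) (f : X -> R) (r : R) :
  bmeas f -> bmeas (fun x => Num.min (f x) r).
Proof.
move=> bf; have -> : (fun x => Num.min (f x) r) = fun x => 2^-1 * (f x + r - `|f x - r|).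
  by apply/funext => x; rewrite minr_absE mulrC.
apply: bmeasZ; apply: bmeasB; first by apply: bmeasD => //; exact: bmeas_cst.
by apply: bmeas_norm; apply: bmeasB => //; exact: bmeas_cst.
Qed.

(** The kernel in space has mass 1 in its first argument, so that integrating over the
cell leaves an average in time of the trace of [w]. *)
Lemma mollified_trace_le N (w : spacetime R -> R) : bmeas w ->
  \int[leb3]_(x in cell) `|mollify S (fun=> p N) (q N) w (x, 0)| <=
  \int[leb1]_(s in `]0, S[%classic)
    (q N (0 - s) * \int[leb3]_(y in cell) `|w (y, s)|).
Proof.
move=> bw.
have hp (j : 'I_3) : profile (p N) := moll_p (avg_moll (avg N)) j.
have hq : profile (q N) := moll_q (avg_moll (avg N)).
have baw : bmeas (fun z => `|w z|) by exact: bmeas_norm.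
have mc := @measurable_cell R; have fc := @leb3_cell_fin R.
have mS := measurable_slab S; have fS := leb4_slab_fin S.
pose K := kern (fun=> p N) (q N).
have bK : bmeas (fun xz : space3 R * spacetime R => K (xz.1, 0) xz.2 * `|w xz.2|).
  apply: bmeasM.
    apply: (@bmeas_comp _ _ _ _ _ (fun xz : space3 R * spacetime R => ((xz.1, 0 : R), xz.2))
      (fun zz => K zz.1 zz.2)); last exact: bmeas_kern2.
    apply: measurable_fun_pair; last exact: measurable_snd.
    by apply: measurable_fun_pair; [exact: measurable_fst|exact: measurable_cst].
  by apply: (bmeas_comp _ baw); exact: measurable_snd.
apply: (@le_trans _ _
    (\int[leb3]_(x in cell) mollify S (fun=> p N) (q N) (fun z => `|w z|) (x, 0))).
  have bA f : bmeas f -> bmeas (fun x => mollify S (fun=> p N) (q N) f (x, 0)).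
    by move=> bf; apply: bmeas_pair1; exact: bmeas_mollify.
  apply: le_bint => //; [by apply: bmeas_norm; exact: bA|exact: bA|].
  by move=> x _; apply: (mollify_norm_le N avg).
rewrite [leLHS](@bint_swap R _ _ _ _ leb3 leb4 _ _ mc fc mS fS _ bK)/=.
have bqw : bmeas (fun z : spacetime R => q N (0 - z.2) * `|w z|).
  by apply: bmeasM => //; apply: profile_bmeas_shift => //; exact: measurable_snd.
have -> : \int[leb1]_(s in `]0, S[%classic)
    (q N (0 - s) * \int[leb3]_(y in cell) `|w (y, s)|) =
    \int[leb4]_(z in slab S) (q N (0 - z.2) * `|w z|).
  rewrite (slab_fubini2 S bqw); apply: eq_Rintegral => s _ /=.
  by rewrite bintZ//; exact: (@bmeas_pair1 _ _ _ _ _ (fun z => `|w z|)).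
rewrite le_eqVlt; apply/orP; left; apply/eqP; apply: eq_Rintegral => z _.
transitivity (\int[leb3]_(x in cell) (q N (0 - z.2) * `|w z| *
    \prod_j p N (xcoord j x - xcoord j z.1))).
  by apply: eq_Rintegral => x _; rewrite /K /kern/=; ring.
rewrite bintZ// ?(avg_cell_massC (avg N)) ?mulr1//.
apply: bmeas_prod => j; apply: (bmeas_comp _ (profile_bmeas (hp j))).
apply: measurable_funB; last exact: measurable_cst.
have mx : measurable_fun setT (fun x : space3 R => (x, 0 : R)).
  by apply: measurable_fun_pair; [exact: measurable_id|exact: measurable_cst].
exact: (measurableT_comp (measurable_coord j) mx).
Qed.

(** At time 0 the time kernel only sees times between [N.+1%:R^-1] and
[2 * N.+1%:R^-1], where the trace of [w] is small. *)
Lemma mollified_trace_vanishes (w : spacetime R -> R) (eps : R) : bmeas w -> 0 < eps ->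
  (exists2 delta : R, 0 < delta & \forall t \ae leb1, 0 < t < delta ->
    \int[leb3]_(x in cell) `|w (x, t)| <= eps) ->
  exists N0, forall N, (N0 <= N)%N ->
    \int[leb3]_(x in cell) `|mollify S (fun=> p N) (q N) w (x, 0)| <= eps.
Proof.
move=> bw eps0 [delta delta0 trace].
have [N0 _ hN0] := near_infty_natSinv_lt (PosNum (divr_gt0 delta0 (ltr0n R 2))).
exists N0 => N /hN0 /= Ndelta; apply: (le_trans (mollified_trace_le N bw)).
have hq : profile (q N) := moll_q (avg_moll (avg N)).
have baw : bmeas (fun z => `|w z|) by exact: bmeas_norm.
have mc := @measurable_cell R; have fc := @leb3_cell_fin R.
pose m s := \int[leb3]_(x in cell) `|w (x, s)|.
have bm : bmeas m by exact: (@bmeas_bint1 R _ _ _ _ leb3 cell mc fc _ baw).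
have bq : bmeas (fun s : R => q N (0 - s)) by exact: profile_bmeas_shiftl.
have mI : measurable (`]0, S[%classic : set R) by [].
have fI := leb1_itv_fin false true 0 S.
have -> : \int[leb1]_(s in `]0, S[%classic) (q N (0 - s) * m s) =
    \int[leb1]_(s in `]0, S[%classic) (q N (0 - s) * Num.min (m s) eps).
  apply: bint_ae_eq => //; [by apply: bmeasM; [exact: bq|exact: bm]|by apply: bmeasM; [exact: bq|exact: bmeas_min]|].
  apply: aeS trace => s hs; rewrite /= in_itv/= => /andP[s0 _].
  have [sd|ds] := ltP s delta.
    by rewrite min_l//; apply: hs; rewrite s0.
  rewrite (moll_left (avg_moll (avg N))) ?mul0r//.
  by move: Ndelta; set e := _^-1; lra.
apply: (@le_trans _ _ (\int[leb1]_(s in `]0, S[%classic) (eps * q N (0 - s)))).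
  apply: le_bint => //.
  - by apply: bmeasM; [exact: bq|exact: bmeas_min].
  - by apply: bmeasZ; exact: bq.
  move=> s _; rewrite mulrC ler_wpM2r ?(avg_q_ge0 (avg N))//.
  by rewrite ge_min lexx orbT.
by rewrite bintZ// (avg_q_mass (avg N)) ?mulr1// lexx ltW.
Qed.

End InitialTraceMollified.

Lemma eventually_all (I : finType) (P : I -> nat -> Prop) :
  (forall i, exists N0, forall N, (N0 <= N)%N -> P i N) ->
  exists N0, forall N, (N0 <= N)%N -> forall i, P i N.
Proof.
move=> /choice[N0 hN0]; exists (\max_i N0 i) => N hN i; apply: hN0.
exact: leq_trans (leq_bigmax i) hN.
Qed.

Lemma bounded_flux_solution_le {R : realType} {n : nat} (D : 'I_n -> 'I_n -> R)
    (B B' : R) c J : B <= B' ->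
  bounded_flux_solution D B c J -> bounded_flux_solution D B' c J.
Proof.
move=> BB' [bc bJ c01 JB sc sJ mass fric]; split => // i k z.
exact: le_trans (JB i k z) BB'.
Qed.

Lemma averaging_kernels {R : realType} (T : R) : 0 <= T ->
  exists p q : nat -> R -> R,
    forall N, averaging_kernel T (T + 3) N.+1%:R^-1 (p N) (q N).
Proof.
move=> T0; have h N : exists pq : (R -> R) * (R -> R),
    averaging_kernel T (T + 3) N.+1%:R^-1 pq.1 pq.2.
  by have [p [q pq]] := averaging_kernel_exists N T0; exists (p, q).
have [pq hpq] := choice h.
by exists (fun N => (pq N).1), (fun N => (pq N).2).
Qed.

(** For every [l] in the interval from 0 to 1, [`|w|] is at most the oscillation of
[w] plus [l + l^-1 * W ^+ 2]. The energy estimate makes the integral of the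
oscillation and of [W ^+ 2] smaller than a multiple of [l ^+ 2] if [N] is large,
so the integral of [`|w|] is at most a multiple of [l]. *)
Lemma bounded_flux_uniqueness {R : realType} {n : nat} (T B : R)
    (D : 'I_n -> 'I_n -> R) (c cb : 'I_n -> spacetime R -> R)
    (J Jb : 'I_n -> 'I_3 -> spacetime R -> R) :
  0 < T -> 0 <= B ->
  (forall i j, i != j -> D i j = D j i) -> (forall i j, i != j -> 0 < D i j) ->
  bounded_flux_solution D B c J -> bounded_flux_solution D B cb Jb ->
  (forall i (eps : R), 0 < eps -> exists2 delta : R, 0 < delta &
    \forall t \ae leb1, 0 < t < delta ->
    \int[leb3]_(x in cell) `|c i (x, t) - cb i (x, t)| <= eps) ->
  forall i, \forall z \ae leb4, slab T z -> c i z = cb i z.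
Proof.
move=> T0 B0 Dsym D0 sol solb trace i.
have [p [q avg]] := averaging_kernels (ltW T0).
have [Kc Kc0 energy] := energy_estimate T0 B0 avg Dsym D0 sol solb.
have TS : T <= T + 3 by rewrite lerDl.
pose w i z := c i z - cb i z.
have bc j : bmeas (c j) := sol_bmeas sol j.
have bcb j : bmeas (cb j) := sol_bmeas solb j.
have bw j : bmeas (w j) by exact: bmeasB.
have mT := measurable_slab T; have fT := leb4_slab_fin T.
pose A N := mollify (T + 3) (fun=> p N) (q N).
have bA N f : bmeas f -> bmeas (A N f).
  move=> bf; apply: bmeas_mollify => //; first by move=> j; exact: moll_p (avg_moll (avg N)) j.
  exact: moll_q (avg_moll (avg N)).
pose o N j := osc T (T + 3) p q N (c j) + osc T (T + 3) p q N (cb j).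
have small (e : R) : 0 < e -> exists N,
    (forall j, \int[leb3]_(x in cell) `|A N (w j) (x, 0)| <= e) /\ (forall j, o N j <= 2 * e).
  move=> e0.
  have [N1 hN1] := eventually_all (fun j => mollified_trace_vanishes T0 avg (bw j) e0 (trace j e e0)).
  have [N2 hN2] := eventually_all (fun j => oscillation_vanishes TS avg (bc j) (sol_bounds sol j) e0).
  have [N3 hN3] := eventually_all (fun j => oscillation_vanishes TS avg (bcb j) (sol_bounds solb j) e0).
  pose N := maxn N1 (maxn N2 N3); exists N; split.
    by move=> j; apply: hN1; rewrite leq_maxl.
  move=> j; rewrite /o mulr2n mulrDl mul1r lerD//.
    by apply: hN2; rewrite /N leq_max leq_maxl orbT.
  by apply: hN3; rewrite /N leq_max leq_maxr orbT.
pose I := \int[leb4]_(z in slab T) `|w i z|.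
have b1 : bmeas (fun z => `|w i z|) by exact: bmeas_norm.
have I0 : 0 <= I by exact: Rintegral_ge0.
pose vol := \int[leb4]_(z in slab T) (1 : R).
have vol0 : 0 <= vol by exact: Rintegral_ge0.
pose M := 2 + vol + 3 * n%:R * Kc + 1.
have M0 : 0 < M by rewrite /M ltr_wpDl// !addr_ge0// !mulr_ge0.
have key (l : R) : 0 < l <= 1 -> I <= l * M.
  move=> /andP[l0 l1].
  have [N [tr os]] := small (l ^+ 2) (exprn_gt0 2 l0).
  have bW := bA N _ (bw i).
  have step1 : I <= o N i + \int[leb4]_(z in slab T) `|A N (w i) z|.
    have bo := bmeas_oscillation N avg (bc i); have bob := bmeas_oscillation N avg (bcb i).
    have boo := bmeasD bo bob; have bn := bmeas_norm bW.
    rewrite /o -!int_oscillation -bintD// -bintD//.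
    apply: le_bint => //; first exact: bmeasD.
    move=> z [_]; rewrite /= in_itv/= => /andP[z0 zT].
    have zT' : 0 <= z.2 <= T by rewrite !ltW.
    apply: (@le_trans _ _ (`|w i z - A N (w i) z| + `|A N (w i) z|)).
      by rewrite -{1}[w i z](subrK (A N (w i) z)) ler_normD.
    rewrite lerD2r; apply: (le_trans (mollify_close N avg (bw i) zT')).
    exact: (oscillationB N avg).
  have step2 : \int[leb4]_(z in slab T) `|A N (w i) z| <=
      l * vol + l^-1 * \int[leb4]_(z in slab T) \sum_j A N (w j) z ^+ 2.
    have bs : bmeas (fun z => \sum_j A N (w j) z ^+ 2).
      by apply: bmeas_sum => j; apply: bmeasX; exact: bA.
    have bone := bmeas_cst (spacetime R) (1 : R).
    rewrite /vol -!bintZ// -bintD//; [|exact: bmeasZ|exact: bmeasZ].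
    apply: le_bint => //; [exact: bmeas_norm|by apply: bmeasD; exact: bmeasZ|].
    move=> z _; apply: (@le_trans _ _ (l * 1 + l^-1 * A N (w i) z ^+ 2)); last first.
      rewrite lerD2l; apply: ler_wpM2l; first by rewrite invr_ge0 ltW.
      rewrite (bigD1 i)//= lerDl.
      by apply: sumr_ge0 => j _; exact: sqr_ge0.
    rewrite -real_normK ?num_real//; move: (normr_ge0 (A N (w i) z)); set x := `|_| => x0.
    rewrite mulr1 -(ler_pM2l l0) mulrDr mulVKf ?gt_eqF//.
    rewrite -subr_ge0 (_ : _ - _ = (l - x) ^+ 2 + l * x); last by ring.
    by rewrite addr_ge0 ?sqr_ge0// mulr_ge0// ltW.
  have step3 : \int[leb4]_(z in slab T) \sum_j A N (w j) z ^+ 2 <= 3 * n%:R * Kc * l ^+ 2.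
    apply: (le_trans (energy N)); rewrite [leRHS](_ : _ = Kc * (n%:R * l ^+ 2 + n%:R * (2 * l ^+ 2))); last by ring.
    apply: ler_wpM2l => //.
    rewrite -[X in X%:R * l ^+ 2]card_ord -[X in X%:R * (2 * _)]card_ord !mulr_natl -!sumr_const.
    apply: lerD; apply: ler_sum => j _; first exact: tr.
    by apply: (le_trans (os j)); rewrite mulr_natl.
  have step4 : l^-1 * (3 * n%:R * Kc * l ^+ 2) = l * (3 * n%:R * Kc) by field; exact: lt0r_neq0.
  have l2 : l ^+ 2 <= l by rewrite expr2 ger_pMr.
  have step5 : l^-1 * \int[leb4]_(z in slab T) \sum_j A N (w j) z ^+ 2 <= l * (3 * n%:R * Kc).
    by rewrite -step4 ler_wpM2l// invr_ge0 ltW.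
  apply: (le_trans step1); apply: (@le_trans _ _ (2 * l + (l * vol + l * (3 * n%:R * Kc)))).
    apply: lerD; last by apply: (le_trans step2); rewrite lerD2l.
    by apply: (le_trans (os i)); rewrite ler_pM2l.
  rewrite (_ : l * M = 2 * l + (l * vol + l * (3 * n%:R * Kc)) + l); last by rewrite /M; ring.
  by rewrite lerDl ltW.
have Iz : I = 0.
  apply/le_anti; rewrite I0 andbT; apply/ler_addgt0Pr => e e0; rewrite add0r.
  have l0 : 0 < Num.min 1 (e / M) by rewrite lt_min ltr01 divr_gt0.
  apply: (le_trans (key (Num.min 1 (e / M)) _)).
    by rewrite l0 ge_min lexx.
  rewrite -ler_pdivlMr// ge_min lexx orbT//.
have w0 := @bint_eq0_ae _ _ _ leb4 _ mT fT _ b1 (fun=> normr_ge0 _) Iz.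
apply: (aeS _ w0) => z h /h /eqP.
by rewrite normr_eq0 subr_eq0 => /eqP.
Qed.

Theorem theorem6 (R : realType) (n : nat) (hn : (2 <= n)%N)
  (D : 'I_n -> 'I_n -> R)
  (D_sym : forall i j : 'I_n, i != j -> D i j = D j i)
  (D_gt0 : forall i j : 'I_n, i != j -> 0 < D i j)
  (init : 'I_n -> space3 R -> R)
  (c cb : 'I_n -> spacetime R -> R)
  (u ub : 'I_n -> 'I_3 -> spacetime R -> R)
  (hc0 : initial_data init)
  (hc : renormalized_solution D init c u)
  (hcb : renormalized_solution D init cb ub)
  (hflux : bounded_fluxes c u)
  (hfluxb : bounded_fluxes cb ub) :
  forall i, \forall z \ae leb4,
    cylinder `]0, +oo[%classic z -> c i z = cb i z.
Proof.
move=> i; have [g sol] := hc; have [gb solb] := hcb.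
have [B B0 csol] := clean_solution sol hflux.
have [Bb Bb0 csolb] := clean_solution solb hfluxb.
have BM : B <= Num.max B Bb by rewrite le_max lexx.
have BbM : Bb <= Num.max B Bb by rewrite le_max lexx orbT.
have csolM := bounded_flux_solution_le BM csol.
have csolbM := bounded_flux_solution_le BbM csolb.
have M0 : 0 <= Num.max B Bb by rewrite le_max B0.
have uniq m : \forall z \ae leb4, slab m.+1%:R z -> clean_mass c i z = clean_mass cb i z.
  apply: (bounded_flux_uniqueness _ M0 D_sym D_gt0 csolM csolbM) => // j eps eps0.
  exact: (initial_trace j hc0 sol solb eps0).
(* the half-space [0 < t] is the union of countably many slabs *)
have hall := ae_foralln uniq; have ci := clean_mass_ae sol i; have cbi := clean_mass_ae solb i.
apply: (aeS2 _ hall (aeS2 _ ci cbi)); last by move=> z h1 h2; exact: conj h1 h2.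
move=> z zall [zc zcb] Qz; rewrite -zc// -zcb//.
case: Qz => cz; rewrite /= in_itv/= andbT => z0.
apply: (zall (Num.truncn z.2)); split => //=.
by rewrite in_itv/= z0 truncnS_gt.
Qed.
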